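(* Let $\mathcal W=W_0,W_1,\dots$ be a stellar sequence, with associated $\mathcal O(\mathcal W)$, $\mathcal I(\mathcal W)$ and $\mathcal G(\mathcal W)$. Then: (1) $\mathcal G(\mathcal W)$ is finitely presented (i.e. the $\ell$-ideal $\mathcal I(\mathcal W)$ is finitely generated) iff $\mathcal W$ has only finitely many deletion steps. (2) $\mathcal G(\mathcal W)$ is finitely presented and its maximal spectrum has dimension at most $1$ iff $\mathcal W$ has only finitely many deletion steps and for all large $i$ all simplexes of $W_i$ have at most two elements. (3) $\mathcal G(\mathcal W)$ is simplicial (i.e. it is, up to isomorphism, a finite product of unital $\ell$-groups of the form $(\mathbb Z\frac1n,1)$, $n\geq 1$) iff for all large $i$ every simplex of $W_i$ other than the empty set is a singleton. (4) $\mathcal G(\mathcal W)$ is archimedean iff every rational polyhedron $P$ containing the intersection $\bigcap\mathcal O(\mathcal W)$ of the zerosets of $\mathcal I(\mathcal W)$ also contains some $Q\in\mathcal O(\mathcal W)$. (5) $\mathcal G(\mathcal W)$ is local (i.e. has precisely one maximal $\ell$-ideal) iff $\bigcap\mathcal O(\mathcal W)$ is a singleton. (6) $\mathcal G(\mathcal W)$ is unitally $\ell$-isomorphic to a unital $\ell$-subgroup of $(\mathbb R,1)$ iff $\bigcap\mathcal O(\mathcal W)$ is a singleton $\{z\}$ and every rational polyhedron $P\ni z$ contains some $Q\in\mathcal O(\mathcal W)$. (7) $\mathcal G(\mathcal W)$ is totally ordered iff for some (equivalently, for every) $\nabla$-realization of $W_0$ with $\nabla$ a regular complex, $|\nabla|\subseteq[0,1]^n$,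 and resulting sequence of regular complexes $\nabla=\nabla_0,\nabla_1,\nabla_2,\dots$, the following holds: for all rational polyhedra $P,Q$ with $P\cup Q=[0,1]^n$ there is an integer $i\ge0$ such that either $|\nabla_i|\subseteq P$ or $|\nabla_i|\subseteq Q$.
   Context: Unital $\ell$-groups. A unital $\ell$-group $(G,u)$ is an abelian group $G$ with a lattice structure such that $x+(y\vee z)=(x+y)\vee(x+z)$ for all $x,y,z$, together with a distinguished order-unit $u$, i.e. for every $g\in G$ there is an integer $k\ge 0$ with $g\le ku$. Unital $\ell$-homomorphisms are group homomorphisms preserving $\vee,\wedge$ and the order-unit. An $\ell$-ideal is the kernel of a unital $\ell$-homomorphism. The maximal spectrum is the space of maximal (proper) $\ell$-ideals with the hull-kernel topology. Archimedean: if $kx\le y$ for all integers $k\ge1$ then $x\le0$. $\mathcal M([0,1]^n)$ is the unital $\ell$-group (pointwise operations, order-unit the constant $1$) of continuous piecewise linear functions $f\colon[0,1]^n\to\mathbb R$ with finitely many pieces, each piece affine with integer coefficients. For $f\in\mathcal M([0,1]^n)$ let $\mathcal Z(f)=f^{-1}(0)$. A rational polyhedron in $\mathbb R^n$ is a finite union of convex hulls of finite sets of rational points. Regular complexes. For a rational point $y\in\mathbb R^n$, $\mathrm{den}(y)$ is the least common denominator of its coordinates and $\tilde y=\mathrm{den}(y)(y,1)\in\mathbb Z^{n+1}$. A simplex $\mathrm{conv}(v_0,\dots,v_k)\subseteq\mathbb R^n$ with rational vertices is regular if $\{\tilde v_0,\dots,\tilde v_k\}$ is part of a basis of the free abelian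 group $\mathbb Z^{n+1}$. A regular complex $\Delta$ is a finite (geometric) simplicial complex all of whose simplexes are rational and regular; its support $|\Delta|$ is the union of its simplexes. The Farey mediant of a regular $1$-simplex $\mathrm{conv}(v_0,v_1)$ is the rational point $v$ of it with $\tilde v=\tilde v_0+\tilde v_1$. The blow-up $\Delta_{(p)}$ of $\Delta$ at $p\in|\Delta|$ is obtained by replacing every $T\in\Delta$ containing $p$ by all simplexes $\mathrm{conv}(F\cup\{p\})$, with $F$ a face of $T$ not containing $p$. Weighted complexes and stellar sequences. A weighted abstract simplicial complex is a triple $W=(\mathcal V,\Sigma,\omega)$ where $\mathcal V$ is a finite nonempty set (of vertices), $\Sigma$ is a collection of subsets of $\mathcal V$ (the simplexes of $W$) with union $\mathcal V$ and closed under taking subsets, and $\omega\colon\mathcal V\to\{1,2,3,\dots\}$. For a two-element set $\{v,w\}\in\Sigma$ and $a\notin\mathcal V$, the binary subdivision $(\{v,w\},a)W$ is obtained by adding $a$ to the vertex set, replacing every set $\{v,w,u_1,\dots,u_t\}\in\Sigma$ by the two sets $\{v,a,u_1,\dots,u_t\}$, $\{a,w,u_1,\dots,u_t\}$ and their faces, and extending the weight by $\omega(a)=\omega(v)+\omega(w)$. A sequence $\mathcal W=(W_0,W_1,\dots)$ of weighted abstract simplicial complexes is stellar if each $W_{j+1}$ is obtained from $W_j$ either by deleting a maximal set of $W_j$ (a deletion step; if this set is a singleton $\{v\}$, the vertex $v$ is removed too), or by a binary subdivision, or else $W_{j+1}=W_j$. Construction of $\mathcal G(\mathcal W)$. A $\nabla$-realization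 of $W=(\mathcal V,\Sigma,\omega)$, for $\nabla$ a regular complex, is a bijection $\iota$ from $\mathcal V$ onto the set of vertices of $\nabla$ such that $\mathrm{den}(\iota(v))=\omega(v)$ for all $v$, and $\{w_1,\dots,w_k\}\in\Sigma$ iff $\mathrm{conv}(\iota(w_1),\dots,\iota(w_k))\in\nabla$. Given a stellar sequence $\mathcal W$ and a $\Delta_0$-realization $\iota_0$ of $W_0$ with $|\Delta_0|\subseteq[0,1]^n$, define inductively $\Delta_j$-realizations $\iota_j$ of $W_j$ (this gives the resulting sequence $\Delta_0,\Delta_1,\dots$): if $W_{j+1}$ is obtained by deleting the maximal set $M$, then $\Delta_{j+1}$ is $\Delta_j$ with the simplex $\mathrm{conv}(\iota_j(M))$ deleted and $\iota_{j+1}$ is the restriction of $\iota_j$; if $W_{j+1}=(\{a,b\},c)W_j$, then $\Delta_{j+1}=(\Delta_j)_{(e)}$ with $e$ the Farey mediant of $\mathrm{conv}(\iota_j(a),\iota_j(b))$, and $\iota_{j+1}=\iota_j\cup\{(c,e)\}$; if $W_{j+1}=W_j$ then $\Delta_{j+1}=\Delta_j$, $\iota_{j+1}=\iota_j$. The $\Delta_0$-orbit is $\mathcal O(\mathcal W,\Delta_0)=\{|\Delta_0|\supseteq|\Delta_1|\supseteq\cdots\}$; $\mathcal I(\mathcal W,\Delta_0)=\{f\in\mathcal M([0,1]^n)\mid \mathcal Z(f)\supseteq|\Delta_j|\text{ for some }j\}$, an $\ell$-ideal; and $\mathcal G(\mathcal W,\Delta_0)=\mathcal M([0,1]^n)/\mathcal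 I(\mathcal W,\Delta_0)$. The canonical realization of $W_0$ with vertices $v_1,\dots,v_n$ sends $v_i$ to $e_i/\omega(v_i)$ ($e_i$ the standard basis vectors of $\mathbb R^n$), and its regular complex $\Delta_{W_0}$ consists of the simplexes spanned by the images of the sets in $\Sigma$. $\mathcal O(\mathcal W),\mathcal I(\mathcal W),\mathcal G(\mathcal W)$ denote $\mathcal O(\mathcal W,\Delta_{W_0}),\mathcal I(\mathcal W,\Delta_{W_0}),\mathcal G(\mathcal W,\Delta_{W_0})$. *)

(* Defs.v *)
From HB Require Import structures.
From mathcomp Require Import all_boot all_order all_algebra finmap generic_quotient.
From mathcomp Require Import all_classical reals topology normedtype.

Set Implicit Arguments.
Unset Strict Implicit.
Unset Printing Implicit Defensive.

Import Order.TTheory GRing.Theory Num.Theory.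
Import numFieldNormedType.Exports.

Local Open Scope classical_set_scope.
Local Open Scope quotient_scope.
Local Open Scope ring_scope.

(* The lattice operations are carried by the mixin, as least upper bounds and
   greatest lower bounds, because joining Order.Lattice with GRing.Zmodule is
   rejected by HB (the join would have to sit below Num.RealDomain).  The fixed
   ring display is the one imposed by Num.POrderedZmodule. *)
HB.mixin Record isUnitalLGroup G of Num.POrderedZmodule G := {
  ljoin : G -> G -> G;
  lmeet : G -> G -> G;
  ljoin_lub : forall x y z : G, (ljoin x y <= z) = (x <= z) && (y <= z);
  lmeet_glb : forall x y z : G, (z <= lmeet x y) = (z <= x) && (z <= y);
  addr_ljoin : forall x y z : G, x + ljoin y z = ljoin (x + y) (x + z);
  ounit : G;
  ounitP : forall x : G, exists k : nat, x <= ounit *+ k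
}.

#[short(type="ulGroupType")]
HB.structure Definition UnitalLGroup :=
  {G of isUnitalLGroup G & Num.POrderedZmodule G}.

Local Notation "x ⊔ y" := (ljoin x y) (at level 50).
Local Notation "x ⊓ y" := (lmeet x y) (at level 48).

Section LGroupTheory.
Variables (G : ulGroupType).
Implicit Types x y z : G.

Lemma leljUx x y z : (x ⊔ y <= z) = (x <= z) && (y <= z).
Proof. exact: ljoin_lub. Qed.
Lemma lexlmI x y z : (z <= x ⊓ y) = (z <= x) && (z <= y).
Proof. exact: lmeet_glb. Qed.
Lemma lgUl x y : x <= x ⊔ y.
Proof. by have := lexx (x ⊔ y); rewrite {1}leljUx => /andP[]. Qed.
Lemma lgUr x y : y <= x ⊔ y.
Proof. by have := lexx (x ⊔ y); rewrite {1}leljUx => /andP[]. Qed.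
Lemma lgIl x y : x ⊓ y <= x.
Proof. by have := lexx (x ⊓ y); rewrite {1}lexlmI => /andP[]. Qed.
Lemma lgIr x y : x ⊓ y <= y.
Proof. by have := lexx (x ⊓ y); rewrite {1}lexlmI => /andP[]. Qed.
Lemma lgUl_trans z x y : z <= x -> z <= x ⊔ y.
Proof. by move=> zx; apply: le_trans zx (lgUl _ _). Qed.
Lemma lgUr_trans z x y : z <= y -> z <= x ⊔ y.
Proof. by move=> zx; apply: le_trans zx (lgUr _ _). Qed.
Lemma ljoin_r x y : x <= y -> x ⊔ y = y.
Proof. by move=> xy; apply/le_anti; rewrite leljUx xy lexx lgUr. Qed.
Lemma ljoinC x y : x ⊔ y = y ⊔ x.
Proof. by apply/le_anti; rewrite !leljUx !lgUl !lgUr. Qed.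
Lemma ljoin_l x y : y <= x -> x ⊔ y = x.
Proof. by rewrite ljoinC; exact: ljoin_r. Qed.
Lemma ljoinxx x : x ⊔ x = x. Proof. exact: ljoin_r. Qed.
Lemma lmeetC x y : x ⊓ y = y ⊓ x.
Proof. by apply/le_anti; rewrite !lexlmI !lgIl !lgIr. Qed.
Lemma lmeet_l x y : x <= y -> x ⊓ y = x.
Proof. by move=> xy; apply/le_anti; rewrite lexlmI xy lexx lgIl. Qed.

Lemma lg_add2 x y z : (x <= y) -> (z + x <= z + y).
Proof. by move=> /ljoin_r e; rewrite -[in (z + y)]e addr_ljoin lgUl. Qed.

Lemma lg_add x y z t : (x <= y) -> (z <= t) -> (x + z <= y + t).
Proof.
by move=> xy zt; apply: le_trans (lg_add2 _ zt) _; rewrite ![_ + t]addrC lg_add2.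
Qed.

Lemma lg_opp x y : (x <= y) -> (- y <= - x).
Proof.
by move=> /(lg_add2 (- x - y)); rewrite addrNK [- x - y]addrC addrNK.
Qed.

Lemma lg_subr_ge0 x y : (0 <= y - x) = (x <= y).
Proof.
apply/idP/idP => [/(lg_add2 x)|/(lg_add2 (- x))].
  by rewrite addr0 addrC subrK.
by rewrite addNr addrC.
Qed.

Lemma lg_addr_ge0 x y : (0 <= x) -> (0 <= y) -> (0 <= x + y).
Proof. by move=> x0 y0; rewrite -[leLHS]addr0 lg_add. Qed.

Lemma lg_oppU x y : - (x ⊔ y) = (- x) ⊓ (- y).
Proof.
apply/le_anti; rewrite lexlmI !lg_opp ?lgUl ?lgUr//=.
rewrite -[leLHS]opprK lg_opp// leljUx.
by rewrite -{1}[x]opprK -{2}[y]opprK !lg_opp ?lgIl ?lgIr.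
Qed.

Lemma lg_oppI x y : - (x ⊓ y) = (- x) ⊔ (- y).
Proof. by rewrite -[RHS]opprK lg_oppU !opprK. Qed.

Definition lpos x := 0 ⊔ x.
Definition labs x := lpos x + lpos (- x).

Lemma lpos_ge0 x : (0 <= lpos x). Proof. exact: lgUl. Qed.
Lemma le_lpos x : (x <= lpos x). Proof. exact: lgUr. Qed.
Lemma labs_ge0 x : (0 <= labs x).
Proof. by rewrite lg_addr_ge0// lpos_ge0. Qed.
Lemma lpos_le_labs x : (lpos x <= labs x).
Proof. by rewrite -[leLHS]addr0 lg_add2// lpos_ge0. Qed.
Lemma lposN_le_labs x : (lpos (- x) <= labs x).
Proof. by rewrite /labs addrC -[leLHS]addr0 lg_add2// lpos_ge0. Qed.
Lemma le_labs x : (x <= labs x).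
Proof. exact: le_trans (le_lpos _) (lpos_le_labs _). Qed.

Lemma lposB x : x = lpos x - lpos (- x).
Proof.
by apply/eqP; rewrite eq_sym subr_eq /lpos addr_ljoin addr0 subrr ljoinC.
Qed.

Lemma ge0_labs x : (0 <= x) -> labs x = x.
Proof.
move=> x0; rewrite /labs /lpos (ljoin_r x0) (ljoin_l _) ?addr0//.
by rewrite -oppr0 lg_opp.
Qed.

Lemma lpos_le x y : (0 <= y) -> (x <= y) -> (lpos x <= y).
Proof. by move=> ? ?; rewrite /lpos leljUx; apply/andP. Qed.

Lemma labsB x y : (labs (x - y) <= labs x + labs y).
Proof.
rewrite [labs y]addrC /labs addrACA lg_add//; apply: lpos_le;
  rewrite ?lg_addr_ge0 ?lpos_ge0 ?opprB//.
  by rewrite lg_add// le_lpos.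
by rewrite addrC lg_add ?le_lpos.
Qed.

Lemma labsU x y : (labs (x ⊔ y) <= labs x + labs y).
Proof.
rewrite /labs addrACA lg_add//; apply: lpos_le;
  rewrite ?lg_addr_ge0 ?lpos_ge0//.
  rewrite leljUx; apply/andP; split.
    by rewrite -[leLHS]addr0 lg_add ?lpos_ge0 ?le_lpos.
  by rewrite -[leLHS]add0r lg_add ?lpos_ge0 ?le_lpos.
apply: (@le_trans _ _ (- x)); first by rewrite lg_opp ?lgUl.
by rewrite -[leLHS]addr0 lg_add ?lpos_ge0 ?le_lpos.
Qed.

Lemma lg_addI x y z : x + (y ⊓ z) = (x + y) ⊓ (x + z).
Proof.
apply: oppr_inj; rewrite opprD lg_oppI addr_ljoin lg_oppI.
by rewrite !opprD.
Qed.

Lemma lg_meetD x y z : (0 <= x) -> (0 <= y) -> (0 <= z) ->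
  ((x + y) ⊓ z <= (x ⊓ z) + (y ⊓ z)).
Proof.
move=> x0 y0 z0; rewrite lg_addI ![x ⊓ z + _]addrC !lg_addI !lexlmI.
rewrite [y + x]addrC lgIl/=.
have h u v : (0 <= u) -> (v ⊓ z <= u + z).
  move=> u0; apply: le_trans (lgIr _ _) _.
  by rewrite -[leLHS]add0r lg_add.
rewrite h//= !(addrC z) h//= -[leLHS]addr0 lg_add ?lgIr//.
Qed.

Lemma lg_meetMn x z k : (0 <= x) -> (0 <= z) ->
  ((x *+ k) ⊓ z <= (x ⊓ z) *+ k).
Proof.
move=> x0 z0; have xk0 j : (0 <= x *+ j).
  by elim: j => [|j ih]; rewrite ?mulr0n// mulrS lg_addr_ge0.
elim: k => [|k ih]; first by rewrite !mulr0n lgIl.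
by rewrite !mulrS; apply: le_trans (lg_meetD _ _ _) _ => //; rewrite lg_add2.
Qed.

Lemma lpos_meetN x : lpos x ⊓ lpos (- x) = 0.
Proof.
have {1}-> : lpos x = lpos (- x) + x by rewrite {3}[x]lposB addrC subrK.
rewrite -{2}[lpos (- x)]addr0 -lg_addI -[x ⊓ 0]opprK lg_oppI oppr0 ljoinC.
exact: subrr.
Qed.

Lemma lg_mulrn_ge0 x k : 0 <= x -> 0 <= x *+ k.
Proof.
by move=> x0; elim: k => [|j ih]; rewrite ?mulr0n// mulrS lg_addr_ge0.
Qed.

Lemma ounit_ge0 : 0 <= (ounit : G).
Proof.
set u := ounit; have [k uk] := ounitP (labs u).
have p0 := lpos_ge0 u; have m0 := lpos_ge0 (- u).
suff m00 : lpos (- u) = 0 by rewrite (lposB u) m00 subr0.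
apply/le_anti; rewrite m0 andbT.
have kmp : lpos (- u) *+ k <= lpos u *+ k.
  by rewrite -lg_subr_ge0 -mulrnBl -lposB (le_trans (labs_ge0 u)).
have : lpos (- u) <= lpos u *+ k.
  case: k uk kmp => [uk _|k _ kmp].
    by rewrite mulr0n in uk *; apply: le_trans uk; exact: lposN_le_labs.
  apply: le_trans kmp; rewrite mulrS -[leLHS]addr0 lg_add2//.
  exact: lg_mulrn_ge0.
move=> h; rewrite -(lmeet_l h) lmeetC.
apply: le_trans (lg_meetMn _ p0 m0) _.
by rewrite lpos_meetN mul0rn.
Qed.

End LGroupTheory.

Section Ideals.
Context {G : ulGroupType}.

Definition ulhom {H : ulGroupType} (h : G -> H) : Prop :=
  [/\ {morph h : x y / x + y}, {morph h : x y / ljoin x y},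
      {morph h : x y / lmeet x y} & h ounit = ounit].

Definition is_lideal (I : set G) : Prop :=
  exists (H : ulGroupType) (h : G -> H),
    ulhom h /\ I = [set x | h x = 0].

(* These are exactly the l-ideals: see lideal_convex and convex_lideal. *)
Definition convex_lsubgroup (I : set G) : Prop :=
  [/\ I 0, forall x y, I x -> I y -> I (x - y),
      forall x y, I x -> I y -> I (ljoin x y) &
      forall x y, (0 <= y) -> (y <= x) -> I x -> I y].

Lemma convex_lsubgroupD I : convex_lsubgroup I -> forall x y, I x -> I y -> I (x + y).
Proof.
move=> [I0 IB _ _] x y Ix Iy; rewrite -[y]opprK; apply: (IB) => //.
by rewrite -[- y]add0r; apply: IB.
Qed.

Lemma convex_lsubgroupN I : convex_lsubgroup I -> forall x, I x -> I (- x).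
Proof. by move=> [I0 IB _ _] x Ix; rewrite -[- x]add0r; apply: IB. Qed.

Lemma labs_convex I : convex_lsubgroup I -> forall x, I (labs x) <-> I x.
Proof.
move=> hI x; have [I0 IB IU IC] := hI; split=> Ix; last first.
  apply: convex_lsubgroupD => //; apply: IU => //; exact: convex_lsubgroupN.
rewrite (lposB x); apply: IB.
  by apply: IC Ix; [exact: lpos_ge0|exact: lpos_le_labs].
by apply: IC Ix; [exact: lpos_ge0|exact: lposN_le_labs].
Qed.

Lemma lideal_convex I : is_lideal I -> convex_lsubgroup I.
Proof.
move=> [H [h [[hD hU hI _] ->]]].
have h0 : h 0 = 0 by apply: (addrI (h 0)); rewrite -hD !addr0.
have hN x : h (- x) = - h x.
  by apply: (addrI (h x)); rewrite -hD !subrr.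
split=> //= [x y hx hy|x y hx hy|x y y0 yx hx].
- by rewrite hD hN hx hy subr0.
- by rewrite hU hx hy ljoinxx.
- apply/le_anti; rewrite -{1}hx -{1}(ljoin_r yx) hU lgUl/=.
  by rewrite -h0 -(ljoin_r y0) hU lgUl.
Qed.

End Ideals.

Section Quotient.
Variables (G : ulGroupType) (I : set G) (hI : convex_lsubgroup I).
Implicit Types x y z : G.

Let IB x y : I x -> I y -> I (x - y). Proof. by have [_ ? _ _] := hI; auto. Qed.
Let I0 : I 0. Proof. by have [] := hI. Qed.
Let IU x y : I x -> I y -> I (x ⊔ y). Proof. by have [_ _ ? _] := hI; auto. Qed.
Let IC x y : (0 <= y) -> (y <= x) -> I x -> I y.
Proof. by have [_ _ _ h] := hI; apply: h. Qed.
Let ID x y : I x -> I y -> I (x + y). Proof. exact: convex_lsubgroupD (hI) _ _. Qed.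
Let IN x : I x -> I (- x). Proof. exact: convex_lsubgroupN (hI) _. Qed.

Definition lcong x y : bool := `[< I (x - y) >].

Lemma lcong_refl : reflexive lcong.
Proof. by move=> x; apply/asboolP; rewrite subrr. Qed.
Lemma lcong_sym : symmetric lcong.
Proof. by move=> x y; apply/asboolP/asboolP => /IN; rewrite opprB. Qed.
Lemma lcong_trans : transitive lcong.
Proof.
move=> y x z /asboolP h1 /asboolP h2; apply/asboolP.
by have := ID h1 h2; rewrite addrA subrK.
Qed.

Canonical lcong_equiv := EquivRel lcong lcong_refl lcong_sym lcong_trans.

Definition lquot : Type := {eq_quot lcong_equiv}.
HB.instance Definition _ := Choice.on lquot.
HB.instance Definition _ := EqQuotient.on lquot.

Definition lq0 : lquot := \pi_lquot 0.
Definition lqopp := lift_op1 lquot (-%R : G -> G).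
Definition lqadd := lift_op2 lquot (+%R : G -> G -> G).
Definition lqjoin := lift_op2 lquot (@ljoin G).
Definition lqmeet := lift_op2 lquot (@lmeet G).
Definition lqle (a b : lquot) : bool := `[< I (lpos (repr a - repr b)) >].

Let congP x y : reflect (I (x - y)) (lcong_equiv x y).
Proof. exact: asboolP. Qed.
Let piP x y : I (x - y) <-> \pi_lquot x = \pi_lquot y.
Proof. by split=> [h|/eqmodP/congP//]; apply/eqmodP/congP. Qed.
Let reprI x : I (repr (\pi_lquot x) - x).
Proof. by apply/piP; rewrite reprK. Qed.

Lemma lqoppE : {morph \pi_lquot : x / - x >-> lqopp x}.
Proof.
move=> x; unlock lqopp; apply/esym/piP.
by rewrite -opprD; apply: IN; exact: reprI.
Qed.

Lemma lqaddE : {morph \pi_lquot : x y / x + y >-> lqadd x y}.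
Proof.
by move=> x y; unlock lqadd; apply/esym/piP; rewrite opprD addrACA; apply: ID;
  exact: reprI.
Qed.

Let join_le x y x' y' :
  x ⊔ y <= (x' ⊔ y') + (lpos (x - x') + lpos (y - y')).
Proof.
rewrite leljUx; apply/andP; split.
  have {1}-> : x = x' + ((x - x') + 0) by rewrite addr0 addrC subrK.
  by rewrite lg_add ?lgUl// lg_add ?le_lpos ?lpos_ge0.
have {1}-> : y = y' + (0 + (y - y')) by rewrite add0r addrC subrK.
by rewrite lg_add ?lgUr// lg_add ?le_lpos ?lpos_ge0.
Qed.

Let Ipos x : I x -> I (lpos x). Proof. exact: IU. Qed.

Let Isand x c : I c -> x <= c -> - x <= c -> I x.
Proof.
move=> Ic xc mxc; apply/(labs_convex (hI)).
have c0 : I (lpos c) by exact: Ipos.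
apply: IC (ID c0 c0); first exact: labs_ge0.
by rewrite lg_add// lpos_le ?lpos_ge0//; apply: le_trans (le_lpos c).
Qed.

Let Ijoin x y x' y' : I (x - x') -> I (y - y') -> I ((x ⊔ y) - (x' ⊔ y')).
Proof.
move=> hx hy; have hx' := IN hx; have hy' := IN hy; rewrite !opprB in hx' hy'.
pose c1 := lpos (x - x') + lpos (y - y').
pose c2 := lpos (x' - x) + lpos (y' - y).
have I1 : I c1 by apply: ID; exact: Ipos.
have I2 : I c2 by apply: ID; exact: Ipos.
have p1 : 0 <= c1 by rewrite lg_addr_ge0 ?lpos_ge0.
have p2 : 0 <= c2 by rewrite lg_addr_ge0 ?lpos_ge0.
have sub (u v w : G) : u <= v + w -> u - v <= w.
  by move=> /(lg_add2 (- v)); rewrite addKr addrC.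
apply: (Isand (ID I1 I2)); [|rewrite opprB]; apply/sub.
  apply: le_trans (join_le _ _ x' y') _.
  by rewrite lg_add2// -[leLHS]addr0 lg_add2.
apply: le_trans (join_le _ _ x y) _.
by rewrite lg_add2// -[leLHS]add0r lg_add.
Qed.

Let lqle_raw x y := I (lpos (x - y)).

Let raw_trans x y z : lqle_raw x y -> lqle_raw y z -> lqle_raw x z.
Proof.
move=> xy yz; apply: IC (ID xy yz); rewrite ?lpos_ge0//.
apply: lpos_le; first by rewrite lg_addr_ge0 ?lpos_ge0.
by rewrite -(subrKA y) lg_add ?le_lpos.
Qed.

Let raw_cong x y : I (x - y) -> lqle_raw x y. Proof. exact: Ipos. Qed.

Let raw_anti x y : lqle_raw x y -> lqle_raw y x -> I (x - y).
Proof. by rewrite /lqle_raw => h1 h2; rewrite (lposB (x - y)) opprB; exact: IB. Qed.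

Let raw_lub x y z : lqle_raw (x ⊔ y) z <-> lqle_raw x z /\ lqle_raw y z.
Proof.
have E : lpos ((x ⊔ y) - z) = lpos (x - z) ⊔ lpos (y - z).
  rewrite /lpos addrC addr_ljoin ![- z + _]addrC; apply/le_anti/andP; split.
    rewrite leljUx; apply/andP; split; first by rewrite lgUl_trans ?lgUl.
    by rewrite leljUx [_ - z <= _]lgUl_trans ?lgUr// lgUr_trans// lgUr.
  rewrite !leljUx !lgUl/= (lgUr_trans _ (lgUl _ _)).
  by rewrite (lgUr_trans _ (lgUr _ _)).
rewrite /lqle_raw E; split=> [h|[]]; last exact: IU.
by split; apply: IC h; rewrite ?lpos_ge0 ?lgUl ?lgUr.
Qed.

Let raw_glb x y z : lqle_raw z (x ⊓ y) <-> lqle_raw z x /\ lqle_raw z y.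
Proof.
have E u v : lqle_raw u v <-> lqle_raw (- v) (- u).
  by rewrite /lqle_raw opprK addrC.
by rewrite E lg_oppI raw_lub -!E.
Qed.

Let Imeet x y x' y' : I (x - x') -> I (y - y') -> I ((x ⊓ y) - (x' ⊓ y')).
Proof.
move=> hx hy; have hx' := IN hx; have hy' := IN hy; rewrite !opprB in hx' hy'.
have h u v u' v' : I (u - u') -> I (v - v') -> lqle_raw (u ⊓ v) (u' ⊓ v').
  move=> hu hv; apply/raw_glb; have : lqle_raw (u ⊓ v) (u ⊓ v) by apply: raw_cong; rewrite subrr.
  by move=> /raw_glb[h1 h2]; split; [exact: raw_trans (raw_cong hu)|exact: raw_trans (raw_cong hv)].
by apply: raw_anti; exact: h.
Qed.

Lemma lqjoinE : {morph \pi_lquot : x y / x ⊔ y >-> lqjoin x y}.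
Proof. by move=> x y; unlock lqjoin; apply/esym/piP/Ijoin; exact: reprI. Qed.

Lemma lqmeetE : {morph \pi_lquot : x y / x ⊓ y >-> lqmeet x y}.
Proof. by move=> x y; unlock lqmeet; apply/esym/piP/Imeet; exact: reprI. Qed.

Lemma lqleE x y : lqle (\pi_lquot x) (\pi_lquot y) <-> I (lpos (x - y)).
Proof.
split=> [/asboolP h|h]; last apply/asboolP.
  apply: raw_trans (raw_trans h _); apply: raw_cong; last exact: reprI.
  by rewrite -opprB; apply: IN; exact: reprI.
apply: raw_trans (raw_trans h _); apply: raw_cong; first exact: reprI.
by rewrite -opprB; apply: IN; exact: reprI.
Qed.

Let lqaddA : associative lqadd.
Proof. by elim/quotW=> x; elim/quotW=> y; elim/quotW=> z; rewrite -!lqaddE addrA. Qed.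
Let lqaddC : commutative lqadd.
Proof. by elim/quotW=> x; elim/quotW=> y; rewrite -!lqaddE addrC. Qed.
Let lqadd0 : left_id lq0 lqadd.
Proof. by elim/quotW=> x; rewrite -!lqaddE add0r. Qed.
Let lqaddN : left_inverse lq0 lqopp lqadd.
Proof. by elim/quotW=> x; rewrite -lqoppE -!lqaddE addNr. Qed.

HB.instance Definition _ :=
  GRing.isZmodule.Build lquot lqaddA lqaddC lqadd0 lqaddN.

Let lqle_refl : reflexive lqle.
Proof. by elim/quotW=> x; apply/lqleE; rewrite subrr /lpos ljoinxx. Qed.
Let lqle_anti : antisymmetric lqle.
Proof.
elim/quotW=> x; elim/quotW=> y /andP[/lqleE h1 /lqleE h2].
by apply/piP/raw_anti.
Qed.
Let lqle_trans : transitive lqle.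
Proof.
elim/quotW=> x; elim/quotW=> y; elim/quotW=> z /lqleE h1 /lqleE h2.
by apply/lqleE; exact: raw_trans h1 h2.
Qed.

HB.instance Definition _ :=
  Order.Le_isPOrder.Build ring_display lquot lqle_refl lqle_anti lqle_trans.

Let lqjoin_lub (a b c : lquot) : (lqjoin a b <= c) = (a <= c) && (b <= c).
Proof.
elim/quotW: a => x; elim/quotW: b => y; elim/quotW: c => z.
rewrite -lqjoinE; apply/idP/andP => [/lqleE/raw_lub[] ? ?|[/lqleE ? /lqleE ?]].
  by split; apply/lqleE.
by apply/lqleE/raw_lub.
Qed.

Let lqmeet_glb (a b c : lquot) : (c <= lqmeet a b) = (c <= a) && (c <= b).
Proof.
elim/quotW: a => x; elim/quotW: b => y; elim/quotW: c => z.
rewrite -lqmeetE; apply/idP/andP => [/lqleE/raw_glb[] ? ?|[/lqleE ? /lqleE ?]].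
  by split; apply/lqleE.
by apply/lqleE/raw_glb.
Qed.

Let piD x y : \pi_lquot x + \pi_lquot y = \pi_lquot (x + y).
Proof. by rewrite lqaddE. Qed.

Let lqadd_join (a b c : lquot) :
  a + lqjoin b c = lqjoin (a + b) (a + c).
Proof.
elim/quotW: a => x; elim/quotW: b => y; elim/quotW: c => z.
by rewrite -lqjoinE !piD -lqjoinE addr_ljoin.
Qed.

Let lqounit (a : lquot) : exists k, a <= \pi_lquot ounit *+ k.
Proof.
elim/quotW: a => x; have [k xk] := ounitP x; exists k.
have -> : \pi_lquot ounit *+ k = \pi_lquot (ounit *+ k).
  by elim: k {xk} => [|k ih]; rewrite ?mulr0n// !mulrS ih piD.
apply/lqleE; rewrite /lpos ljoin_l//.
by rewrite -lg_subr_ge0 sub0r opprB lg_subr_ge0.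
Qed.

HB.instance Definition _ :=
  isUnitalLGroup.Build lquot lqjoin_lub lqmeet_glb lqadd_join lqounit.

Lemma pi_ulhom : ulhom (\pi_lquot : G -> lquot).
Proof. by split; [exact: lqaddE|exact: lqjoinE|exact: lqmeetE|]. Qed.

Lemma convex_lideal : is_lideal I.
Proof.
exists lquot, (\pi_lquot); split; first exact: pi_ulhom.
apply/seteqP; split=> x /=; last by move=> /piP; rewrite subr0.
by move=> Ix; apply/piP; rewrite subr0.
Qed.

End Quotient.

Section MaximalSpectrum.
Variable G : ulGroupType.
Implicit Types (x y : G) (I J m : set G).

Definition maximal_lideal m : Prop :=
  [/\ is_lideal m, m <> setT &
      forall J, is_lideal J -> J <> setT -> m `<=` J -> J = m].

Lemma labs_mono_meet x y z : x <= y -> x ⊓ z <= y ⊓ z.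
Proof. by move=> xy; rewrite lexlmI lgIr andbT; apply: le_trans (lgIl _ _) xy. Qed.

Lemma maximal_lideal_prime m x y : maximal_lideal m ->
  0 <= x -> 0 <= y -> m (x ⊓ y) -> m x \/ m y.
Proof.
move=> [ml mT mmax] x0 y0 mxy.
have mc := lideal_convex ml; have [m0 mB mU mC] := mc.
have mD := convex_lsubgroupD mc.
pose J : set G := [set z | m (labs z ⊓ y)].
have meet0 z : 0 <= labs z ⊓ y by rewrite lexlmI labs_ge0.
have Jdom z t w : labs z <= labs t + labs w -> J t -> J w -> J z.
  move=> h Jt Jw; apply: (mC (labs t ⊓ y + labs w ⊓ y)) => //; last exact: mD.
  by apply: le_trans (labs_mono_meet y h) (lg_meetD _ _ _); rewrite ?labs_ge0.
have mJ : m `<=` J.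
  move=> z /(labs_convex mc) mz; apply: mC mz => //; exact: lgIl.
have Jc : convex_lsubgroup J.
  split=> [|z t|z t|z t t0 tz Jz]; first exact: mJ.
  - exact/Jdom/labsB.
  - exact/Jdom/labsU.
  - apply: (Jdom _ _ 0 _ Jz); last exact: mJ.
    have z0 := le_trans t0 tz.
    by rewrite [labs 0]ge0_labs// addr0 !ge0_labs.
have [JT|JT] := pselect (J = setT); [right|left].
  have [k yk] := ounitP y.
  have Ju : J ounit by rewrite JT.
  have mk j : m ((labs ounit ⊓ y) *+ j).
    by elim: j => [|j ih]; rewrite ?mulr0n// mulrS; exact: mD.
  apply: mC (mk k) => //.
  apply: le_trans (lg_meetMn _ _ _); rewrite ?labs_ge0// lexlmI lexx andbT.
  apply: (le_trans yk); elim: k {yk} => [|j ih]; rewrite ?mulr0n// !mulrS.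
  by rewrite lg_add ?le_labs.
have := mmax J (convex_lideal Jc) JT mJ => <-.
by rewrite /J /= ge0_labs.
Qed.

End MaximalSpectrum.

Record maxspec (G : ulGroupType) := MaxSpec {
  mxs :> set G;
  mxsP : maximal_lideal mxs }.

Section HullKernel.
Variable G : ulGroupType.

HB.instance Definition _ := gen_eqMixin (maxspec G).
HB.instance Definition _ := gen_choiceMixin (maxspec G).

Definition hk_hull (A : set G) : set (maxspec G) := [set m | A `<=` mxs m].
(* Hull-kernel topology: the closed sets are the hulls. *)
Definition hk_open (U : set (maxspec G)) : Prop := exists A, U = ~` hk_hull A.

Lemma hk_openT : hk_open setT.
Proof.
exists setT; apply/esym/seteqP; split=> // m _ /= h.
by case: (mxsP m) => _ + _; apply; apply/seteqP; split.
Qed.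

Lemma hk_openI : setI_closed hk_open.
Proof.
move=> _ _ [A ->] [B ->].
exists [set z | exists2 a, A a & exists2 b, B b & z = labs a ⊓ labs b].
rewrite -setCU; congr (~` _); apply/seteqP; split=> m /=.
  have mc : convex_lsubgroup (mxs m) by apply: lideal_convex; case: (mxsP m).
  have [_ _ _ mC] := mc.
  have p (a b : G) : 0 <= labs a ⊓ labs b by rewrite lexlmI !labs_ge0.
  move=> [h|h] _ [a Aa [b Bb ->]].
    by apply: mC (p a b) (lgIl _ _) _; apply/labs_convex/h.
  by apply: mC (p a b) (lgIr _ _) _; apply/labs_convex/h.
have mc : convex_lsubgroup (mxs m) by apply: lideal_convex; case: (mxsP m).
move=> h; apply: contrapT => /not_orP[/existsNP[a /not_implyP[Aa ma]]].
move=> /existsNP[b /not_implyP[Bb mb]].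
have : mxs m (labs a ⊓ labs b) by apply: h; exists a => //; exists b.
by move=> /(maximal_lideal_prime (mxsP m) (labs_ge0 _) (labs_ge0 _))
  [] /(labs_convex mc).
Qed.

Lemma hk_open_bigU (I : Type) (f : I -> set (maxspec G)) :
  (forall i, hk_open (f i)) -> hk_open (\bigcup_i f i).
Proof.
move=> /choice[A fA]; exists (\bigcup_i A i).
apply/seteqP; split=> [m [i _]|m /= h].
  by rewrite fA => /= h; apply: contra_not h => h a Aa; apply: h; exists i.
apply: contrapT => nU; apply: h => a [i _ Aa]; apply: contrapT => ma.
by apply: nU; exists i => //; rewrite fA => hA; exact/ma/hA.
Qed.

HB.instance Definition _ :=
  isOpenTopological.Build (maxspec G) hk_openT hk_openI hk_open_bigU.

End HullKernel.

(* Lebesgue covering dimension at most d. *)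
Definition covering_dim_le (T : topologicalType) (d : nat) : Prop :=
  forall (k : nat) (U : 'I_k -> set T),
    (forall i, open (U i)) -> \bigcup_i U i = setT ->
  exists (l : nat) (V : 'I_l -> set T),
    [/\ forall j, open (V j), \bigcup_j V j = setT,
        forall j, exists i, V j `<=` U i &
        forall x, (#|[pred j | `[< V j x >]]| <= d.+1)%N].

Section Properties.
Variable G : ulGroupType.

Definition lideal_gen (A : set G) : set G :=
  \bigcap_(J in [set J | is_lideal J /\ A `<=` J]) J.

Definition fin_gen_lideal (I : set G) : Prop :=
  is_lideal I /\ exists A : set G, finite_set A /\ I = lideal_gen A.

Definition archimedean_ulg : Prop :=
  forall x y : G, (forall k : nat, (0 < k)%N -> x *+ k <= y) -> x <= 0.

Definition local_ulg : Prop :=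
  exists m : set G, maximal_lideal m /\ forall m', maximal_lideal m' -> m' = m.

Definition totally_ordered_ulg : Prop := forall x y : G, x <= y \/ y <= x.

Definition ulsubgroup (S : set G) : Prop :=
  [/\ forall x y, S x -> S y -> S (x - y),
      forall x y, S x -> S y -> S (ljoin x y),
      forall x y, S x -> S y -> S (lmeet x y) & S ounit].

End Properties.

Definition ulisomorphic (G H : ulGroupType) : Prop :=
  exists h : G -> H, ulhom h /\ bijective h.

Definition ulisomorphic_to_ulsubgroup (G H : ulGroupType) : Prop :=
  exists (S : set H) (h : G -> H),
    [/\ ulsubgroup S, ulhom h, injective h & range h = S].

Section RealUnitalLGroup.
Variable R : realType.

Let max_lub (x y z : R) : (Num.max x y <= z) = (x <= z) && (y <= z).
Proof. exact: ge_max. Qed.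
Let min_glb (x y z : R) : (z <= Num.min x y) = (z <= x) && (z <= y).
Proof. exact: le_min. Qed.
Let add_max (x y z : R) : x + Num.max y z = Num.max (x + y) (x + z).
Proof. exact: addr_maxr. Qed.
Let one_unit (x : R) : exists k, x <= 1 *+ k.
Proof. by exists (Num.bound `|x|); rewrite ltW// (le_lt_trans (ler_norm x)) ?archi_boundP. Qed.

HB.instance Definition _ :=
  isUnitalLGroup.Build R max_lub min_glb add_max one_unit.
End RealUnitalLGroup.

Section ZFrac.
Variable n : nat.

(* The unital l-group (Z (1/n.+1), 1). *)
Definition zfrac_pred : {pred rat} :=
  fun q => `[< exists z : int, q = z%:~R / n.+1%:R >].

Record zfrac := ZFrac { zfrac_val : rat; zfracP : zfrac_val \in zfrac_pred }.

HB.instance Definition _ := [isSub for zfrac_val].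
HB.instance Definition _ := [Choice of zfrac by <:].

Let zfrac_zmod : zmod_closed zfrac_pred.
Proof.
split; first by apply/asboolP; exists 0; rewrite mul0r.
move=> _ _ /asboolP[a ->] /asboolP[b ->]; apply/asboolP; exists (a - b).
by rewrite -mulrBl rmorphB.
Qed.
HB.instance Definition _ := GRing.isZmodClosed.Build rat zfrac_pred zfrac_zmod.
HB.instance Definition _ := [SubChoice_isSubZmodule of zfrac by <:].
HB.instance Definition _ := [SubChoice_isSubPOrder of zfrac by <: with ring_display].

Let zfrac_max (x y : zfrac) : Num.max (val x) (val y) \in zfrac_pred.
Proof. by rewrite /Num.max; case: ifP => _; exact: zfracP. Qed.
Let zfrac_min (x y : zfrac) : Num.min (val x) (val y) \in zfrac_pred.
Proof. by rewrite /Num.min; case: ifP => _; exact: zfracP. Qed.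
Let zfrac_one : 1 \in zfrac_pred.
Proof. by apply/asboolP; exists n.+1; rewrite divff// pnatr_eq0. Qed.

Definition zfrac_join x y := ZFrac (zfrac_max x y).
Definition zfrac_meet x y := ZFrac (zfrac_min x y).
Definition zfrac1 := ZFrac zfrac_one.

Let zfrac_lub x y z : (zfrac_join x y <= z) = (x <= z) && (y <= z).
Proof. exact: ge_max. Qed.
Let zfrac_glb x y z : (z <= zfrac_meet x y) = (z <= x) && (z <= y).
Proof. exact: le_min. Qed.
Let zfrac_addU x y z : x + zfrac_join y z = zfrac_join (x + y) (x + z).
Proof. by apply: val_inj; exact: addr_maxr. Qed.
Let zfrac_unit x : exists k, x <= zfrac1 *+ k.
Proof.
exists (Num.bound `|val x|); rewrite -[_ <= _]/(val x <= val (zfrac1 *+ _)).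
rewrite raddfMn/= ltW// (le_lt_trans (ler_norm (val x)))//.
by rewrite archi_boundP.
Qed.

HB.instance Definition _ :=
  isUnitalLGroup.Build zfrac zfrac_lub zfrac_glb zfrac_addU zfrac_unit.
End ZFrac.

Section Product.
Variables (I : finType) (G : I -> ulGroupType).

Definition ulprod : Type := forall i, G i.
Implicit Types x y z : ulprod.

HB.instance Definition _ := Choice.on ulprod.

Definition ulprod_add x y : ulprod := fun i => x i + y i.
Definition ulprod_opp x : ulprod := fun i => - x i.
Definition ulprod_zero : ulprod := fun i => 0.
Definition ulprod_le x y : bool := [forall i, x i <= y i].
Definition ulprod_join x y : ulprod := fun i => ljoin (x i) (y i).
Definition ulprod_meet x y : ulprod := fun i => lmeet (x i) (y i).
Definition ulprod_unit : ulprod := fun i => ounit.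

Let addA : associative ulprod_add.
Proof. by move=> x y z; apply: functional_extensionality_dep => i; exact: addrA. Qed.
Let addC : commutative ulprod_add.
Proof. by move=> x y; apply: functional_extensionality_dep => i; exact: addrC. Qed.
Let add0 : left_id ulprod_zero ulprod_add.
Proof. by move=> x; apply: functional_extensionality_dep => i; exact: add0r. Qed.
Let addN : left_inverse ulprod_zero ulprod_opp ulprod_add.
Proof. by move=> x; apply: functional_extensionality_dep => i; exact: addNr. Qed.
HB.instance Definition _ := GRing.isZmodule.Build ulprod addA addC add0 addN.

Let le_refl : reflexive ulprod_le.
Proof. by move=> x; apply/forallP => i. Qed.
Let le_anti : antisymmetric ulprod_le.
Proof.
move=> x y /andP[/forallP xy /forallP yx].
by apply: functional_extensionality_dep => i; apply/le_anti; rewrite xy yx.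
Qed.
Let le_trans : transitive ulprod_le.
Proof.
by move=> x y z /forallP yx /forallP xz; apply/forallP => i; exact: le_trans (yx i) (xz i).
Qed.
HB.instance Definition _ :=
  Order.Le_isPOrder.Build ring_display ulprod le_refl le_anti le_trans.

Let prod_lub x y z : (ulprod_join x y <= z) = (x <= z) && (y <= z).
Proof.
apply/forallP/andP => [h|[/forallP xz /forallP yz] i]; last first.
  by rewrite ljoin_lub xz yz.
by split; apply/forallP => i; have := h i; rewrite ljoin_lub => /andP[].
Qed.
Let prod_glb x y z : (z <= ulprod_meet x y) = (z <= x) && (z <= y).
Proof.
apply/forallP/andP => [h|[/forallP xz /forallP yz] i]; last first.
  by rewrite lmeet_glb xz yz.
by split; apply/forallP => i; have := h i; rewrite lmeet_glb => /andP[].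
Qed.
Let prod_addU x y z : x + ulprod_join y z = ulprod_join (x + y) (x + z).
Proof. by apply: functional_extensionality_dep => i; exact: addr_ljoin. Qed.
Let unitMn k i : (ulprod_unit *+ k) i = ounit *+ k.
Proof. by elim: k => [//|k ih]; rewrite !mulrS -ih. Qed.
Let prod_unit x : exists k, x <= ulprod_unit *+ k.
Proof.
have /choice[k xk] : forall i, exists k, x i <= ounit *+ k by move=> i; exact: ounitP.
exists (\sum_i k i)%N; apply/forallP => i; rewrite unitMn.
apply: (order.Order.POrderTheory.le_trans (xk i)); rewrite (bigD1 i)//= mulrnDr.
by rewrite -[leLHS]addr0 lg_add2// lg_mulrn_ge0// ounit_ge0.
Qed.

HB.instance Definition _ :=
  isUnitalLGroup.Build ulprod prod_lub prod_glb prod_addU prod_unit.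
End Product.

Definition simplicial_ulg (G : ulGroupType) : Prop :=
  exists (k : nat) (n : 'I_k -> nat), ulisomorphic G (ulprod (fun i => zfrac (n i))).

Section McNaughton.
Variables (R : realType) (n : nat).

Definition cube : set 'rV[R]_n := [set x | forall i, 0 <= x 0 i <= 1].

(* x |-> <p.1, x> + p.2 *)
Definition int_affine (p : 'rV[int]_n * int) (x : 'rV[R]_n) : R :=
  \sum_(i < n) (p.1 0 i)%:~R * x 0 i + p.2%:~R.

Definition mcnaughton (f : cube -> R) : Prop :=
  continuous f /\
  exists s : seq ('rV[int]_n * int),
    forall x : cube, exists2 p, p \in s & f x = int_affine p (val x).

Definition mcn_pred : {pred (cube -> R)} := fun f => `[< mcnaughton f >].

Record mcn := Mcn { mcn_fun :> cube -> R; mcnP : mcn_fun \in mcn_pred }.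

HB.instance Definition _ := [isSub for mcn_fun].
HB.instance Definition _ := [Choice of mcn by <:].

Let int_affineB p q x :
  int_affine p x - int_affine q x = int_affine (p.1 - q.1, p.2 - q.2) x.
Proof.
rewrite /int_affine /= opprD addrACA rmorphB -sumrB; congr (_ + _).
by apply: eq_bigr => i _; rewrite !mxE rmorphB mulrBl.
Qed.

Let mcn_zmod : zmod_closed mcn_pred.
Proof.
split.
  apply/asboolP; split; first exact: cst_continuous.
  exists [:: (0, 0)] => x; exists (0, 0); rewrite ?mem_head//.
  by rewrite /int_affine /= big1 ?addr0// => i _; rewrite mxE mul0r.
move=> f g /asboolP[cf [s fs]] /asboolP[cg [t gt]]; apply/asboolP; split.
  by move=> x; apply: (@continuousB _ R^o _ f g x); [exact: cf|exact: cg].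
exists [seq (p.1 - q.1, p.2 - q.2) | p <- s, q <- t] => x.
have [p ps fp] := fs x; have [q qt gq] := gt x.
exists (p.1 - q.1, p.2 - q.2); first by apply/allpairsP; exists (p, q).
by rewrite -int_affineB -fp -gq.
Qed.
HB.instance Definition _ := GRing.isZmodClosed.Build (cube -> R) mcn_pred mcn_zmod.
HB.instance Definition _ := [SubChoice_isSubZmodule of mcn by <:].
HB.instance Definition _ := [SubChoice_isSubPOrder of mcn by <: with ring_display].

Let mcn_maxP (f g : mcn) : (fun x => Num.max (f x) (g x)) \in mcn_pred.
Proof.
have /asboolP[cf [s fs]] := mcnP f; have /asboolP[cg [t gt]] := mcnP g.
apply/asboolP; split.
  by move=> x; apply: (@continuous_max _ _ f g x); [exact: cf|exact: cg].
exists (s ++ t) => x; rewrite /Num.max; case: ifP => _.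
  by have [q qt ->] := gt x; exists q => //; rewrite mem_cat qt orbT.
by have [q qt ->] := fs x; exists q => //; rewrite mem_cat qt.
Qed.
Let mcn_minP (f g : mcn) : (fun x => Num.min (f x) (g x)) \in mcn_pred.
Proof.
have /asboolP[cf [s fs]] := mcnP f; have /asboolP[cg [t gt]] := mcnP g.
apply/asboolP; split.
  by move=> x; apply: (@continuous_min _ _ f g x); [exact: cf|exact: cg].
exists (s ++ t) => x; rewrite /Num.min; case: ifP => _.
  by have [q qt ->] := fs x; exists q => //; rewrite mem_cat qt.
by have [q qt ->] := gt x; exists q => //; rewrite mem_cat qt orbT.
Qed.
Let mcn_oneP : (fun=> 1) \in mcn_pred.
Proof.
apply/asboolP; split; first exact: cst_continuous.
exists [:: (0, 1)] => x; exists (0, 1); rewrite ?mem_head//.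
by rewrite /int_affine /= big1 ?add0r// => i _; rewrite mxE mul0r.
Qed.

Definition mcn_join f g := Mcn (mcn_maxP f g).
Definition mcn_meet f g := Mcn (mcn_minP f g).
Definition mcn_one := Mcn mcn_oneP.

Let mcn_leP (f g : mcn) : reflect (forall x, f x <= g x) (f <= g).
Proof. exact: lefP. Qed.

Let mcn_lub f g h : (mcn_join f g <= h) = (f <= h) && (g <= h).
Proof.
apply/mcn_leP/andP => [H|[/mcn_leP fh /mcn_leP gh] x]; last first.
  by rewrite /= ge_max fh gh.
by split; apply/mcn_leP => x; have := H x; rewrite /= ge_max => /andP[].
Qed.
Let mcn_glb f g h : (h <= mcn_meet f g) = (h <= f) && (h <= g).
Proof.
apply/mcn_leP/andP => [H|[/mcn_leP fh /mcn_leP gh] x]; last first.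
  by rewrite /= le_min fh gh.
by split; apply/mcn_leP => x; have := H x; rewrite /= le_min => /andP[].
Qed.
Let mcn_addU f g h : f + mcn_join g h = mcn_join (f + g) (f + h).
Proof. by apply/val_inj/funext => x; exact: addr_maxr. Qed.
Let mcn_unit f : exists k, f <= mcn_one *+ k.
Proof.
have /asboolP[_ [s fs]] := mcnP f.
pose c (p : 'rV[int]_n * int) : nat := (\sum_(i < n) `|p.1 0%R i| + `|p.2|)%N.
exists (\sum_(p <- s) c p)%N; apply/mcn_leP => x.
have E k : (mcn_one *+ k) x = k%:R.
  by elim: k => [//|k ih]; rewrite !mulrS -ih.
rewrite E; have [p ps ->] := fs x.
apply: (@le_trans _ _ (c p)%:R); last first.
  by rewrite ler_nat (big_rem p)//= leq_addr.
have nz (z : int) : (z%:~R : R) <= `|z|%N%:R.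
  by rewrite pmulrn ler_int abszE ler_norm.
rewrite /int_affine natrD natr_sum lerD//; apply: ler_sum => i _.
have /andP[x0 x1] := set_mem (valP x) i.
apply: (@le_trans _ _ (`|p.1 0%R i|%N%:R * val x 0 i)); first by rewrite ler_wpM2r.
by rewrite ler_piMr// ler0n.
Qed.

HB.instance Definition _ :=
  isUnitalLGroup.Build mcn mcn_lub mcn_glb mcn_addU mcn_unit.

Definition zeroset (f : mcn) : set cube := [set x | f x = 0].

End McNaughton.
Arguments cube R n _ : clear implicits.

Section Simplexes.
Variable n : nat.

Definition den (y : 'rV[rat]_n) : nat :=
  \big[lcmn/1%N]_(i < n) `|denq (y 0%R i)|%N.

(* den y *: y has integer entries, so numq is the identity here *)
Definition homog (y : 'rV[rat]_n) : 'rV[int]_(n + 1) :=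
  row_mx (\row_i numq ((den y)%:R * y 0 i)) (const_mx (den y)%:Z).

(* The rows of an invertible integer matrix are the elements of a basis of
   Z^(n+1); homog is injective, so distinct vertices give distinct rows. *)
Definition regular_simplex (S : {fset 'rV[rat]_n}) : Prop :=
  exists2 B : 'M[int]_(n + 1), B \in unitmx &
    forall v, v \in S -> exists i, row i B = homog v.

End Simplexes.

(* A simplex is represented by its finite set of (rational) vertices, and a
   complex by the set of its simplexes.  The empty simplex is allowed, its hull
   is empty, and, by closure under faces, it belongs to every nonempty complex:
   this matches the abstract complexes below, which contain the empty set. *)
Section RegularComplexes.
Variables (R : realType) (n : nat).
Implicit Types (S T F : {fset 'rV[rat]_n}) (D : set {fset 'rV[rat]_n}).

Definition chull S : set 'rV[R]_n :=
  [set x | exists l : 'rV[rat]_n -> R,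
     [/\ forall v, v \in S -> 0 <= l v, \sum_(v <- S) l v = 1 &
         x = \sum_(v <- S) l v *: map_mx ratr v]].

Definition csupport D : set 'rV[R]_n := \bigcup_(S in D) chull S.

Definition vertices D : set 'rV[rat]_n := [set v | exists2 S, D S & v \in S].

Definition regular_complex D : Prop :=
  [/\ finite_set D,
      forall S F, D S -> (F `<=` S)%fset -> D F,
      forall S T, D S -> D T -> exists F,
        [/\ (F `<=` S)%fset, (F `<=` T)%fset & chull S `&` chull T = chull F] &
      forall S, D S -> regular_simplex S].

(* The default value v0 is irrelevant: on a regular 1-simplex the set below is a
   singleton. *)
Definition farey_mediant (v0 v1 : 'rV[rat]_n) : 'rV[rat]_n :=
  xget v0 [set v | chull [fset v0; v1]%fset (map_mx ratr v) /\
                   homog v = homog v0 + homog v1].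

Definition blowup D (p : 'rV[rat]_n) : set {fset 'rV[rat]_n} :=
  [set T | D T /\ ~ chull T (map_mx ratr p)] `|`
  [set (p |` F)%fset | F in [set F | ~ chull F (map_mx ratr p) /\
     exists T, [/\ D T, chull T (map_mx ratr p) & (F `<=` T)%fset]]].

Definition rational_polyhedron (P : set 'rV[R]_n) : Prop :=
  exists s : seq {fset 'rV[rat]_n}, P = \bigcup_(S in [set` s]) chull S.

End RegularComplexes.
Arguments chull R {n} S _.
Arguments csupport R {n} D _.

Section WeightedComplexes.
Variable V : choiceType.

Record wcomplex := WComplex {
  verts : {fset V};
  simps : set {fset V};
  weight : V -> nat;
  verts_neq0 : verts != fset0;
  simps_verts : forall v : V, v \in verts <-> exists2 S, simps S & v \in S;
  simps_down : forall S F, simps S -> (F `<=` S)%fset -> simps F;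
  weight_gt0 : forall v, v \in verts -> (0 < weight v)%N }.

(* A stellar sequence is given together with its steps.  They are determined by
   the sequence of complexes, except that the two endpoints of a subdivided edge
   may be exchanged, which changes nothing below. *)
Inductive stellar_move :=
  | Stay
  | Deletion of {fset V}
  | Subdivision of V & V & V.

Definition stellar_step (m : stellar_move) (W W' : wcomplex) : Prop :=
  match m with
  | Stay =>
      [/\ verts W' = verts W, simps W' = simps W &
          {in verts W, weight W' =1 weight W}]
  | Deletion M =>
      [/\ simps W M, forall S, simps W S -> (M `<=` S)%fset -> S = M,
          verts W' =
            (verts W `\` (if #|` M| == 1%N then M else fset0))%fset,
          simps W' = simps W `\ M &
          {in verts W', weight W' =1 weight W}]
  | Subdivision v w a =>
      [/\ v != w, simps W [fset v; w]%fset & a \notin verts W] /\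
      [/\ verts W' = (a |` verts W)%fset,
          simps W' =
            [set T | simps W T /\ ~ ([fset v; w] `<=` T)%fset] `|`
            [set T | exists S, [/\ simps W S, ([fset v; w] `<=` S)%fset &
               (T `<=` a |` (S `\ w))%fset \/ (T `<=` a |` (S `\ v))%fset]],
          {in verts W, weight W' =1 weight W} &
          weight W' a = (weight W v + weight W w)%N]
  end.

Definition is_deletion (m : stellar_move) : Prop := exists M, m = Deletion M.

Definition stellar (W : nat -> wcomplex) (s : nat -> stellar_move) : Prop :=
  forall j, stellar_step (s j) (W j) (W j.+1).

Definition realization (R : realType) (n : nat) (D : set {fset 'rV[rat]_n})
    (W : wcomplex) (iota : V -> 'rV[rat]_n) : Prop :=
  [/\ regular_complex R D,
      set_bij [set` verts W] (vertices D) iota,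
      forall v, v \in verts W -> den (iota v) = weight W v &
      forall S, (S `<=` verts W)%fset -> simps W S <-> D (iota @` S)%fset].

End WeightedComplexes.

Section Orbits.
Variables (R : realType) (V : choiceType) (n : nat).
Implicit Types (D : set {fset 'rV[rat]_n}) (iota : V -> 'rV[rat]_n).

(* iota is a total function, only its values on the current vertices matter; the
   label c of a new vertex may have been used for a vertex deleted earlier. *)
Definition realize_move (m : stellar_move V)
    (p : set {fset 'rV[rat]_n} * (V -> 'rV[rat]_n)) :=
  let: (D, iota) := p in
  match m with
  | Stay => (D, iota)
  | Deletion M => (D `\ (iota @` M)%fset, iota)
  | Subdivision a b c =>
      let e := farey_mediant R (iota a) (iota b) in
      (blowup R D e, fun x => if x == c then e else iota x)
  end.

Fixpoint realize (s : nat -> stellar_move V) D iota (j : nat) :=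
  if j is i.+1 then realize_move (s i) (realize s D iota i) else (D, iota).

Definition realized_complex s D iota j := (realize s D iota j).1.

Definition stellar_orbit s D iota : set (set 'rV[R]_n) :=
  range (fun j => csupport R (realized_complex s D iota j)).

(* f and its zeroset live on the cube, which contains the supports. *)
Definition stellar_ideal s D iota : set (mcn R n) :=
  [set f | exists j,
     val @^-1` csupport R (realized_complex s D iota j) `<=` zeroset f].

Lemma chull_sub (S T : {fset 'rV[rat]_n}) :
  (forall v, v \in S -> chull R T (map_mx ratr v)) -> chull R S `<=` chull R T.
Proof.
move=> ST x [l [l0 l1 ->]].
have /choice[k kP] : forall v, exists k : 'rV[rat]_n -> R, v \in S ->
    [/\ forall w, w \in T -> 0 <= k w, \sum_(w <- T) k w = 1 &
        map_mx ratr v = \sum_(w <- T) k w *: map_mx ratr w].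
  move=> v; have [/ST[k kP]|] := boolP (v \in S); first by exists k.
  by exists (fun=> 0).
exists (fun w => \sum_(v <- S) l v * k v w); split.
- move=> w wT; rewrite big_seq; apply: sumr_ge0 => v vS.
  by rewrite mulr_ge0 ?l0//; have [+ _ _] := kP v vS; apply.
- rewrite exchange_big /= -l1 [LHS]big_seq [RHS]big_seq; apply: eq_bigr => v vS.
  by rewrite -mulr_sumr; have [_ -> _] := kP v vS; rewrite mulr1.
- under [RHS]eq_bigr do rewrite scaler_suml.
  rewrite exchange_big /= [LHS]big_seq [RHS]big_seq; apply: eq_bigr => v vS.
  have [_ _ ->] := kP v vS; rewrite scaler_sumr.
  by apply: eq_bigr => w _; rewrite scalerA.
Qed.

Lemma chull_vertex (S : {fset 'rV[rat]_n}) v : v \in S ->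
  chull R S (map_mx ratr v).
Proof.
move=> vS; exists (fun w => (w == v)%:R); split.
- by move=> w _; rewrite ler0n.
- rewrite (bigD1_seq v) ?fset_uniq//= eqxx big1 ?addr0// => w /negbTE ->.
  by [].
- rewrite (bigD1_seq v) ?fset_uniq//= eqxx scale1r big1 ?addr0// => w /negbTE ->.
  by rewrite scale0r.
Qed.

Lemma support_blowup D p : csupport R (blowup R D p) `<=` csupport R D.
Proof.
move=> x [S [[DS _] xS|[F [_ [T [DT pT FT]]] <-]]]; first by exists S.
move=> xS; exists T => //; apply: chull_sub xS => v.
by rewrite in_fset1U => /orP[/eqP->//|/(fsubsetP FT)]; exact: chull_vertex.
Qed.

Lemma support_realize_move m p :
  csupport R (realize_move m p).1 `<=` csupport R p.1.
Proof.
case: m p => [|M|a b c] [D iota] //=; last exact: support_blowup.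
by move=> x [S [DS _] xS]; exists S.
Qed.

Lemma support_realize_le s D iota i j : (i <= j)%N ->
  csupport R (realized_complex s D iota j) `<=`
  csupport R (realized_complex s D iota i).
Proof.
elim: j => [|j ih]; first by rewrite leqn0 => /eqP ->.
rewrite leq_eqVlt => /predU1P[->//|/ih]; apply: subset_trans.
exact: support_realize_move.
Qed.

Lemma stellar_ideal_convex s D iota : convex_lsubgroup (stellar_ideal s D iota).
Proof.
have common (f g : mcn R n) :
    stellar_ideal s D iota f -> stellar_ideal s D iota g ->
    exists j, forall x, csupport R (realized_complex s D iota j) (val x) ->
      f x = 0 /\ g x = 0.
  move=> [i fi] [j gj]; exists (maxn i j) => x xs; split.
    exact/fi/(support_realize_le (leq_maxl i j)).
  exact/gj/(support_realize_le (leq_maxr i j)).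
split=> [|f g /common h /h[j fg]|f g /common h /h[j fg]|f g g0 gf [j fj]].
- by exists 0%N.
- by exists j => x /fg[fx gx]; rewrite /zeroset/= -[LHS]/(f x - g x) fx gx subr0.
- by exists j => x /fg[fx gx]; rewrite /zeroset/= fx gx maxxx.
exists j => x /fj; rewrite /zeroset/= => fx; apply/le_anti.
have /lefP/(_ x) gfx : (mcn_fun g <= mcn_fun f)%O by [].
have /lefP/(_ x) g0x : (mcn_fun 0 <= mcn_fun g)%O by [].
by apply/andP; split; [rewrite -fx|].
Qed.

Definition stellar_group s D iota : ulGroupType :=
  lquot (stellar_ideal_convex s D iota).

End Orbits.
Arguments stellar_orbit R {V n} s D iota _.
Arguments stellar_ideal R {V n} s D iota _.
Arguments stellar_group R {V n} s D iota.

Section CanonicalRealization.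
Variables (V : choiceType) (n : nat) (W : wcomplex V) (v : n.-tuple V).

Definition canonical_iota (x : V) : 'rV[rat]_n :=
  \row_i ((x == tnth v i)%:R / (weight W x)%:R).

Definition canonical_complex : set {fset 'rV[rat]_n} :=
  [set (canonical_iota @` S)%fset | S in simps W].

End CanonicalRealization.

(* For every cover of [0,1]^n by two rational polyhedra, some |D_i| is contained
   in one of them. *)
Definition orbit_decides_covers (R : realType) (V : choiceType) (n : nat)
    (s : nat -> stellar_move V) (D : set {fset 'rV[rat]_n}) (iota : V -> 'rV[rat]_n) :
    Prop :=
  forall P Q : set 'rV[R]_n,
    rational_polyhedron P -> rational_polyhedron Q -> P `|` Q = cube R n ->
  exists i, csupport R (realized_complex R s D iota i) `<=` P \/
            csupport R (realized_complex R s D iota i) `<=` Q.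

(* Main.v *)
(* Write P_j = |Delta_j| and let K be the intersection of the P_j. Rational
   polyhedra are finite unions of intersections of integer affine half-spaces
   (Weyl, Minkowski), hence are the zerosets of McNaughton functions, and on the
   cells of a rational subdivision such functions are affine. An element of the
   quotient is a germ along the P_j, and by compactness its maximal l-ideals are
   the points of K; this gives (1) and (4)-(6), as a deletion, unlike a
   subdivision, makes the support strictly smaller. For (2), the open stars in a
   finely subdivided graph show that it has dimension at most 1, and Sperner's
   lemma that a triangle has not. For (3), the coordinates of the points of K in
   a simplicial group have a common denominator, so that some P_j is finite. For
   (7), the group is totally ordered iff the sign of each integer affine form is
   constant on some P_j; pulled back to the cone over the abstract complex W_0,
   where subdivisions act by h(a) = h(v) + h(w), this condition no longer depends
   on the realization. *)
Require Import Defs.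
From mathcomp Require Import all_boot all_order all_algebra finmap generic_quotient.
From mathcomp Require Import all_classical reals topology normedtype.
From mathcomp Require Import ring lra zify.

Set Implicit Arguments.
Unset Strict Implicit.
Unset Printing Implicit Defensive.

Import Order.TTheory GRing.Theory Num.Theory.
Import numFieldNormedType.Exports.

Local Open Scope classical_set_scope.
Local Open Scope ring_scope.

(** * Rational cones and polyhedra *)

(** The steps of a sequence carry the invariant [good], stated through one linear map [tot] on
    functions of the vertices. Subdividing an edge then amounts to composing [tot] with [rho], and
    the invariant is preserved by looking at the coordinates at [v], [w] and [a] only. Its
    integrality clause also identifies the mediant: it forces the sum of the two vectors [homog] at
    the ends of an edge to be primitive, hence to be [homog] of its rational point. The obstacle in
    (7) is that an integer function on the vertices of [W 0] need not come from an affine form on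
    R^n, so that forms cannot be carried directly from one realization to another. On a single
    regular simplex it does come from one, and if all forms are decided, then some support lies in a
    single simplex of the initial complex; there the two conditions can be compared. *)

Section Cones.
Variables (R : realType) (m : nat).
Implicit Types (a h : 'rV[int]_m) (x y z : 'rV[R]_m) (s t : seq 'rV[int]_m).

Definition intv a : 'rV[R]_m := map_mx intr a.
Definition dot x y : R := \sum_i x 0 i * y 0 i.

Lemma dotC x y : dot x y = dot y x.
Proof. by apply: eq_bigr => i _; rewrite mulrC. Qed.
Lemma dotDr x y z : dot x (y + z) = dot x y + dot x z.
Proof. by rewrite -big_split; apply: eq_bigr => i _; rewrite mxE mulrDr. Qed.
Lemma dotZr x k y : dot x (k *: y) = k * dot x y.
Proof. by rewrite mulr_sumr; apply: eq_bigr => i _; rewrite mxE mulrCA. Qed.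
Lemma dotNr x y : dot x (- y) = - dot x y.
Proof. by rewrite -scaleN1r dotZr mulN1r. Qed.
Lemma dotBr x y z : dot x (y - z) = dot x y - dot x z.
Proof. by rewrite dotDr dotNr. Qed.
Lemma dot0r x : dot x 0 = 0.
Proof. by rewrite -(scale0r x) dotZr mul0r. Qed.
Lemma dot_sumr (I : Type) (r : seq I) (P : pred I) (F : I -> 'rV[R]_m) x :
  dot x (\sum_(i <- r | P i) F i) = \sum_(i <- r | P i) dot x (F i).
Proof.
by apply: (big_morph (dot x) (fun y z => dotDr x y z) (dot0r x)).
Qed.
Lemma dotDl x y z : dot (x + y) z = dot x z + dot y z.
Proof. by rewrite !(dotC _ z) dotDr. Qed.
Lemma dotZl x k y : dot (k *: x) y = k * dot x y.
Proof. by rewrite !(dotC _ y) dotZr. Qed.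
Lemma dotNl x y : dot (- x) y = - dot x y.
Proof. by rewrite !(dotC _ y) dotNr. Qed.

Lemma intv_delta i : intv (delta_mx 0 i) = delta_mx 0 i.
Proof. exact: map_delta_mx. Qed.
Lemma dot_delta i y : dot (delta_mx 0 i) y = y 0 i.
Proof.
rewrite /dot (bigD1 i)//= big1 ?addr0 => [|j ji]; rewrite mxE ?eqxx ?mul1r//.
by rewrite (negbTE ji) andbF mul0r.
Qed.
Lemma intvD a h : intv (a + h) = intv a + intv h. Proof. exact: map_mxD. Qed.
Lemma intvN a : intv (- a) = - intv a. Proof. exact: map_mxN. Qed.
Lemma intvB a h : intv (a - h) = intv a - intv h. Proof. exact: map_mxB. Qed.
Lemma intvZ (k : int) a : intv (k *: a) = k%:~R *: intv a.
Proof. exact: map_mxZ. Qed.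

Lemma dot_intv a h : dot (intv a) (intv h) = (\sum_i a 0 i * h 0 i)%:~R.
Proof. by rewrite rmorph_sum; apply: eq_bigr => i _; rewrite !mxE rmorphM. Qed.

(** Generators are peeled off one by one, which is the shape of the elimination in [weyl]; [coneP]
    recovers the usual sums. *)
Fixpoint cone s y : Prop :=
  if s is h :: s' then exists2 t, 0 <= t & cone s' (y - t *: intv h) else y = 0.

Definition dual t y : bool := all (fun a => 0 <= dot (intv a) y) t.

Lemma dualP t y : reflect (forall a, a \in t -> 0 <= dot (intv a) y) (dual t y).
Proof. exact: allP. Qed.

Lemma exists_between (ls us : seq R) :
  (forall l u, l \in ls -> u \in us -> l <= u) ->
  exists k : R, (forall l, l \in ls -> l <= k) /\ (forall u, u \in us -> k <= u).
Proof.
elim: ls => [_|l ls ih lu].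
  exists (- \sum_(u <- us) `|u|); split=> // u us_u.
  rewrite (big_rem u)//= opprD -[leRHS]addr0 lerD//.
    by rewrite lerNl ler_normr lexx orbT.
  by rewrite oppr_le0 sumr_ge0.
have [l' u l'ls uus|t [lt tu]] := ih; first by apply: lu; rewrite // in_cons l'ls orbT.
exists (Num.max l t); split=> [l'|u uus].
  by rewrite in_cons => /predU1P[->|/lt]; rewrite le_max ?lexx// => ->; rewrite orbT.
by rewrite ge_max tu// lu// mem_head.
Qed.

(* Fourier-Motzkin elimination of one generator at a time. *)
Lemma weyl s : exists t, forall y, cone s y <-> dual t y.
Proof.
elim: s => [|h s [t ih]].
  exists ([seq delta_mx 0 i | i <- enum 'I_m] ++
          [seq - delta_mx 0 i | i <- enum 'I_m]) => y.
  split=> [->|/dualP H]; first by apply/dualP => a _; rewrite dot0r.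
  apply/rowP => i; rewrite mxE; apply/le_anti/andP; split.
    rewrite -oppr_ge0 -dot_delta -dotNl -intv_delta -intvN.
    apply: H; rewrite mem_cat; apply/orP; right.
    by apply/mapP; exists i; rewrite ?mem_enum.
  rewrite -dot_delta -intv_delta; apply: H.
  by rewrite mem_cat; apply/orP; left; apply/mapP; exists i; rewrite ?mem_enum.
pose e a : int := \sum_i a 0 i * h 0 i.
have eE a : dot (intv a) (intv h) = (e a)%:~R by exact: dot_intv.
(* Constraints nonnegative on [h] survive; two of opposite signs on [h] are combined so that their
   values on [h] cancel, which eliminates the coefficient of [h]. *)
pose T := [seq a <- t | 0 <= e a] ++
  [seq (e p.1) *: p.2 - (e p.2) *: p.1 | p <- [seq (a, b) | a <- t, b <- t] & (0 < e p.1) && (e p.2 < 0)].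
exists T => y; split=> [[k k0 /ih /dualP H]|/dualP H].
  have H' a : a \in t -> k * (e a)%:~R <= dot (intv a) y.
    by move=> /H; rewrite dotBr dotZr eE subr_ge0.
  apply/dualP => a; rewrite mem_cat => /orP[|].
    rewrite mem_filter => /andP[ea /H']; apply: le_trans.
    by rewrite mulr_ge0// ler0z.
  move=> /mapP[[b c] /=]; rewrite mem_filter => /andP[/andP[/= b0 c0]].
  move=> /allpairsP[[b' c'] [/= bt ct [? ?]]] ->; subst b' c'.
  rewrite intvB !intvZ dotDl dotNl !dotZl subr_ge0.
  have eb : 0 < (e b)%:~R :> R by rewrite ltr0z.
  have ec : (e c)%:~R < 0 :> R by rewrite ltrz0.
  have := H' _ bt; have := H' _ ct.
  move=> h1 h2; apply: (@le_trans _ _ ((e c)%:~R * (k * (e b)%:~R))).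
    by rewrite ler_nM2l.
  by rewrite mulrCA [_ * _%:~R]mulrC mulrCA ler_pM2l.
(* The extra lower bound 0 makes the coefficient of [h] nonnegative. *)
pose ls := 0 :: [seq dot (intv a) y / (e a)%:~R | a <- t & e a < 0].
pose us := [seq dot (intv a) y / (e a)%:~R | a <- t & 0 < e a].
have [l u lls uus|k [kl ku]] := @exists_between ls us.
  move: uus => /mapP[b]; rewrite mem_filter => /andP[eb bt] ->.
  have eb' : 0 < (e b)%:~R :> R by rewrite ltr0z.
  move: lls; rewrite in_cons => /predU1P[->|].
    by rewrite divr_ge0 ?(ltW eb')// H// mem_cat mem_filter ltW// bt.
  move=> /mapP[c]; rewrite mem_filter => /andP[ec ct] ->.
  have ec' : (e c)%:~R < 0 :> R by rewrite ltrz0.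
  rewrite ler_pdivlMr// mulrAC ler_ndivrMr//.
  have := H (e b *: c - e c *: b).
  rewrite intvB !intvZ dotDl dotNl !dotZl subr_ge0 => hh.
  rewrite mulrC [leRHS]mulrC; apply: hh; rewrite mem_cat; apply/orP; right.
  apply/mapP; exists (b, c) => //; rewrite mem_filter /= eb ec /=.
  by apply/allpairsP; exists (b, c).
exists k; first by apply: kl; rewrite mem_head.
apply/ih/dualP => a at_; rewrite dotBr dotZr eE subr_ge0.
have [ea|ea|ea] := ltgtP (e a) 0.
- rewrite -ler_ndivrMr ?ltrz0//; apply: kl; rewrite in_cons; apply/orP; right.
  by apply/mapP; exists a => //; rewrite mem_filter ea.
- rewrite -ler_pdivlMr ?ltr0z//; apply: ku.
  by apply/mapP; exists a => //; rewrite mem_filter ea.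
- by rewrite ea mulr0 H// mem_cat mem_filter ea lexx at_.
Qed.

Lemma cone_dot s y z : cone s y -> (forall h, h \in s -> 0 <= dot (intv h) z) ->
  0 <= dot y z.
Proof.
elim: s y => [|h s ih] y /=; first by move=> -> _; rewrite dotC dot0r.
move=> [t t0 /ih H] hz.
have -> : y = (y - t *: intv h) + t *: intv h by rewrite subrK.
rewrite dotDl dotZl addr_ge0 ?mulr_ge0 ?hz ?mem_head// H// => k ks.
by rewrite hz// in_cons ks orbT.
Qed.

Lemma cone0 s : cone s 0.
Proof. by elim: s => [//|h s ih]; exists 0; rewrite // scale0r subr0. Qed.

Lemma cone_mem s h : h \in s -> cone s (intv h).
Proof.
elim: s => [//|k s ih]; rewrite in_cons => /predU1P[->|/ih hs].
  by exists 1; rewrite ?ler01// scale1r subrr; exact: cone0.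
by exists 0; rewrite ?lexx// scale0r subr0.
Qed.

(* By Weyl's theorem applied twice, the double dual of a finitely generated
   cone is the cone itself. *)
Lemma minkowski t : exists s, forall y, dual t y <-> cone s y.
Proof.
have [s sP] := weyl t; exists s.
have [q qP] := weyl s.
move=> y; split=> [/dualP ty|/cone_dot sy]; last first.
  by apply/dualP => a /cone_mem/sP/dualP sa; rewrite dotC sy// => h /sa; rewrite dotC.
apply/qP/dualP => b bq.
have : cone t (intv b).
  by apply/sP/dualP => h hs; rewrite dotC; apply: (dualP _ _ ((qP _).1 (cone_mem hs))).
by move=> /cone_dot; apply.
Qed.

(** Coefficients are indexed by elements rather than by positions, hence [uniq vs]. *)
Lemma coneP (T : eqType) (vs : seq T) (h : T -> 'rV[int]_m) y : uniq vs ->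
  cone [seq h v | v <- vs] y <->
  exists c : T -> R, (forall v, v \in vs -> 0 <= c v) /\
    y = \sum_(v <- vs) c v *: intv (h v).
Proof.
elim: vs y => [|v vs ih] y /=.
  by split=> [->|[c [_]]]; [exists (fun=> 0)|]; rewrite big_nil.
move=> /andP[vvs uvs]; split.
  move=> [t t0 /(ih _ uvs)[c [c0 E]]].
  exists (fun w => if w == v then t else c w); split.
    by move=> w; rewrite in_cons; case: eqP => //= _; exact: c0.
  rewrite big_cons eqxx -[LHS](subrK (t *: intv (h v))) addrC E; congr (_ + _).
  by apply: eq_big_seq => w wvs; case: eqP => // wv; rewrite -wv wvs in vvs.
move=> [c [c0]]; rewrite big_cons => E.
exists (c v); first by rewrite c0// mem_head.
apply/(ih _ uvs); exists c; split; last by rewrite E addrC addKr.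
by move=> w wvs; rewrite c0// in_cons wvs orbT.
Qed.

End Cones.

Section Polyhedra.
Variables (R : realType) (n : nat).
Implicit Types (v w : 'rV[rat]_n) (S : {fset 'rV[rat]_n}) (x y : 'rV[R]_n).
Implicit Types (a b : 'rV[int]_(n + 1)) (t : seq 'rV[int]_(n + 1)).

Definition pt v : 'rV[R]_n := map_mx ratr v.
Definition lift1 x : 'rV[R]_(n + 1) := row_mx x (const_mx 1).
(** An integer row of length n + 1 encodes an affine form with its constant term last; pairing it
    with the lift to height 1 makes it linear. *)
Definition ev a x : R := dot (intv R a) (lift1 x).
Definition form (p : 'rV[int]_n * int) : 'rV[int]_(n + 1) :=
  row_mx p.1 (const_mx p.2).
Definition unform a : 'rV[int]_n * int := (lsubmx a, a 0 (rshift n 0)).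

Lemma mx11_eq (T : Type) (u w : 'M[T]_1) : u 0 0 = w 0 0 -> u = w.
Proof. by move=> e; apply/matrixP => i j; rewrite !ord1. Qed.

Lemma unformK a : form (unform a) = a.
Proof.
rewrite -[RHS]hsubmxK /form /=; congr row_mx.
by apply: mx11_eq; rewrite !mxE.
Qed.

Lemma evE a x : ev a x = \sum_(i < n) (a 0 (lshift 1 i))%:~R * x 0 i +
  (a 0 (rshift n 0))%:~R.
Proof.
rewrite /ev /dot big_split_ord big_ord1 /= mxE row_mxEr mxE mulr1; congr (_ + _).
by apply: eq_bigr => i _; rewrite mxE row_mxEl.
Qed.

Lemma int_affineE p x : int_affine p x = ev (form p) x.
Proof.
rewrite evE row_mxEr mxE /int_affine; congr (_ + _).
by apply: eq_bigr => i _; rewrite row_mxEl.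
Qed.

Lemma evD a b x : ev (a + b) x = ev a x + ev b x.
Proof. by rewrite /ev intvD dotDl. Qed.
Lemma evN a x : ev (- a) x = - ev a x.
Proof. by rewrite /ev intvN dotNl. Qed.
Lemma evB a b x : ev (a - b) x = ev a x - ev b x.
Proof. by rewrite evD evN. Qed.
Lemma evZ (k : int) a x : ev (k *: a) x = k%:~R * ev a x.
Proof. by rewrite /ev intvZ dotZl. Qed.
Lemma ev0 x : ev 0 x = 0.
Proof. by rewrite -(scale0r 0) evZ mul0r. Qed.

Definition xform (i : 'I_n) : 'rV[int]_(n + 1) := delta_mx 0 (lshift 1 i).
Definition oneform : 'rV[int]_(n + 1) := delta_mx 0 (rshift n 0).

Lemma ev_xform i x : ev (xform i) x = x 0 i.
Proof. by rewrite /ev intv_delta dot_delta row_mxEl. Qed.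
Lemma ev_oneform x : ev oneform x = 1.
Proof. by rewrite /ev intv_delta dot_delta row_mxEr mxE. Qed.

Lemma lift_sum (I : eqType) (r : seq I) (l : I -> R) (p : I -> 'rV[R]_n) :
  \sum_(i <- r) l i = 1 ->
  lift1 (\sum_(i <- r) l i *: p i) = \sum_(i <- r) l i *: lift1 (p i).
Proof.
move=> l1; apply/rowP => j; rewrite summxE; case: (splitP j) => k jk.
  have -> : j = lshift 1 k by exact: val_inj.
  by rewrite row_mxEl summxE; apply: eq_bigr => i _; rewrite [RHS]mxE row_mxEl mxE.
have -> : j = rshift n 0 by apply: val_inj; rewrite /= jk ord1.
by rewrite row_mxEr mxE -l1; apply: eq_bigr => i _; rewrite mxE row_mxEr mxE mulr1.
Qed.

Lemma lift_inj : injective lift1.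
Proof. by move=> x y /eq_row_mx[]. Qed.

Lemma ev_sum (I : eqType) (r : seq I) (l : I -> R) (p : I -> 'rV[R]_n) a :
  \sum_(i <- r) l i = 1 ->
  ev a (\sum_(i <- r) l i *: p i) = \sum_(i <- r) l i * ev a (p i).
Proof.
by move=> l1; rewrite /ev lift_sum// dot_sumr; apply: eq_bigr => i _; rewrite dotZr.
Qed.

Lemma ev_segment a x y (k : R) :
  ev a (x + k *: (y - x)) = (1 - k) * ev a x + k * ev a y.
Proof.
rewrite !evE; under eq_bigr do rewrite !mxE.
rewrite !mulrDr addrACA !mulr_sumr -big_split; congr (_ + _) => /=; last by ring.
by apply: eq_bigr => i _; ring.
Qed.

Lemma chull_ev_ge0 S a x : chull R S x -> (forall v, v \in S -> 0 <= ev a (pt v)) ->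
  0 <= ev a x.
Proof.
move=> [l [l0 l1 ->]] aS; rewrite ev_sum// big_seq sumr_ge0// => v vS.
by rewrite mulr_ge0 ?l0 ?aS.
Qed.

Lemma den_gt0 v : (0 < den v)%N.
Proof.
rewrite /den; elim/big_ind: _ => // [i j i0 j0|i _]; first by rewrite lcmn_gt0 i0.
by rewrite absz_gt0 denq_neq0.
Qed.

Lemma den_coord v i : (numq ((den v)%:R * v 0 i))%:~R = (den v)%:R * v 0 i.
Proof.
have /dvdnP[k dk] : (`|denq (v 0%R i)| %| den v)%N.
  by rewrite /den (bigD1 i)//= dvdn_lcml.
have -> : (den v)%:R * v 0 i = (k%:Z * numq (v 0 i))%:~R.
  have E : (`|denq (v 0%R i)|%N)%:R = (denq (v 0 i))%:~R :> rat by rewrite -[in RHS]absz_denq.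
  rewrite -{1}[v 0 i]divq_num_den dk natrM intrM -mulrA E; congr (_ * _).
  rewrite mulrCA divff ?mulr1//.
  by rewrite intr_eq0 denq_neq0.
by rewrite numq_int.
Qed.

Lemma intv_homog v : intv R (homog v) = (den v)%:R *: lift1 (pt v).
Proof.
apply/rowP => j; case: (splitP j) => k jk.
  have -> : j = lshift 1 k by exact: val_inj.
  rewrite mxE row_mxEl [RHS]mxE row_mxEl !mxE.
  by rewrite -[LHS](@ratr_int R) den_coord rmorphM /= ratr_nat.
have -> : j = rshift n 0 by apply: val_inj; rewrite /= jk ord1.
by rewrite mxE row_mxEr [RHS]mxE row_mxEr !mxE mulr1.
Qed.

(** The hull is the section at height 1 of the cone over it: weights are divided by the
    denominators, and the last coordinate of the cone says that they add up to 1. *)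
Lemma chull_cone S x : chull R S x <-> cone [seq homog v | v <- S] (lift1 x).
Proof.
have den0 v : (den v)%:R != 0 :> R by rewrite pnatr_eq0 -lt0n den_gt0.
split=> [[l [l0 l1 ->]]|/(coneP _ _ (fset_uniq S))[c [c0 E]]].
  apply/coneP; rewrite ?fset_uniq//; exists (fun v => l v / (den v)%:R); split.
    by move=> v vS; rewrite divr_ge0 ?l0.
  by rewrite lift_sum//; apply: eq_bigr => v _; rewrite intv_homog scalerA divfK.
have E' : lift1 x = \sum_(v <- S) (c v * (den v)%:R) *: lift1 (pt v).
  by rewrite E; apply: eq_bigr => v _; rewrite intv_homog scalerA.
have s1 : \sum_(v <- S) (c v * (den v)%:R) = 1.
  have /(congr1 (fun u : 'rV__ => u 0 (rshift n 0))) := E'.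
  rewrite summxE row_mxEr [X in X = _]mxE => e; apply/esym/(etrans e).
  by apply: eq_bigr => v _; rewrite mxE row_mxEr mxE mulr1.
exists (fun v => c v * (den v)%:R); split=> // [v vS|]; first by rewrite mulr_ge0 ?c0.
apply: lift_inj; rewrite E'; exact/esym/(lift_sum pt s1).
Qed.

Lemma chull_dual S : exists t, forall x, chull R S x <-> dual t (lift1 x).
Proof.
have [t tP] := weyl R [seq homog v | v <- S]; exists t => x.
by rewrite chull_cone.
Qed.

Lemma cat_dual t t' (x : 'rV[R]_(n + 1)) : dual (t ++ t') x = dual t x && dual t' x.
Proof. exact: all_cat. Qed.

(** The inequalities of the cone over the cube. At height 0 they leave only the origin, so
    [dual_chull] meets no directions at infinity. *)
Definition cubeforms : seq 'rV[int]_(n + 1) :=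
  oneform :: [seq xform i | i <- enum 'I_n] ++ [seq oneform - xform i | i <- enum 'I_n].

Lemma dual_cubeforms (y : 'rV[R]_(n + 1)) : dual cubeforms y <->
  0 <= y 0 (rshift n 0) /\
  forall i, 0 <= y 0 (lshift 1 i) <= y 0 (rshift n 0).
Proof.
have d1 : dot (intv R oneform) y = y 0 (rshift n 0) by rewrite intv_delta dot_delta.
have dx i : dot (intv R (xform i)) y = y 0 (lshift 1 i) by rewrite intv_delta dot_delta.
rewrite /dual /= all_cat d1; split.
  move=> /and3P[y0 /allP h1 /allP h2]; split=> // i; apply/andP; split.
    by rewrite -dx h1// map_f ?mem_enum.
  rewrite -subr_ge0 -d1 -dx -dotNl -dotDl -intvN -intvD h2//.
  by apply/mapP; exists i; rewrite ?mem_enum.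
move=> [-> h] /=; apply/andP; split; apply/allP => _ /mapP[i _ ->].
  by rewrite dx; case/andP: (h i).
by rewrite intvB dotDl dotNl d1 dx subr_ge0; case/andP: (h i).
Qed.

Lemma dual_cube x : dual cubeforms (lift1 x) <-> cube R n x.
Proof.
rewrite dual_cubeforms row_mxEr mxE; split=> [[_ h] i|h].
  by have := h i; rewrite row_mxEl.
by split=> // i; rewrite row_mxEl; exact: h.
Qed.

(** The generators given by [minkowski] for the cone over the polytope become rational points after
    division by their last coordinate; those of height 0 vanish because the cube is bounded. *)
Lemma dual_chull t : exists S, forall x, chull R S x <-> cube R n x /\ dual t (lift1 x).
Proof.
have [s sP] := minkowski R (cubeforms ++ t).
pose q (g : 'rV[int]_(n + 1)) : 'rV[rat]_n :=
  \row_i ((g 0 (lshift 1 i))%:~R / (g 0 (rshift n 0))%:~R).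
have qE (g : 'rV_(n + 1)) : g 0 (rshift n 0) != 0 ->
    intv R g = (g 0 (rshift n 0))%:~R *: lift1 (pt (q g)).
  move=> g0; apply/rowP => j; case: (splitP j) => k jk.
    have -> : j = lshift 1 k by exact: val_inj.
    rewrite 2!mxE row_mxEl !mxE fmorph_div /= !ratr_int mulrCA divff ?mulr1//.
    by rewrite intr_eq0.
  have -> : j = rshift n 0 by apply: val_inj; rewrite /= jk ord1.
  by rewrite 2!mxE row_mxEr mxE mulr1.
have sD (g : 'rV_(n + 1)) : g \in s -> dual (cubeforms ++ t) (intv R g).
  by move=> /(cone_mem R)/sP.
have last0 (g : 'rV_(n + 1)) : g \in s -> (0 <= g 0 (rshift n 0)).
  by move=> /sD; rewrite cat_dual => /andP[/dual_cubeforms[+ _] _]; rewrite mxE ler0z.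
have null (g : 'rV_(n + 1)) : g \in s -> g 0 (rshift n 0) = 0 -> intv R g = 0.
  move=> /sD; rewrite cat_dual => /andP[/dual_cubeforms[_ h] _] g0.
  apply/rowP => j; rewrite [RHS]mxE; case: (splitP j) => k jk.
    have -> : j = lshift 1 k by exact: val_inj.
    by apply/le_anti; have := h k; rewrite andbC !mxE g0.
  have -> : j = rshift n 0 by apply: val_inj; rewrite /= jk ord1.
  by rewrite mxE g0.
pose S := seq_fset tt [seq q g | g : 'rV_(n + 1) <- s & g 0 (rshift n 0) != 0].
have SP v : v \in S -> exists2 g, g \in s /\ g 0 (rshift n 0) != 0 & v = q g.
  by rewrite seq_fsetE => /mapP[g]; rewrite mem_filter => /andP[? ?] ->; exists g.
exists S => x; split.
  move=> xS; have : dual (cubeforms ++ t) (lift1 x).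
    apply/dualP => a at_; apply: chull_ev_ge0 xS _ => v /SP[g [gs g0] ->].
    have /dualP/(_ _ at_) := sD g gs; rewrite (qE g)// dotZr pmulr_rge0//.
    by rewrite ltr0z lt_def g0 last0.
  by rewrite cat_dual => /andP[/dual_cube].
move=> [/dual_cube cx tx]; have /sP xs : dual (cubeforms ++ t) (lift1 x).
  by rewrite cat_dual cx.
have [t' t'P] := chull_dual S; apply/t'P/dualP => a at'.
rewrite dotC; apply: cone_dot xs _ => g gs; rewrite dotC.
have [g0|g0] := eqVneq (g 0 (rshift n 0)) 0; first by rewrite (null g)// dot0r.
rewrite (qE g)// dotZr mulr_ge0 ?ler0z ?last0//.
suff /chull_vertex/t'P/dualP/(_ _ at') : q g \in S by [].
by rewrite seq_fsetE; apply/mapP; exists g; rewrite // mem_filter g0.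
Qed.

End Polyhedra.

(** * Piecewise linear functions *)

Section Ext.
Variables (R : realType) (n : nat).
Implicit Types (x y : 'rV[R]_n) (f g : mcn R n) (a : 'rV[int]_(n + 1)).

Lemma sum_continuous (T : topologicalType) (I : Type) (r : seq I) (F : I -> T -> R) :
  (forall i, continuous (F i)) -> continuous (fun t => \sum_(i <- r) F i t).
Proof.
move=> cF; elim: r => [|i r ih].
  rewrite (_ : (fun _ => _) = fun=> 0); first exact: cst_continuous.
  by apply/funext => t; rewrite big_nil.
rewrite (_ : (fun _ => _) = F i \+ (fun t => \sum_(i <- r) F i t)).
  by move=> t; apply: (@continuousD _ R^o); [exact: cF|exact: ih].
by apply/funext => t; rewrite big_cons.
Qed.

Lemma ev_continuous a : continuous (ev a : 'rV[R]_n -> R).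
Proof.
rewrite (_ : ev a = (fun x : 'rV[R]_n => \sum_(i < n) (a 0 (lshift 1 i))%:~R * x 0 i) \+
  (fun=> (a 0 (rshift n 0))%:~R)); last by apply/funext => x; rewrite evE.
move=> x; apply: (@continuousD _ R^o); last exact: cst_continuous.
apply: sum_continuous => i y; apply: (@continuousM R); first exact: cst_continuous.
exact: coord_continuous.
Qed.

Lemma rV_continuous (T : topologicalType) (f : T -> 'rV[R]_n) :
  (forall i, continuous (fun t => f t 0 i)) -> continuous f.
Proof.
move=> cf x A /nbhs_ballP[e /= e0 eA].
have : \forall t \near x, forall i, ball (f x 0 i) e (f t 0 i).
  apply: filter_forall => i; apply: (cf i x).
  by apply/nbhs_ballP; exists e.
rewrite /nbhs/=; apply: filterS => t h; apply: eA; split=> // i j.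
by rewrite ord1; exact: h.
Qed.

Definition clampv x : 'rV[R]_n := \row_i Num.max 0 (Num.min (x 0 i) 1).

Lemma clampvP x : cube R n (clampv x).
Proof. by move=> i; rewrite mxE le_max lexx/= ge_max ler01 ge_min lexx orbT. Qed.

Definition clamp x : cube R n := SigSub (mem_set (clampvP x)).

Lemma clamp_id x : cube R n x -> val (clamp x) = x.
Proof.
move=> cx; apply/rowP => i; rewrite mxE; have /andP[h0 h1] := cx i.
by rewrite min_l// max_r.
Qed.

Lemma clampK (x : cube R n) : clamp (val x) = x.
Proof. by apply: val_inj; rewrite clamp_id//; exact: set_mem (valP x). Qed.

Lemma clamp_continuous : continuous clamp.
Proof.
apply: continuous_comp_initial; apply: rV_continuous => i.
rewrite (_ : (fun _ => _) = fun x : 'rV[R]_n => Num.max 0 (Num.min (x 0 i) 1)).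
  move=> x; apply: (@continuous_max _ _ (fun=> 0) (fun x => Num.min (x 0 i) 1) x).
    exact: cst_continuous.
  apply: (@continuous_min _ _ (fun x => x 0 i) (fun=> 1) x).
    exact: coord_continuous.
  exact: cst_continuous.
by apply/funext => y; rewrite /= mxE.
Qed.

(* Precomposing with the retraction onto the cube avoids the subspace topology. *)
Definition ext f x : R := f (clamp x).

Lemma ext_continuous f : continuous (ext f).
Proof.
move=> x; apply: continuous_comp; first exact: clamp_continuous.
by have /asboolP[cf _] := mcnP f; exact: cf.
Qed.

Lemma extE f (x : cube R n) : ext f (val x) = f x.
Proof. by rewrite /ext clampK. Qed.

Lemma mcn_leP f g : (f <= g) <-> forall x, cube R n x -> ext f x <= ext g x.
Proof.
split=> [/lefP h x _|h]; first exact: h.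
by apply/lefP => x; have := h (val x) (set_mem (valP x)); rewrite !extE.
Qed.

Lemma mcn_eqP f g : f = g <-> forall x, cube R n x -> ext f x = ext g x.
Proof.
split=> [-> //|h]; apply/val_inj/funext => x.
by have := h (val x) (set_mem (valP x)); rewrite !extE.
Qed.

Lemma aff_subproof a : (fun x : cube R n => ev a (val x)) \in @mcn_pred R n.
Proof.
apply/asboolP; split.
  move=> x; apply: continuous_comp; first exact: initial_continuous.
  exact: ev_continuous.
by exists [:: unform a] => x; exists (unform a); rewrite ?mem_head// int_affineE unformK.
Qed.
Definition aff a : mcn R n := Mcn (aff_subproof a).

Lemma ext_aff a x : cube R n x -> ext (aff a) x = ev a x.
Proof. by move=> cx; rewrite -{2}(clamp_id cx). Qed.
Lemma extD f g x : ext (f + g) x = ext f x + ext g x. Proof. by []. Qed.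
Lemma extN f x : ext (- f) x = - ext f x. Proof. by []. Qed.
Lemma extB f g x : ext (f - g) x = ext f x - ext g x. Proof. by []. Qed.
Lemma ext0 x : ext 0 x = 0. Proof. by []. Qed.
Lemma ext1 x : ext ounit x = 1. Proof. by []. Qed.
Lemma ext_join f g x : ext (ljoin f g) x = Num.max (ext f x) (ext g x). Proof. by []. Qed.
Lemma ext_meet f g x : ext (lmeet f g) x = Num.min (ext f x) (ext g x). Proof. by []. Qed.
Lemma extMn f k x : ext (f *+ k) x = k%:R * ext f x.
Proof. by elim: k => [|k ih]; rewrite ?mulr0n ?mul0r// mulrS extD ih mulrS mulrDl mul1r. Qed.
Lemma ext_pos f x : ext (lpos f) x = Num.max 0 (ext f x). Proof. by []. Qed.
Lemma ext_abs f x : ext (labs f) x = `|ext f x|.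
Proof.
rewrite /labs extD !ext_pos extN.
by have [h|h] := leP 0 (ext f x); [rewrite ger0_norm// max_l ?addr0// oppr_le0|
  rewrite ltr0_norm// add0r max_r// oppr_ge0 ltW].
Qed.

Definition extr := (ext_aff, extD, extN, ext0, ext1, ext_join, ext_meet, extMn, ext_pos, ext_abs).

Lemma ext_pieces f : exists s : seq 'rV[int]_(n + 1), forall x, cube R n x ->
  exists2 a, a \in s & ext f x = ev a x.
Proof.
have /asboolP[_ [s sP]] := mcnP f; exists [seq form p | p <- s] => x cx.
have [p ps e] := sP (clamp x).
by exists (form p); rewrite ?map_f// /ext e int_affineE clamp_id.
Qed.

Lemma cube_segment x y (k : R) : cube R n x -> cube R n y -> 0 <= k <= 1 ->
  cube R n (x + k *: (y - x)).
Proof.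
move=> cx cy /andP[k0 k1] i; rewrite !mxE; have := cx i; have := cy i.
by move=> /andP[? ?] /andP[? ?]; apply/andP; split; nra.
Qed.

Lemma segment_continuous x y : continuous (fun k : R => x + k *: (y - x)).
Proof.
by move=> k; apply: cvgD; [exact: cvg_cst|apply: cvgZr_tmp; exact: cvg_id].
Qed.

(* At x + k *: (y - x) the gap between the piece taken at x and any other value
   of f is at least (1 - k) * d, so by the intermediate value theorem f cannot
   leave this piece before y. *)
Lemma pwl_transfer f (s : seq 'rV[int]_(n + 1)) x y a :
  (forall z, cube R n z -> exists2 b, b \in s & ext f z = ev b z) ->
  cube R n x -> cube R n y ->
  (forall b c, b \in s -> c \in s -> ev b x <= ev c x -> ev b y <= ev c y) ->
  a \in s -> ext f x = ev a x -> ext f y = ev a y.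
Proof.
move=> sP cx cy sxy as_ fx; apply: contrapT => fy.
pose z k := x + k *: (y - x).
pose g k := ext f (z k) - ev a (z k).
have [d d0 dP] : exists2 d, 0 < d & forall b, b \in s -> ev b x != ev a x -> d < `|ev b x - ev a x|.
  elim: (s) => [|c s' [d d0 ih]]; first by exists 1; rewrite ?ltr01.
  have [e|ne] := eqVneq (ev c x) (ev a x).
    exists d => // b; rewrite in_cons => /predU1P[->|]; last exact: ih.
    by rewrite e eqxx.
  have e0 : 0 < `|ev c x - ev a x| by rewrite normr_gt0 subr_eq0.
  exists (Num.min d (`|ev c x - ev a x| / 2)).
    by rewrite lt_min d0 divr_gt0.
  move=> b; rewrite in_cons => /predU1P[-> _|bs /(ih _ bs) h].
    by rewrite gt_min ltr_pdivrMr// ltr_pMr// ltr1n orbT.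
  by rewrite gt_min h.
have gap k : 0 <= k <= 1 -> g k = 0 \/ (1 - k) * d < `|g k| \/ k = 1.
  move=> k01; have [b bs fb] := sP _ (cube_segment cx cy k01).
  rewrite /g /z fb !ev_segment opprD addrACA -!mulrBr.
  have [k1|k1] := eqVneq k 1; first by right; right.
  have [e|ne] := eqVneq (ev b x) (ev a x).
    left; rewrite e subrr mulr0 add0r.
    have -> : ev b y = ev a y by apply/le_anti; rewrite !sxy ?e.
    by rewrite subrr mulr0.
  right; left; have /(_ b bs ne) h := dP.
  have k1' : 0 < 1 - k by rewrite subr_gt0 lt_neqAle k1; case/andP: k01.
  have /andP[k0 _] := k01.
  apply: lt_le_trans (_ : (1 - k) * `|ev b x - ev a x| <= _).
    by rewrite ltr_pM2l.
  have [lt|lt] := leP (ev b x) (ev a x).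
    have := sxy _ _ bs as_ lt; rewrite ler0_norm ?subr_le0// => h2.
    rewrite ler0_norm; last by nra.
    nra.
  have := sxy _ _ as_ bs (ltW lt); rewrite gtr0_norm ?subr_gt0// => h2.
  rewrite ger0_norm; last by nra.
  nra.
have cz : continuous z by exact: segment_continuous.
have cg : continuous g.
  move=> k; apply: cvgB; first by apply: (continuous_comp (cz k)); exact: ext_continuous.
  by apply: (continuous_comp (cz k)); exact: ev_continuous.
(* At a zero of [p] the value of [|g k|] is [(1 - k) * (d / 2)]. The first two alternatives of [gap]
   allow this only at [k = 1], which [p1] excludes. *)
pose p k := `|g k| - (1 - k) * (d / 2).
have cp : continuous p.
  move=> k; apply: cvgB; first by apply: cvg_norm; exact: cg.
  by apply: cvgM; [apply: cvgB; [exact: cvg_cst|exact: cvg_id]|exact: cvg_cst].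
have z0 : z 0 = x by rewrite /z scale0r addr0.
have z1 : z 1 = y by rewrite /z scale1r addrC subrK.
have p0 : p 0 < 0 by rewrite /p /g z0 fx subrr normr0 sub0r subr0 mul1r oppr_lt0 divr_gt0.
have p1 : 0 < p 1.
  by rewrite /p /g z1 subrr mul0r subr0 normr_gt0 subr_eq0; apply/eqP.
have [||k k01 pk] := @IVT R p 0 1 0 ler01.
- exact: continuous_subspaceT.
- by rewrite ge_min le_max (ltW p0) (ltW p1) orbT.
move: k01; rewrite in_itv /= => k01; have /andP[k0 k1] := k01.
have [gk|[gk|k1']] := gap k k01; last by rewrite k1' in pk; rewrite pk ltxx in p1.
- move: pk; rewrite /p gk normr0 sub0r => /eqP; rewrite oppr_eq0 mulf_eq0 => /orP[|].
    rewrite subr_eq0 => /eqP k1'.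
    by move: p1; rewrite k1' /p gk normr0 -k1' subrr mul0r subrr ltxx.
  by rewrite mulf_eq0 invr_eq0 pnatr_eq0 orbF gt_eqF.
move: pk; rewrite /p => /eqP; rewrite subr_eq0 => /eqP e; rewrite e in gk.
have : 0 <= (1 - k) * d by rewrite mulr_ge0 ?subr_ge0// ltW.
by lra.
Qed.

End Ext.

(** Applied to the differences of the pieces of a function, this lists all possible sign patterns,
    so that the cells of [pwl_cells] are finite in number. *)
Lemma ex_all_filters (T : eqType) (D : seq T) :
  exists Ls : seq (seq T), forall P : pred T, [seq d <- D | P d] \in Ls.
Proof.
elim: D => [|d D [Ls h]]; first by exists [:: [::]] => P; rewrite mem_head.
exists (Ls ++ map (cons d) Ls) => P /=; rewrite mem_cat.
by case: ifP => _; rewrite ?h// (map_f (cons d)) ?orbT// h.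
Qed.

Lemma ex_bound_seq (T : eqType) (L : seq T) (Q : T -> nat -> Prop) :
  (forall t k k', (k <= k')%N -> Q t k -> Q t k') ->
  (forall t, t \in L -> exists k, Q t k) -> exists k, forall t, t \in L -> Q t k.
Proof.
move=> mono; elim: L => [|t L ih] h; first by exists 0%N.
have [|k kP] := ih; first by move=> u uL; apply: h; rewrite in_cons uL orbT.
have [k' k'P] := h t (mem_head _ _).
exists (maxn k k') => u; rewrite in_cons => /predU1P[->|/kP].
  by apply: mono k'P; rewrite leq_maxr.
by apply: mono; rewrite leq_maxl.
Qed.

Section PiecewiseLinear.
Variables (R : realType) (n : nat).
Implicit Types (x y : 'rV[R]_n) (f g : mcn R n) (a : 'rV[int]_(n + 1)).
Implicit Types (t : seq 'rV[int]_(n + 1)) (L : seq (seq 'rV[int]_(n + 1))).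

Lemma dual_ev t x : dual t (lift1 x) <-> forall a, a \in t -> 0 <= ev a x.
Proof. by split=> [/dualP//|h]; apply/dualP. Qed.

(** The cell of [x] consists of the points where each difference of pieces that is nonnegative at
    [x] stays nonnegative. By [pwl_transfer] the piece taken at [x] is then taken on the whole cell.
    The filter keeps the sign patterns on which [f] is affine. *)
Lemma pwl_cells f : exists L,
  (forall x, cube R n x -> exists2 t, t \in L & dual t (lift1 x)) /\
  forall t, t \in L -> exists a, forall x, cube R n x -> dual t (lift1 x) ->
    ext f x = ev a x.
Proof.
have [s sP] := ext_pieces f.
have [Ls LsP] := ex_all_filters [seq c - b | b <- s, c <- s].
exists [seq t <- Ls | `[< exists a, forall x, cube R n x -> dual t (lift1 x) ->
    ext f x = ev a x >]]; split; last first.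
  by move=> t; rewrite mem_filter => /andP[/asboolP].
move=> x cx; pose t := [seq d <- [seq c - b | b <- s, c <- s] | 0 <= ev d x].
exists t; last by apply/dual_ev => d; rewrite mem_filter => /andP[].
rewrite mem_filter LsP andbT; apply/asboolP.
have [a as_ fx] := sP x cx; exists a => y cy /dual_ev ty.
apply: pwl_transfer sP cx cy _ as_ fx => b c bs cs; rewrite -subr_ge0 -evB => h.
rewrite -subr_ge0 -evB; apply: ty; rewrite mem_filter h.
by apply/allpairsP; exists (b, c).
Qed.

Lemma cells_polyhedron L :
  rational_polyhedron [set x | cube R n x /\ exists2 t, t \in L & dual t (lift1 x)].
Proof.
have /choice[S SP] := @dual_chull R n.
exists [seq S t | t <- L]; apply/seteqP; split=> x /=.
  by move=> [cx [t tL tx]]; exists (S t); rewrite /= ?map_f//; apply/SP.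
move=> [_ /= /mapP[t tL ->] /SP[cx tx]]; split=> //; by exists t.
Qed.

Lemma le0_polyhedron f : rational_polyhedron [set x | cube R n x /\ ext f x <= 0].
Proof.
have [L [L1 L2]] := pwl_cells f.
have /choice[a aP] : forall t, exists a, t \in L ->
    forall x, cube R n x -> dual t (lift1 x) -> ext f x = ev a x.
  move=> t; have [/L2[a ?]|] := boolP (t \in L); first by exists a.
  by exists 0.
have dN t x : dual (- a t :: t) (lift1 x) = (ev (a t) x <= 0) && dual t (lift1 x).
  by rewrite /dual /= -[dot _ _]/(ev (- a t) x) evN oppr_ge0.
rewrite (_ : [set x | _] = [set x | cube R n x /\
    exists2 t, t \in [seq - a t :: t | t <- L] & dual t (lift1 x)]).
  exact: cells_polyhedron.
apply/seteqP; split=> x /= [cx].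
  have [t tL tx] := L1 x cx; rewrite (aP _ tL x cx tx) => h; split=> //.
  by exists (- a t :: t); rewrite ?dN ?h// (map_f (fun t => - a t :: t)).
move=> [_ /mapP[t tL ->]]; rewrite dN => /andP[h tx].
by rewrite (aP _ tL x cx tx).
Qed.

(** Intersections of half-spaces are zerosets of sums of negative parts; in [polyhedron_zeroset]
    unions become meets. *)
Lemma dual_zeroset t : exists f, 0 <= f /\
  forall x, cube R n x -> ext f x = 0 <-> dual t (lift1 x).
Proof.
elim: t => [|a t [f [f0 fP]]]; first by exists 0; split.
have p0 : 0 <= lpos (- aff R a) by exact: lpos_ge0.
exists (lpos (- aff R a) + f); split=> [|x cx]; first exact: lg_addr_ge0.
have -> : dual (a :: t) (lift1 x) = (0 <= ev a x) && dual t (lift1 x) by [].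
move: f0 p0 => /mcn_leP/(_ x cx) + /mcn_leP/(_ x cx).
rewrite !extr// => f0 p0; split.
  move=> /eqP; rewrite paddr_eq0// => /andP[/eqP e /eqP/(fP _ cx) ->]; rewrite andbT.
  by rewrite -oppr_le0 -e le_max lexx orbT.
by move=> /andP[h /(fP x cx) ->]; rewrite max_l ?addr0// oppr_le0.
Qed.

Lemma polyhedron_zeroset (P : set 'rV[R]_n) : rational_polyhedron P ->
  exists f, 0 <= f /\ forall x, cube R n x -> ext f x = 0 <-> P x.
Proof.
move=> [s ->]; elim: s => [|S s [f [f0 fP]]].
  exists ounit; split=> [|x cx]; first exact: ounit_ge0.
  split=> [/eqP|[]//]; by rewrite ext1 oner_eq0.
have [t tP] := chull_dual R S; have [g [g0 gP]] := dual_zeroset t.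
exists (lmeet g f); split=> [|x cx]; first by rewrite lexlmI g0.
move: f0 g0 => /mcn_leP/(_ x cx) + /mcn_leP/(_ x cx); rewrite ext0 ext_meet => f0 g0.
split=> [/eqP|].
  have [_ /eqP/(gP _ cx)/tP Sx|_ /eqP/(fP _ cx)[T sT Tx]] := leP (ext g x) (ext f x).
    by exists S => //=; rewrite mem_head.
  by exists T => //=; rewrite in_cons [T \in s]sT orbT.
move=> [T /=]; rewrite in_cons => /predU1P[->|sT Tx].
  by move=> /tP/(gP _ cx) ->; rewrite min_l.
have -> : ext f x = 0 by apply/(fP _ cx); exists T.
by rewrite min_r.
Qed.

(* On the polytopes of a common subdivision both functions are affine, so it is
   enough to compare them at the finitely many vertices. *)
Lemma domination f g : 0 <= g ->
  (forall x, cube R n x -> ext g x = 0 -> ext f x = 0) ->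
  exists k, labs f <= g *+ k.
Proof.
move=> /mcn_leP g0 gf.
have [Lf [Lf1 Lf2]] := pwl_cells f; have [Lg [Lg1 Lg2]] := pwl_cells g.
have gx0 x k k' : cube R n x -> (k <= k')%N -> k%:R * ext g x <= k'%:R * ext g x.
  by move=> cx kk'; rewrite ler_wpM2r ?ler_nat// -(ext0 x) g0.
have [|t|k kP] := @ex_bound_seq _ [seq t ++ t' | t <- Lf, t' <- Lg]
  (fun t k => forall x, cube R n x -> dual t (lift1 x) -> `|ext f x| <= k%:R * ext g x).
- by move=> t k k' kk' h x cx tx; apply: le_trans (h x cx tx) (gx0 _ _ _ cx kk').
- move=> /allpairsP[[tf tg] /= [/Lf2[a aP] /Lg2[b bP] ->]].
  have [S SP] := dual_chull R (tf ++ tg).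
  have Sv v : v \in S -> [/\ cube R n (pt R v), ext f (pt R v) = ev a (pt R v) &
      ext g (pt R v) = ev b (pt R v)].
    move=> /(chull_vertex R)/SP[cv]; rewrite cat_dual => /andP[v1 v2].
    by split; [|exact: aP|exact: bP].
  have [|v vS|k kP] := @ex_bound_seq _ (S : seq _)
      (fun v k => cube R n (pt R v) -> `|ext f (pt R v)| <= k%:R * ext g (pt R v)).
  + by move=> v k k' kk' h cv; apply: le_trans (h cv) (gx0 _ _ _ cv kk').
  + have [e|ne] := eqVneq (ext g (pt R v)) 0.
      by exists 0%N => cv; rewrite gf// normr0 mul0r.
    exists (Num.bound (`|ext f (pt R v)| / ext g (pt R v))) => cv.
    have gv : 0 < ext g (pt R v) by rewrite lt_def ne -(ext0 (pt R v)) g0.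
    rewrite -ler_pdivrMr//; apply/ltW/archi_boundP.
    by rewrite divr_ge0// ltW.
  exists k => x cx tx; have /SP[l [l0 l1 xE]] := conj cx tx.
  move: tx; rewrite cat_dual => /andP[tfx tgx].
  rewrite (aP x)// (bP x)// xE !(ev_sum (@pt R n))// mulr_sumr.
  apply: le_trans (ler_norm_sum _ _ _) _; rewrite !big_seq; apply: ler_sum => v vS.
  have [cv fv gv] := Sv v vS; rewrite normrM ger0_norm ?l0// mulrCA.
  by rewrite ler_wpM2l ?l0// -fv -gv kP.
exists k; apply/mcn_leP => x cx; rewrite extMn ext_abs.
have [t tL tx] := Lf1 x cx; have [t' t'L t'x] := Lg1 x cx.
by apply: (kP (t ++ t')); rewrite ?allpairs_f// cat_dual tx.
Qed.

End PiecewiseLinear.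

(** * Germs of piecewise linear functions along a decreasing sequence of polyhedra *)

Section Topology.
Variables (R : realType) (n : nat).
Implicit Types (x : 'rV[R]_n).

Lemma chull_closed S : closed (chull R S : set 'rV[R]_n).
Proof.
have [t tP] := chull_dual R S.
rewrite (_ : chull R S = \bigcap_(a in [set` t]) [set x | 0 <= ev a x]).
  apply: closed_bigI => a _; apply: (@preimage_closed _ _ (ev a) [set y | 0 <= y]).
    by move=> y _; exact: ev_continuous.
  exact: closed_ge.
apply/seteqP; split=> x; rewrite tP; first by move=> /dual_ev h a; exact: h.
by move=> h; apply/dual_ev => a; exact: h.
Qed.

Lemma polyhedron_closed (P : set 'rV[R]_n) : rational_polyhedron P -> closed P.
Proof.
move=> [s ->]; apply: closed_bigcup => [|S _]; last exact: chull_closed.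
exact: finite_seq.
Qed.

Lemma cube_compact : compact (cube R n).
Proof.
apply: (@rV_compact R n (fun=> [set y : R | 0 <= y <= 1])) => _.
by rewrite (_ : [set y | _] = `[0, 1]%classic); [exact: segment_compact|apply/seteqP; split=> y /=; rewrite in_itv].
Qed.
End Topology.

Section DecreasingPolyhedra.
Variables (R : realType) (n : nat) (P : nat -> set 'rV[R]_n).
Hypothesis P_poly : forall j, rational_polyhedron (P j).
Hypothesis P_cube : forall j, P j `<=` cube R n.
Hypothesis P_ne : forall j, P j !=set0.
Hypothesis P_dec : forall i j, (i <= j)%N -> P j `<=` P i.

(** The ideal depends on a realization only through the supports. Its convexity is kept as the
    variable [hI], so that instantiating it gives the quotient [stellar_group] itself. *)
Definition germ_ideal : set (mcn R n) :=
  [set f | exists j, val @^-1` P j `<=` zeroset f].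
Variable hI : convex_lsubgroup germ_ideal.
Let G : ulGroupType := lquot hI.
Let K : set 'rV[R]_n := \bigcap_j P j.
Local Open Scope quotient_scope.
Local Notation pi f := (\pi_(lquot hI) f).
Implicit Types (f g : mcn R n) (x z : 'rV[R]_n).

Lemma germ_idealE f : germ_ideal f <-> exists j, forall x, P j x -> ext f x = 0.
Proof.
split=> -[j h]; exists j => x Px.
  have : P j (val (clamp x)) by rewrite clamp_id//; exact: P_cube Px.
  exact: h.
by rewrite /zeroset/= -extE; exact: h.
Qed.

Lemma pi_le f g : (pi f <= pi g :> G) <->
  exists j, forall x, P j x -> ext f x <= ext g x.
Proof.
rewrite -[pi f <= pi g]/(lqle (pi f) (pi g)) lqleE germ_idealE.
split=> -[j h]; exists j => x /h; rewrite ext_pos extB.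
  by move=> e; rewrite -subr_le0 -e le_max lexx orbT.
by rewrite -subr_le0 => ?; rewrite max_l.
Qed.

Lemma pi_eq f g : (pi f = pi g :> G) <->
  exists j, forall x, P j x -> ext f x = ext g x.
Proof.
split=> [e|[j h]].
  have /pi_le[i hi] : (pi f <= pi g :> G) by rewrite e.
  have /pi_le[j hj] : (pi g <= pi f :> G) by rewrite e.
  exists (maxn i j) => x Px; apply/le_anti; rewrite hi ?hj//;
    by apply: P_dec Px; rewrite ?leq_maxr ?leq_maxl.
by apply/le_anti/andP; split; apply/pi_le; exists j => x /h ->.
Qed.

Lemma piD f g : pi (f + g) = pi f + pi g :> G. Proof. by have [] := pi_ulhom hI. Qed.
Lemma pi_join f g : pi (ljoin f g) = ljoin (pi f : G) (pi g).
Proof. by have [_ h] := pi_ulhom hI; rewrite h. Qed.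
Lemma pi_meet f g : pi (lmeet f g) = lmeet (pi f : G) (pi g).
Proof. by have [_ _ h] := pi_ulhom hI; rewrite h. Qed.
Lemma piN f : pi (- f) = - pi f :> G. Proof. exact: lqoppE. Qed.
Lemma pi_abs f : pi (labs f) = labs (pi f : G).
Proof. by rewrite /labs /lpos piD !pi_join piN. Qed.
Lemma piMn f k : pi (f *+ k) = pi f *+ k :> G.
Proof. by elim: k => [//|k ih]; rewrite !mulrS piD ih. Qed.

Lemma pi1 : pi ounit = ounit :> G. Proof. by []. Qed.

Lemma bigcap_cube : K `<=` cube R n.
Proof. by move=> x /(_ 0%N I)/P_cube. Qed.

(** A point of [K] has the neighbourhood [U], and a point off [K] has one that misses some [P i],
    hence all later ones. Compactness of the cube makes the index uniform. *)
Lemma cut_open (U : set 'rV[R]_n) : open U -> K `<=` U -> exists j, P j `<=` U.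
Proof.
move=> oU KU.
have /compact_near_coveringP/(_ nat \oo (fun j x => P j x -> U x)) := @cube_compact R n.
move=> /(_ _)[x _|N _ h].
  have [Kx|] := pselect (K x).
    exists (U, setT) => /=; last by move=> -[y j] [/= Uy _] _.
    by split; [apply: open_nbhs_nbhs; split=> //; exact: KU|exact: filterT].
  move=> /existsNP[i /not_implyP[_ Pi]].
  exists (~` P i, [set j | (i <= j)%N]) => /=.
    split; last exact: nbhs_infty_ge.
    apply: open_nbhs_nbhs; split=> //; apply: closed_openC.
    by apply: polyhedron_closed; exact: P_poly.
  by move=> -[y j] [/= Py ij] /(P_dec ij).
by exists N => x Px; apply: (h N) => //=; exact: P_cube Px.
Qed.

Lemma bigcap_neq0 : K !=set0.
Proof.
apply/set0P/negP => /eqP K0; have [|j] := @cut_open set0 open0; first by rewrite K0.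
by have [x Px] := P_ne j; move=> /(_ x Px).
Qed.

Lemma bigcap_compact : compact K.
Proof.
apply: subclosed_compact (@cube_compact R n) bigcap_cube.
by apply: closed_bigI => j _; by apply: polyhedron_closed; exact: P_poly.
Qed.

Lemma open_ext_gt f (c : R) : open [set x | c < ext f x].
Proof.
apply: (@open_comp _ _ (ext f) [set y | c < y]); last exact: open_gt.
by move=> x _; exact: ext_continuous.
Qed.

(** By compactness of [K] one multiple of [f] exceeds 1 on [K]; the set where it does so is open,
    and [cut_open] spreads the inequality to some [P j]. *)
Lemma pos_on_bigcap f : (forall x, K x -> 0 < ext f x) ->
  exists k, (ounit : G) <= pi f *+ k.
Proof.
move=> f0.
have /compact_near_coveringP/(_ nat \oo (fun k x => 1 < k%:R * ext f x)) := bigcap_compact.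
move=> /(_ _)[x Kx|k _ h].
  have fx := f0 x Kx; pose c := ext f x / 2.
  have c0 : 0 < c by rewrite divr_gt0.
  exists ([set y | c < ext f y], [set k | (Num.bound c^-1 <= k)%N]) => /=.
    split; last exact: nbhs_infty_ge.
    apply: open_nbhs_nbhs; split; first exact: open_ext_gt.
    by rewrite /= /c ltr_pdivrMr// ltr_pMr// ltr1n.
  move=> -[y k] [/= cy ck]; apply: (@lt_le_trans _ _ (k%:R * c)).
    rewrite -ltr_pdivrMr// mul1r; apply: lt_le_trans (archi_boundP _) _.
      by rewrite invr_ge0 ltW.
    by rewrite ler_nat.
  by rewrite ler_wpM2l// ltW.
have [|j Pj] := @cut_open _ (@open_ext_gt (f *+ k) 1).
  by move=> x Kx /=; rewrite extMn; apply: h => //=.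
exists k; rewrite -piMn -pi1; by apply/pi_le; exists j => x /Pj/= /ltW.
Qed.

(** The value is taken on a representative. For [z] in [K] it depends on the germ only, because [z]
    lies in every [P j]. *)
Definition evalz z (a : G) : R := ext (repr a) z.

Lemma evalz_pi z f : K z -> evalz z (pi f) = ext f z.
Proof.
move=> Kz; have /pi_eq[j h] : pi (repr (pi f)) = pi f by rewrite reprK.
by rewrite /evalz h//; exact: Kz.
Qed.

Lemma evalz_ulhom z : K z -> ulhom (evalz z).
Proof.
move=> Kz; split.
- by elim/quotW=> f; elim/quotW=> g; rewrite -[X in evalz z X]piD !evalz_pi.
- by elim/quotW=> f; elim/quotW=> g; rewrite -[X in evalz z X]pi_join !evalz_pi.
- by elim/quotW=> f; elim/quotW=> g; rewrite -[X in evalz z X]pi_meet !evalz_pi.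
- exact: evalz_pi.
Qed.

Definition point_ideal z : set G := [set a | evalz z a = 0].

Lemma point_idealP z f : K z -> point_ideal z (pi f) <-> ext f z = 0.
Proof. by move=> Kz; rewrite /point_ideal /= evalz_pi. Qed.

Lemma lideal_unit (H : ulGroupType) (J : set H) : convex_lsubgroup J ->
  J ounit -> J = setT.
Proof.
move=> cJ J1; have [J0 JB JU JC] := cJ; apply/seteqP; split=> // a _.
apply/(labs_convex cJ); have [k ak] := ounitP (labs a).
have Jk : J (ounit *+ k).
  by elim: (k) => [//|i ih]; rewrite mulrS; exact: convex_lsubgroupD.
by apply: JC Jk => //; exact: labs_ge0.
Qed.

(** If a larger ideal contains a germ [f] with [f z] nonzero, choose [k] with [k |f z| > 1]. The
    positive part of [1 - k |f|] vanishes at [z], so it is in the ideal too, and its sum with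
    [k |f|] dominates the unit. *)
Lemma point_ideal_maximal z : K z -> maximal_lideal (point_ideal z).
Proof.
move=> Kz; split.
- by exists R, (evalz z); split; first exact: evalz_ulhom.
- move=> /(congr1 (@^~ (pi ounit))) /= e.
  have : point_ideal z (pi ounit) by rewrite e.
  by move=> /(point_idealP _ Kz)/eqP; rewrite ext1 oner_eq0.
move=> J lJ JT zJ; apply/seteqP; split=> // a Ja; apply: contrapT => za; apply: JT.
have cJ := lideal_convex lJ; have [J0 JB JU JC] := cJ.
apply: (lideal_unit cJ); move: a Ja za.
elim/quotW => f Jf /(point_idealP _ Kz) /eqP fz.
have fz0 : 0 < `|ext f z| by rewrite normr_gt0.
pose k := Num.bound (`|ext f z|^-1).
have kf : 1 < k%:R * `|ext f z|.
  by rewrite -ltr_pdivrMr// mul1r archi_boundP// invr_ge0.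
pose g := lpos (ounit - labs f *+ k).
have Jg : J (pi g).
  apply/zJ/(point_idealP _ Kz); rewrite ext_pos extB extMn ext_abs ext1.
  by rewrite max_l// subr_le0 ltW.
have Jlf : J (pi (labs f)) by rewrite pi_abs; apply/(labs_convex cJ).
have Jk : J (pi (labs f *+ k)).
  rewrite piMn; elim: (k) => [//|i ih]; rewrite mulrS; exact: convex_lsubgroupD.
apply: JC (convex_lsubgroupD cJ Jg Jk); first exact: ounit_ge0.
rewrite -piD; apply/pi_le; exists 0%N => x _.
rewrite extD ext_pos extB -lerBlDr le_max lexx orbT//.
Qed.

(** Otherwise each point of [K] has a germ of [J] that does not vanish there. Finitely many of them
    have absolute values whose sum is positive on [K], and [pos_on_bigcap] puts the unit into
    [J]. *)
Lemma proper_sub_point (J : set G) : convex_lsubgroup J -> J <> setT ->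
  exists2 z, K z & J `<=` point_ideal z.
Proof.
move=> cJ JT; have [J0 JB JU JC] := cJ; apply: contrapT => nz; apply: JT.
apply: (lideal_unit cJ).
have := bigcap_compact; rewrite compact_cover.
move=> /(_ _ [set f | J (pi f)] (fun f => [set x | 0 < ext (labs f) x])).
case=> [f _|z Kz|D DJ KD].
- exact: open_ext_gt.
- apply: contrapT => h; apply: nz; exists z => // a Ja; apply: contrapT; move: a Ja.
  elim/quotW => f Jf /(point_idealP _ Kz)/eqP fz; apply: h; exists f => //.
  by rewrite /mkset ext_abs normr_gt0.
pose F := \sum_(f <- D) labs f.
have JF : J (pi F).
  rewrite /F big_seq; elim/big_ind: _ => [//|f g Jf Jg|f fD].
    by rewrite piD; exact: convex_lsubgroupD.
  by rewrite pi_abs; apply/(labs_convex cJ); have := DJ f fD; rewrite inE.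
have [x Kx|k Fk] := @pos_on_bigcap F.
  have [f fD fx] := KD x Kx; rewrite /F (big_fsetD1 f)// extD.
  apply: ltr_pwDl; first exact: fx.
  elim/big_ind: _ => [|u v|g _]; rewrite ?ext0//; first by move=> u0 v0; rewrite extD addr_ge0.
  by rewrite ext_abs.
have Jk : J (pi F *+ k).
  by elim: (k) => [//|i ih]; rewrite mulrS; exact: convex_lsubgroupD.
by apply: JC Jk => //; exact: ounit_ge0.
Qed.

Lemma maximal_point (m : set G) : maximal_lideal m ->
  exists2 z, K z & m = point_ideal z.
Proof.
move=> [lm mT mmax]; have [z Kz mz] := proper_sub_point (lideal_convex lm) mT.
have [lz zT _] := point_ideal_maximal Kz.
by exists z => //; rewrite (mmax _ lz zT mz).
Qed.

(** With a rational [q] strictly between two distinct coordinates, the functions are the two parts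
    of the integer form [denq q * x_i - numq q]. *)
Lemma separating (x y : 'rV[R]_n) : cube R n x -> cube R n y -> x <> y ->
  exists f g, [/\ lmeet f g = 0, 0 < ext f x & 0 < ext g y].
Proof.
move=> cx cy xy.
have [i xyi] : exists i, x 0 i != y 0 i.
  apply: contrapT => /forallNP h; apply: xy; apply/rowP => i.
  by have /negP := h i; rewrite negbK => /eqP.
wlog lt : x y cx cy xy xyi / x 0 i < y 0 i.
  move=> H; have [lt|lt|e] := ltgtP (x 0 i) (y 0 i); first exact: H.
    have [||f [g [h1 h2 h3]]] := H y x cy cx _ _ lt; rewrite 1?eq_sym//.
      by move=> e; apply: xy.
    by exists g, f; split=> //; rewrite lmeetC.
  by rewrite e eqxx in xyi.
have [q /andP[xq qy]] : exists q : rat, x 0 i < ratr q < y 0 i.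
  by have [q] := rat_in_itvoo lt; rewrite in_itv /= => ?; exists q.
have d0 : 0 < (denq q)%:~R :> R by rewrite ltr0z denq_gt0.
pose a := denq q *: xform i - numq q *: oneform n.
have aE z : ev a z = (denq q)%:~R * (z 0 i - ratr q).
  rewrite evB !evZ ev_xform ev_oneform mulr1 mulrBr; congr (_ - _).
  have -> : ratr q = (numq q)%:~R / (denq q)%:~R :> R.
    by rewrite -{1}[q]divq_num_den fmorph_div /= !ratr_int.
  by rewrite mulrCA divff ?mulr1// intr_eq0 denq_neq0.
exists (lpos (aff R (- a))), (lpos (aff R a)); split.
- have -> : aff R a = - aff R (- a).
    by apply/mcn_eqP => z cz; rewrite extN !ext_aff// evN opprK.
  exact: lpos_meetN.
- by rewrite ext_pos ext_aff// evN aE lt_max oppr_gt0 pmulr_rlt0// subr_lt0 xq orbT.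
- by rewrite ext_pos ext_aff// aE lt_max pmulr_rgt0// subr_gt0 qy orbT.
Qed.

Lemma point_ideal_inj x y : K x -> K y -> point_ideal x = point_ideal y -> x = y.
Proof.
move=> Kx Ky e; apply: contrapT => xy.
have [f [g [fg fx gy]]] := separating (bigcap_cube Kx) (bigcap_cube Ky) xy.
have hfy : ext f y <= 0.
  have /mcn_eqP/(_ y (bigcap_cube Ky)) := fg; rewrite ext_meet ext0 => h.
  by rewrite leNgt; apply/negP => fy; move: h; rewrite /Num.min; case: ifP => _ h; move: fy gy; rewrite h ltxx.
have : point_ideal y (pi (lpos f)).
  by apply/(point_idealP _ Ky); rewrite ext_pos max_l.
rewrite -e => /(point_idealP _ Kx); rewrite ext_pos max_r ?ltW// => fx0.
by rewrite fx0 ltxx in fx.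
Qed.

Lemma local_iff : local_ulg G <-> exists z, K = [set z].
Proof.
split=> [[m [mm mu]]|[z Kz]].
  have [z Kz mz] := maximal_point mm; exists z; apply/seteqP; split=> x /=; last by move=> ->.
  by move=> Kx; apply: point_ideal_inj => //; rewrite -mz; apply: mu; exact: point_ideal_maximal.
have Kzz : K z by rewrite Kz.
exists (point_ideal z); split; first exact: point_ideal_maximal.
by move=> m /maximal_point[x]; rewrite Kz => ->.
Qed.

(** A nonnegative function with zeroset [Q] vanishes on [K], so all its multiples are germs below
    the unit, and an archimedean group makes its germ 0. Conversely, if all multiples of [f] are
    below [g], then [f] is nonpositive on [K], and the hypothesis is applied to the polyhedron where
    [f <= 0]. *)
Lemma archimedean_iff : archimedean_ulg G <->
  forall Q, rational_polyhedron Q -> K `<=` Q -> exists j, P j `<=` Q.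
Proof.
split=> [ar Q /polyhedron_zeroset[f [f0 fP]] KQ|h].
  have fK x : K x -> ext f x = 0 by move=> Kx; apply/fP; [exact: bigcap_cube|exact: KQ].
  have : (pi f <= 0 :> G).
    apply: (ar _ ounit) => k _.
    have [x /fK fx|j Pj] := @cut_open _ (@open_ext_gt (- (f *+ k)) (- 1)).
      by rewrite /mkset extN extMn fx mulr0 oppr0 oppr_lt0.
    rewrite -piMn -pi1; apply/pi_le; exists j => x /Pj; rewrite /mkset extN ltrN2.
    exact: ltW.
  move=> /pi_le[j fj]; exists j => x Px; apply/fP; first exact: P_cube Px.
  by apply/le_anti; rewrite -{1}(ext0 x) fj//= -(ext0 x) (mcn_leP _ _).1//; exact: P_cube Px.
move=> a b; elim/quotW: a => f; elim/quotW: b => g fg.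
have [x Kx|j Pj] := h _ (le0_polyhedron f); last by apply/pi_le; exists j => x /Pj[].
split; first exact: bigcap_cube.
rewrite leNgt; apply/negP => fx.
have gx0 : 0 <= ext g x.
  have := fg 1%N isT; rewrite mulr1n => /pi_le[j /(_ x (Kx j I))].
  by apply: le_trans; exact: ltW.
pose k := Num.bound (ext g x / ext f x).
have : ext g x < k%:R * ext f x by rewrite -ltr_pdivrMr// archi_boundP// divr_ge0// ltW.
have /pi_le[j /(_ x (Kx j I))] : (pi (f *+ k.+1) <= pi g :> G) by rewrite piMn fg.
rewrite extMn -natr1 mulrDl mul1r => h1 h2; lra.
Qed.

(** Two points of [K] would carry disjoint germs, each positive at one of them; in the totally
    ordered R one of the two images is 0, against injectivity. In the other direction the embedding
    is evaluation at [z]. *)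
Lemma subreal_iff : ulisomorphic_to_ulsubgroup G R <->
  exists z, K = [set z] /\
    forall Q, rational_polyhedron Q -> Q z -> exists j, P j `<=` Q.
Proof.
split=> [[S [h [_ [hD hU hI' h1] hinj _]]]|[z [Kz zQ]]].
  have h0 : h 0 = 0 by apply: (addrI (h 0)); rewrite -hD !addr0.
  have hN a : h (- a) = - h a by apply: (addrI (h a)); rewrite -hD !subrr.
  have hle a b : a <= b <-> h a <= h b.
    split=> [/ljoin_r e|ab]; first by rewrite -e hU -[leRHS]/(Num.max (h a) (h b)) le_max lexx.
    suff -> : b = ljoin a b by exact: lgUl.
    by apply: hinj; rewrite hU -[RHS]/(Num.max (h a) (h b)) max_r.
  have hMn a k : h (a *+ k) = h a *+ k.
    by elim: k => [//|k ih]; rewrite !mulrS hD ih.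
  have ar : archimedean_ulg G.
    move=> a b ab; apply/hle; rewrite h0 leNgt; apply/negP => a0.
    have b0 : 0 <= h b by have /hle := ab 1%N isT; rewrite mulr1n; apply: le_trans; exact: ltW.
    pose k := Num.bound (h b / h a).
    have : h b < k%:R * h a by rewrite -ltr_pdivrMr// archi_boundP// divr_ge0// ltW.
    have /hle := ab k.+1 isT; rewrite hMn mulrS -mulr_natl => h2 h3; lra.
  have [z Kz] := bigcap_neq0; exists z.
  have Kz1 : K = [set z].
    apply/seteqP; split=> x /=; last by move=> ->.
    move=> Kx; apply: contrapT => xz.
    have [f [g [fg fx gz]]] := separating (bigcap_cube Kx) (bigcap_cube Kz) xz.
    have : Num.min (h (pi f)) (h (pi g)) = 0.
      by rewrite -[LHS]/(lmeet (h (pi f)) (h (pi g))) -hI' -pi_meet fg -h0.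
    have nz u y : K y -> 0 < ext u y -> h (pi u) = 0 -> False.
      move=> Ky u0; rewrite -h0 => /hinj/pi_eq[j /(_ y (Ky j I))].
      by rewrite ext0 => e; rewrite e ltxx in u0.
    by rewrite /Num.min; case: ifP => _; [exact: (nz _ x)|exact: (nz _ z)].
  split=> // Q Qp Qz; apply: (archimedean_iff.1 ar) => //.
  by rewrite Kz1 => _ ->.
have Kzz : K z by rewrite Kz.
exists (range (evalz z)), (evalz z); have [hD hU hI' h1] := evalz_ulhom Kzz.
have h0 : evalz z 0 = 0 by apply: (addrI (evalz z 0)); rewrite -hD !addr0.
have hN a : evalz z (- a) = - evalz z a by apply: (addrI (evalz z a)); rewrite -hD !subrr.
split=> //.
  split=> [_ _ [a _ <-] [b _ <-]|_ _ [a _ <-] [b _ <-]|_ _ [a _ <-] [b _ <-]|].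
  - by exists (a - b) => //; rewrite hD hN.
  - by exists (ljoin a b) => //; rewrite hU.
  - by exists (lmeet a b) => //; rewrite hI'.
  - by exists ounit.
suff inj0 a : evalz z a = 0 -> a = 0.
  by move=> a b e; apply/eqP; rewrite -subr_eq0; apply/eqP/inj0; rewrite hD hN e subrr.
elim/quotW: a => f; rewrite evalz_pi// => fz.
have [|j Pj] := zQ _ (le0_polyhedron (labs f)).
  by split; [exact: bigcap_cube|rewrite ext_abs fz normr0].
apply/pi_eq; exists j => x /Pj[_]; rewrite ext_abs normr_le0 ext0.
by move=> /eqP.
Qed.

Lemma total_iff : totally_ordered_ulg G <->
  forall a : 'rV[int]_(n + 1), exists j,
    (forall x, P j x -> 0 <= ev a x) \/ (forall x, P j x -> ev a x <= 0).
Proof.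
split=> [tot a|h].
  have [/pi_le[j hj]|/pi_le[j hj]] := tot (pi 0) (pi (aff R a));
    exists j; [left|right] => x Px; have := hj x Px; rewrite ext_aff//; exact: P_cube Px.
suff H f : exists j, (forall x, P j x -> 0 <= ext f x) \/ (forall x, P j x -> ext f x <= 0).
  move=> a b; elim/quotW: a => f; elim/quotW: b => g; have [j [hj|hj]] := H (g - f); [left|right];
    by apply/pi_le; exists j => x /hj; rewrite extB ?subr_ge0 ?subr_le0.
(* With 0 among the pieces, the sign of each piece is one of the comparisons settled on [P j]. *)
have [s0 sP0] := ext_pieces f; pose s := 0 :: s0.
have sP x : cube R n x -> exists2 a, a \in s & ext f x = ev a x.
  by move=> /sP0[a as_ fx]; exists a; rewrite // in_cons as_ orbT.
have [|d _|j jP] := @ex_bound_seq _ [seq c - b | b <- s, c <- s]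
    (fun d j => (forall x, P j x -> 0 <= ev d x) \/ (forall x, P j x -> ev d x <= 0)).
- by move=> d j j' jj' [hj|hj]; [left|right] => x /(P_dec jj')/hj.
- exact: h.
have ord b c : b \in s -> c \in s ->
    (forall x, P j x -> ev b x <= ev c x) \/ (forall x, P j x -> ev c x <= ev b x).
  move=> bs cs; have [hd|hd] := jP (c - b) (allpairs_f _ bs cs); [left|right] => x /hd;
    by rewrite evB ?subr_ge0 ?subr_le0.
exists j; apply: contrapT => /not_orP[/existsNP[x /not_implyP[Px /negP]]].
rewrite -ltNge => fx /existsNP[y /not_implyP[Py /negP]]; rewrite -ltNge => fy.
have [cx cy] := (P_cube Px, P_cube Py).
(* The midpoint lies in the cube, though perhaps not in [P j]. Two pieces compared one way on [P j]
   and the other way at [z] agree at both [x] and [y]; hence the piece that [f] takes at [z] is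
   taken at both ends, where its sign would differ. *)
pose z := x + 2^-1 *: (y - x).
have cz : cube R n z by apply: cube_segment => //; lra.
have zE a : ev a z = 2^-1 * ev a x + 2^-1 * ev a y by rewrite ev_segment; field.
have zle b c : b \in s -> c \in s -> ev b z <= ev c z -> ev b x <= ev c x /\ ev b y <= ev c y.
  move=> bs cs; rewrite !zE => le.
  have [o|o] := ord b c bs cs; have := o x Px; have := o y Py; split; lra.
have [a as_ az] := sP z cz.
have fxa : ext f x = ev a x.
  by apply: (pwl_transfer sP cz cx _ as_ az) => b c bs cs /(zle _ _ bs cs)[].
have fya : ext f y = ev a y.
  by apply: (pwl_transfer sP cz cy _ as_ az) => b c bs cs /(zle _ _ bs cs)[].
have [o|o] := ord a 0 as_ (mem_head _ _); have := o x Px; have := o y Py; rewrite !ev0; lra.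
Qed.

(** Finitely many generators vanish on a common [P j], and so does the ideal they generate; it
    contains functions with zeroset [P i] for every [i]. Conversely a nonnegative function with
    zeroset [P N] generates the ideal, by [domination]. *)
Lemma fin_gen_iff : fin_gen_lideal germ_ideal <-> exists N, forall j, (N <= j)%N -> P j = P N.
Proof.
have Ij j : convex_lsubgroup [set f | forall x, P j x -> ext f x = 0].
  split=> [x _|f g hf hg x Px|f g hf hg x Px|f g g0 gf hf x Px]; rewrite ?ext0//.
  - by rewrite extB hf ?hg ?subrr.
  - by rewrite ext_join hf ?hg ?maxxx.
  - have cx := P_cube Px; apply/le_anti/andP; split; first by rewrite -(hf x Px) (mcn_leP _ _).1.
    by rewrite -(ext0 x) (mcn_leP _ _).1.
split=> [[_ [A [fA IA]]]|[N PN]].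
  have [j Aj] : exists j, forall f, A f -> forall x, P j x -> ext f x = 0.
    have AI f : A f -> exists j, forall x, P j x -> ext f x = 0.
      by move=> Af; apply/germ_idealE; rewrite IA => J [_]; apply.
    have /finite_seqP[s As] := fA.
    have [|f fs|j jP] := @ex_bound_seq _ s (fun f j => forall x, P j x -> ext f x = 0).
    - by move=> f j j' jj' h x /(P_dec jj')/h.
    - by apply: AI; rewrite As.
    by exists j => f; rewrite As => /jP.
  exists j => i ji; apply/seteqP; split=> [|x Px]; first exact: P_dec.
  have [f [f0 fP]] := polyhedron_zeroset (P_poly i).
  apply/fP; first exact: P_cube Px.
  have : germ_ideal f by apply/germ_idealE; exists i => y Py; apply/fP => //; exact: P_cube Py.
  rewrite IA => /(_ [set f | forall x, P j x -> ext f x = 0]); apply=> //.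
  by split=> //; exact: convex_lideal.
split; first exact: convex_lideal.
have [f [f0 fP]] := polyhedron_zeroset (P_poly N).
have fN x : P N x -> ext f x = 0 by move=> Px; apply/fP => //; exact: P_cube Px.
exists [set f]; split; first exact: finite_set1.
apply/seteqP; split=> [g /germ_idealE[j gj] J [/lideal_convex cJ fJ]|g].
  have [x cx fx|k gk] := @domination _ _ g f f0.
    apply: gj; have [jN|Nj] := leqP j N; last by rewrite PN ?(ltnW Nj)//; apply/fP.
    by apply: (P_dec jN); apply/fP.
  apply/(labs_convex cJ); have [J0 _ _ JC] := cJ; apply: JC gk _; first exact: labs_ge0.
  elim: (k) => [//|i ih]; rewrite mulrS; apply: convex_lsubgroupD => //; exact: fJ.
apply; split; first exact: convex_lideal.
by move=> _ ->; apply/germ_idealE; exists N.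
Qed.

End DecreasingPolyhedra.

(** * Denominators, grids and simplicial groups *)

Lemma bezout_seq (I : eqType) (F : I -> int) (r : seq I) : uniq r ->
  exists a : I -> int, forall i, i \in r -> (\sum_(j <- r) a j * F j %| F i)%Z.
Proof.
elim: r => [_|i r ih /= /andP[ir /ih[a aP]]]; first by exists (fun=> 0).
pose g := \sum_(j <- r) a j * F j.
have [u [v uv]] := Bezoutz (F i) g.
exists (fun j => if j == i then u else v * a j) => k.
rewrite big_cons eqxx; have -> : \sum_(j <- r) (if j == i then u else v * a j) * F j = v * g.
  rewrite mulr_sumr; apply: eq_big_seq => j jr.
  by case: eqP => [e|_]; [rewrite -e jr in ir|rewrite mulrA].
rewrite uv in_cons => /predU1P[->|kr]; first exact: dvdz_gcdl.
by apply: dvdz_trans (dvdz_gcdr _ _) _; exact: aP.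
Qed.

Section HomogPrimitive.
Variables (R : realType) (n : nat).

Lemma den_dvd (v : 'rV[rat]_n) (t : nat) :
  (forall i, exists k : int, t%:R * v 0 i = k%:~R) -> (den v %| t)%N.
Proof.
move=> h; rewrite /den; elim/big_ind: _ => //[x y hx hy|i _]; first by rewrite dvdn_lcm hx.
have [k kP] := h i.
have e : t%:Z * numq (v 0 i) = k * denq (v 0 i).
  apply: (@intr_inj rat); rewrite !rmorphM /= -kP.
  by rewrite -{2}[v 0 i]divq_num_den -!mulrA mulVf ?mulr1// intr_eq0 denq_neq0.
have : (denq (v 0%R i) %| t%:Z * numq (v 0%R i))%Z by rewrite e dvdz_mull.
by rewrite Gauss_dvdzl// /coprimez gcdzC; exact: coprime_num_den.
Qed.

(** The vector [homog v] is primitive, since a common divisor of its entries would yield a smaller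
    common denominator of [v]. The resulting form takes the value [1 / den v] at [v], so every
    multiple of it is the value of an integer form. *)
Lemma homog_bezout (v : 'rV[rat]_n) : exists a : 'rV[int]_(n + 1),
  (den v)%:R * ev a (pt R v) = 1.
Proof.
have [a aP] := bezout_seq (fun i => homog v 0 i) (index_enum_uniq _).
set g := \sum_(j <- _) _ in aP.
have gP i : (g %| homog v 0%R i)%Z by apply: aP; rewrite mem_index_enum.
have gd : (g %| (den v)%:Z)%Z by have := gP (rshift n 0); rewrite row_mxEr mxE.
have d0 := den_gt0 v.
have g0 : g != 0 by apply: contraTneq gd => ->; rewrite dvd0z eqz_nat -lt0n.
have gn1 : `|g|%N = 1%N.
  have /dvdnP[t tE] : (`|g| %| den v)%N by [].
  have gn0 : (0 < `|g|)%N by rewrite absz_gt0.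
  have : (den v %| t)%N.
    apply: den_dvd => i; have /dvdzP[k kE] := gP (lshift 1 i).
    exists (k * sgz g); have := den_coord v i.
    move: kE; rewrite row_mxEl mxE => ->; rewrite tE natrM rmorphM /= => e.
    have gE : g%:~R = (sgz g)%:~R * (`|g|%N)%:R :> rat by rewrite {1}[g]intEsg intrM.
    have gn0' : (`|g|%N)%:R != 0 :> rat by rewrite pnatr_eq0 -lt0n.
    apply: (mulfI gn0'); rewrite mulrA [_ * t%:R]mulrC -e gE intrM.
    by rewrite mulrA mulrC.
  rewrite tE => hd.
  have t0 : (0 < t)%N by move: d0; rewrite tE muln_gt0 => /andP[].
  have := dvdn_leq t0 hd; rewrite -{2}[t]muln1 leq_pmul2l// => h.
  by apply/eqP; rewrite eqn_leq h.
exists (\row_j (sgz g * a j)).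
rewrite /ev -dotZr -intv_homog dot_intv.
have -> : \sum_i (\row_j (sgz g * a j)) 0 i * homog v 0 i = sgz g * g.
  by rewrite mulr_sumr; apply: eq_bigr => i _; rewrite mxE mulrA.
by rewrite -abszEsg gn1.
Qed.

Lemma chull1 (v : 'rV[rat]_n) x : chull R [fset v]%fset x <-> x = pt R v.
Proof.
split=> [[l [_]]|->]; last by apply: chull_vertex; rewrite in_fset1.
by rewrite !big_seq_fset1 => -> ->; rewrite scale1r.
Qed.

Definition on_grid (N : nat) (x : 'rV[R]_n) : Prop :=
  forall i, exists k : int, N%:R * x 0 i = k%:~R.

Lemma grid_polyhedron (N : nat) : (0 < N)%N ->
  rational_polyhedron [set x | cube R n x /\ on_grid N x].
Proof.
move=> N0; have N0' : N%:R != 0 :> R by rewrite pnatr_eq0 -lt0n.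
pose p (phi : {ffun 'I_n -> 'I_N.+1}) : 'rV[rat]_n := \row_i ((phi i)%:R / N%:R).
have pE phi i : pt R (p phi) 0 i = (phi i)%:R / N%:R.
  by rewrite !mxE fmorph_div /= !ratr_nat.
exists [seq [fset p phi]%fset | phi : {ffun 'I_n -> 'I_N.+1}].
apply/seteqP; split=> x /=.
  move=> [cx gx]; have /choice[k kP] : forall i, exists k : 'I_N.+1, N%:R * x 0 i = k%:R.
    move=> i; have [k kP] := gx i; have /andP[x0 x1] := cx i.
    have k0 : 0 <= k by rewrite -(ler0z R) -kP mulr_ge0.
    have kN : (`|k| < N.+1)%N.
      rewrite ltnS -(ler_nat R) -[leLHS]/((`|k|%N%:Z)%:~R) gez0_abs// -kP.
      by rewrite ler_piMr.
    exists (Ordinal kN); rewrite kP /=.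
    by rewrite -[RHS]/((`|k|%N%:Z)%:~R) gez0_abs.
  exists [fset p (finfun k)]%fset; first by apply/mapP; exists (finfun k); rewrite ?mem_enum.
  by apply/chull1/rowP => i; rewrite pE ffunE -kP mulrC mulKf.
move=> [_ /mapP[phi _ ->] /chull1 ->]; split=> i; rewrite pE.
  apply/andP; split; first by rewrite divr_ge0.
  by rewrite ler_pdivrMr ?ltr0n// mul1r ler_nat -ltnS.
by exists (phi i); rewrite mulrCA divff// mulr1.
Qed.
End HomogPrimitive.

Section Simplicial.
Variables (R : realType) (n : nat) (P : nat -> set 'rV[R]_n).
Hypothesis P_poly : forall j, rational_polyhedron (P j).
Hypothesis P_cube : forall j, P j `<=` cube R n.
Hypothesis P_dec : forall i j, (i <= j)%N -> P j `<=` P i.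
Variable hI : convex_lsubgroup (germ_ideal P).
Let G : ulGroupType := lquot hI.
Let K : set 'rV[R]_n := \bigcap_j P j.
Local Open Scope quotient_scope.
Local Notation pi f := (\pi_(lquot hI) f).

Lemma zfrac_valMn m (x : zfrac m) k : \val (x *+ k) = k%:R * \val x.
Proof. by rewrite raddfMn /= mulr_natl. Qed.

Lemma zfrac_valMz m (x : zfrac m) k : \val (x *~ k) = \val x *~ k.
Proof. exact: raddfMz. Qed.

Lemma ulprod_Mn (I : finType) (H : I -> ulGroupType) (x : ulprod H) k i :
  (x *+ k) i = x i *+ k.
Proof. by elim: k => [//|k ih]; rewrite !mulrS -ih. Qed.

Lemma ulprod_zfrac_archimedean k (m : 'I_k -> nat) :
  archimedean_ulg (ulprod (fun i => zfrac (m i))).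
Proof.
move=> x y xy; apply/forallP => i; rewrite -[_ <= _]/(\val (x i) <= 0) leNgt.
apply/negP => x0.
have le j : (0 < j)%N -> j%:R * \val (x i) <= \val (y i).
  by move=> /xy/forallP/(_ i); rewrite ulprod_Mn -zfrac_valMn.
have y0 : 0 <= \val (y i) by have := le 1%N isT; rewrite mul1r; apply: le_trans; exact: ltW.
pose N := Num.bound (\val (y i) / \val (x i)).
have : \val (y i) < N%:R * \val (x i).
  by rewrite -ltr_pdivrMr// archi_boundP// divr_ge0// ltW.
have := le N.+1 isT; rewrite -natr1 mulrDl mul1r => h1 h2; lra.
Qed.

Lemma iso_archimedean (H H' : ulGroupType) : ulisomorphic H H' ->
  archimedean_ulg H' -> archimedean_ulg H.
Proof.
move=> [h [[hD hU hI' h1] [g hK gK]]] ar a b ab.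
have h0 : h 0 = 0 by apply: (addrI (h 0)); rewrite -hD !addr0.
have hMn c k : h (c *+ k) = h c *+ k.
  by elim: k => [//|k ih]; rewrite !mulrS hD ih.
have hle c d : c <= d -> h c <= h d by move=> /ljoin_r <-; rewrite hU lgUl.
have : h a <= 0 by apply: (ar _ (h b)) => k /ab/hle; rewrite hMn.
move=> /ljoin_r; rewrite -h0 -hU => /(can_inj hK) <-; exact: lgUl.
Qed.

(* The meet of the i-th unit vector e i with 1 - e i is 0, so point evaluations
   take e i to 0 or 1; hence the values of N times an element are integers, and
   archimedeanity confines some P j to the grid (1/N)Z^n. *)
Lemma simplicial_grid : simplicial_ulg G ->
  exists2 N, (0 < N)%N & exists j, forall x, P j x -> on_grid N x.
Proof.
(* A common denominator of the factors, as [zfrac m] is Z(1/(m + 1)). *)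
move=> [k [m iso]]; pose N := (\prod_i (m i).+1)%N.
have N0 : (0 < N)%N by exact: prodn_gt0.
exists N => //.
have ar := iso_archimedean iso (@ulprod_zfrac_archimedean _ _).
have [|j jP] := (archimedean_iff P_poly P_cube P_dec hI).1 ar _ (grid_polyhedron R n N0);
  last by exists j => x /jP[].
move=> z Kz; split; first exact: bigcap_cube P_cube _ Kz.
have [h [[hD hU hI' h1] [g hK gK]]] := iso.
have [eD eU eI e1] := evalz_ulhom P_cube P_dec hI Kz.
pose psi y := evalz z (g y).
have gD x y : g (x + y) = g x + g y by apply: (can_inj hK); rewrite hD !gK.
have psiD : {morph psi : x y / x + y} by move=> x y; rewrite /psi gD eD.
have psi1 : psi ounit = 1 by rewrite /psi -h1 hK e1.
have psiI x y : psi (lmeet x y) = Num.min (psi x) (psi y).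
  rewrite /psi -[RHS]/(lmeet (evalz z (g x)) (evalz z (g y))) -eI; congr evalz.
  by apply: (can_inj hK); rewrite hI' !gK.
have psi0 : psi 0 = 0 by apply: (addrI (psi 0)); rewrite -psiD !addr0.
have psiN x : psi (- x) = - psi x by apply: (addrI (psi x)); rewrite -psiD !subrr.
have psiMn x i : psi (x *+ i) = psi x *+ i.
  by elim: i => [//|i ih]; rewrite !mulrS psiD ih.
pose e i : ulprod (fun i => zfrac (m i)) := fun j => if j == i then ounit else 0.
have psie i : psi (e i) = 0 \/ psi (e i) = 1.
  have : lmeet (e i) (ounit - e i) = 0.
    apply: functional_extensionality_dep => j.
    rewrite -[LHS]/(lmeet (e i j) (ounit - e i j)) -[RHS]/(0 : zfrac (m j)) /e.
    case: eqP => _; first by rewrite subrr lmeetC lmeet_l// ounit_ge0.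
    by rewrite subr0 lmeet_l// ounit_ge0.
  move=> /(congr1 psi); rewrite psiI psiD psiN psi1 psi0 /Num.min.
  by case: ifP => _ h'; [left|right; apply/esym/eqP; rewrite -subr_eq0 h'].
have psi_int x : exists l : int, N%:R * psi x = l%:~R.
  have /fin_all_exists[l lP] : forall i, exists l : int, N%:R * \val (x i) = l%:~R.
    move=> i; have /asboolP[l lP] := zfracP (x i).
    exists (l * (\prod_(j | j != i) (m j).+1)%N); rewrite /N (bigD1 i)//= natrM [X in _ * X]lP.
    by rewrite rmorphM /= mulrCA mulrAC mulrA mulrAC divff ?mul1r ?mulr1 ?pnatr_eq0// mulrC.
  have xE : x *+ N = \sum_i (e i *~ l i).
    apply: functional_extensionality_dep => j; apply: val_inj.
    rewrite ulprod_Mn zfrac_valMn lP.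
    have -> : (\sum_i e i *~ l i : ulprod _) j = \sum_i (e i *~ l i : ulprod _) j.
      by elim/big_rec2: _ => // i y1 y2 _ <-.
    have eMz i : (e i *~ l i : ulprod _) j = e i j *~ l i.
      case: (l i) => q; first by rewrite -!pmulrn ulprod_Mn.
      by rewrite NegzE !mulrNz -!pmulrn -[LHS]/(- ((e i *+ q.+1) j)) ulprod_Mn.
    rewrite (bigD1 j)//= big1 ?addr0 => [|i ij]; rewrite eMz /e; last first.
      by rewrite eq_sym (negbTE ij) mul0rz.
    by rewrite eqxx [RHS]zfrac_valMz.
  have -> : N%:R * psi x = psi (x *+ N) by rewrite psiMn mulr_natl.
  rewrite xE; elim/big_ind: _ => [|u w [a aP] [b bP]|i _].
  - by exists 0; rewrite psi0.
  - by exists (a + b); rewrite psiD aP bP rmorphD.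
  - have -> : psi (e i *~ l i) = psi (e i) *~ l i.
      by case: (l i) => q; rewrite ?NegzE ?mulrNz ?psiN -?pmulrn psiMn.
    by case: (psie i) => ->; [exists 0; rewrite mul0rz|exists (l i)].
move=> i; have [l lP] := psi_int (h (pi (aff R (xform i)))).
exists l; rewrite -lP /psi hK (evalz_pi P_cube P_dec hI _ Kz) ext_aff ?ev_xform//.
exact: bigcap_cube P_cube _ Kz.
Qed.

(** A germ is determined by its values at the points of [s], and the value at [v] is a multiple of
    [1 / den v]. All systems of such values occur: [homog_bezout] prescribes the value at one point,
    and cutting both parts of that form off by a large multiple of a function vanishing exactly at
    the other points makes them 0 there. *)
Lemma simplicial_finite N (s : seq 'rV[rat]_n) :
  (forall j, (N <= j)%N -> P j = P N) ->
  (forall x, P N x <-> exists2 v, v \in s & x = pt R v) -> simplicial_ulg G.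
Proof.
move=> PN Ps0.
have {Ps0} : forall x, P N x <-> exists2 v, v \in undup s & x = pt R v.
  by move=> x; rewrite Ps0; split=> -[v vs ->]; exists v; rewrite ?mem_undup// -mem_undup.
have := undup_uniq s; move: (undup s) => {}s us Ps.
pose k := size s; pose v (i : 'I_k) := tnth (in_tuple s) i.
have vs i : v i \in s by exact: mem_tnth.
have vinj : injective v by apply/tuple_uniqP.
have Pv j i : P j (pt R (v i)).
  have : P N (pt R (v i)) by apply/Ps; exists (v i).
  by have [jN|Nj] := leqP j N; [exact: P_dec|rewrite (PN j (ltnW Nj))].
have Kv i : K (pt R (v i)) by move=> j _; exact: Pv.
have cv i : cube R n (pt R (v i)) by exact: (P_cube (Pv 0%N i)).
(* The predecessor compensates for the shift by 1 in [zfrac]. *)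
pose m (i : 'I_k) := (den (v i)).-1.
have mS i : (m i).+1 = den (v i) by rewrite prednK// den_gt0.
have /choice[h hP] : forall a : G, exists y : ulprod (fun i => zfrac (m i)),
    forall i, ratr (\val (y i)) = evalz (pt R (v i)) a.
  elim/quotW => f; apply: (fin_all_exists (P := fun i (y : zfrac (m i)) => ratr (\val y) = _)) => i.
  rewrite evalz_pi//; have [s' s'P] := ext_pieces f; have [a _ ->] := s'P _ (cv i).
  pose z := \sum_j a 0 j * homog (v i) 0 j.
  have zP : (z%:~R / (m i).+1%:R : rat) \in zfrac_pred (m i) by apply/asboolP; exists z.
  exists (ZFrac zP); rewrite fmorph_div /= ratr_int ratr_nat -dot_intv intv_homog dotZr -/(ev _ _).
  by rewrite mS mulrC mulKf// pnatr_eq0 -lt0n den_gt0.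
have hinj (y y' : ulprod (fun i => zfrac (m i))) :
    (forall i, ratr (\val (y i)) = ratr (\val (y' i)) :> R) -> y = y'.
  move=> e; apply: functional_extensionality_dep => i; apply: val_inj.
  exact: fmorph_inj (e i).
have rmax (p q : rat) : ratr (Num.max p q) = Num.max (ratr p) (ratr q) :> R.
  by have [pq|/ltW pq] := leP p q; [rewrite max_r ?ler_rat|rewrite max_l ?ler_rat].
have rmin (p q : rat) : ratr (Num.min p q) = Num.min (ratr p) (ratr q) :> R.
  by have [pq|/ltW pq] := leP p q; [rewrite min_l ?ler_rat|rewrite min_r ?ler_rat].
exists k, m, h; split.
  split=> [a b|a b|a b|]; apply: hinj => i; rewrite hP;
    have [eD eU eI e1] := evalz_ulhom P_cube P_dec hI (Kv i).
  - by rewrite eD -!hP -rmorphD.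
  - by rewrite eU -[LHS]/(Num.max _ _) -!hP -rmax.
  - by rewrite eI -[LHS]/(Num.min _ _) -!hP -rmin.
  - by rewrite e1 -[\val _]/(1 : rat) rmorph1.
have inj : injective h.
  move=> a b; elim/quotW: a => f; elim/quotW: b => g e; apply/pi_eq => //; exists N => x /Ps[w ws ->].
  have [i iE] : exists i, w = v i by apply/tnthP.
  by have := hP (pi g) i; rewrite -e hP !evalz_pi// iE.
suff surj y : exists a, h a = y.
  by have /choice[g gK] := surj; exists g => [a|//]; apply: inj; rewrite gK.
suff loc i : exists f, ext f (pt R (v i)) = ratr (\val (y i)) /\
    forall j, j != i -> ext f (pt R (v j)) = 0.
  have /choice[f fP] := loc; exists (pi (\sum_i f i)); apply: hinj => i.
  have extS (J : seq 'I_k) x : ext (\sum_(j <- J) f j) x = \sum_(j <- J) ext (f j) x.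
    by elim/big_rec2: _ => // j y1 y2 _ <-.
  rewrite hP evalz_pi// extS (bigD1 i)//= big1 ?addr0; first by have [] := fP i.
  by move=> j ji; have [_ ->] := fP j => //; rewrite eq_sym.
have [a aP] := homog_bezout R (v i).
have /asboolP[z zP] := zfracP (y i).
pose p := aff R (z *: a).
have pv : ext p (pt R (v i)) = ratr (\val (y i)).
  rewrite ext_aff// evZ [X in ratr X]zP fmorph_div /= ratr_int ratr_nat mS; congr (_ * _).
  by apply/esym/mulr1_eq.
have [b [b0 bP]] : exists b, 0 <= b /\ forall x, cube R n x ->
    ext b x = 0 <-> (\bigcup_(S in [set` [seq [fset w]%fset | w <- s & w != v i]]) chull R S) x.
  by apply: polyhedron_zeroset; eexists.
have bi : 0 < ext b (pt R (v i)).
  rewrite lt_def -{2}(ext0 (pt R (v i))) (mcn_leP _ _).1// andbT; apply/eqP.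
  move=> /(bP _ (cv i))[S /= /mapP[w]]; rewrite mem_filter => /andP[wv _] -> /chull1 e.
  case/eqP: wv; apply/rowP => l; apply: (@fmorph_inj _ R ratr).
  by have := congr1 (fun u : 'rV[R]_n => u 0 l) e; rewrite !mxE.
have bj j : j != i -> ext b (pt R (v j)) = 0.
  move=> ji; apply/bP => //; exists [fset v j]%fset; last exact/chull1.
  by apply/mapP; exists (v j); rewrite // mem_filter vs (inj_eq vinj) ji.
pose c := Num.bound (`|ext p (pt R (v i))| / ext b (pt R (v i))).
have cP : `|ext p (pt R (v i))| <= c%:R * ext b (pt R (v i)).
  by rewrite -ler_pdivrMr//; apply/ltW/archi_boundP; rewrite divr_ge0// ltW.
exists (lmeet (lpos p) (b *+ c) - lmeet (lpos (- p)) (b *+ c)); split; last first.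
  move=> j ji; rewrite extB !ext_meet extMn bj// mulr0 !ext_pos.
  by rewrite !min_r ?subr0 // le_max lexx.
rewrite -pv extB !ext_meet extMn !ext_pos extN.
set q := ext p _ in cP *; set r := _ * _ in cP *.
have h1 : q <= r by apply: le_trans cP; exact: ler_norm.
have h2 : - q <= r by apply: le_trans cP; rewrite ler_normr lexx orbT.
have r0 : 0 <= r by apply: le_trans cP.
rewrite !min_l ?ge_max ?r0//.
have [q0|q0] := leP 0 q; first by rewrite max_l ?subr0// oppr_le0.
by rewrite max_r ?opprK ?add0r// oppr_ge0 ltW.
Qed.

End Simplicial.

(** * Covering dimension of the maximal spectrum *)

Section Sperner.
Variables (N : nat) (c : nat -> nat -> 'I_3).
Let c0 : 'I_3 := inord 0.
Let c1 : 'I_3 := inord 1.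
Let c2 : 'I_3 := inord 2.
Hypothesis N0 : (0 < N)%N.
Hypothesis left_col : forall j, (j <= N)%N -> c 0 j != c2.
Hypothesis right_col : forall j, (j <= N)%N -> c (N - j) j != c1.
Hypothesis bottom0 : c 0 0 = c1.
Hypothesis bottom : forall i, (0 < i <= N)%N -> c i 0 = c2.

Let door (x y : 'I_3) : bool := (x == c1) && (y == c2) || (x == c2) && (y == c1).
Let rainbow (x y z : 'I_3) : bool := [&& x != y, y != z & z != x].

Let ord3 (x : 'I_3) : [\/ x = c0, x = c1 | x = c2].
Proof.
case: x => [[|[|[|//]]] ?]; [apply: Or31|apply: Or32|apply: Or33];
  by apply: val_inj; rewrite /= inordK.
Qed.
Let ne01 : (c0 == c1) = false. Proof. by apply/eqP => /(congr1 val); rewrite /= !inordK. Qed.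
Let ne02 : (c0 == c2) = false. Proof. by apply/eqP => /(congr1 val); rewrite /= !inordK. Qed.
Let ne12 : (c1 == c2) = false. Proof. by apply/eqP => /(congr1 val); rewrite /= !inordK. Qed.
Let ne := (ne01, ne02, ne12, eq_sym c1 c0, eq_sym c2 c0, eq_sym c2 c1, eqxx).

Let door_triangle x y z : ~~ rainbow x y z -> door x y (+) door y z = door x z.
Proof.
by rewrite /rainbow /door; case: (ord3 x) => ->; case: (ord3 y) => ->;
  case: (ord3 z) => ->; rewrite ?ne.
Qed.
Let rainbow_all x y z a : rainbow x y z -> [\/ x = a, y = a | z = a].
Proof.
rewrite /rainbow; case: (ord3 x) => ->; case: (ord3 y) => ->; case: (ord3 z) => ->;
  rewrite ?ne//= => _; case: (ord3 a) => ->;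
  first [by apply: Or31|by apply: Or32|by apply: Or33].
Qed.

(* The parity of the number of 1-2 edges on a row is the same for all rows. *)
Lemma sperner : exists i j, forall a, exists i' j',
  [/\ (i <= i' <= i.+1)%N, (j <= j' <= j.+1)%N, (i' + j' <= N)%N & c i' j' = a].
Proof.
apply: contrapT => none.
have up i j : (i + j < N)%N -> ~~ rainbow (c i j) (c i.+1 j) (c i j.+1).
  move=> ij; apply/negP => rb; apply: none; exists i, j => a.
  case: (rainbow_all a rb) => <-; [exists i, j|exists i.+1, j|exists i, j.+1];
    split=> //; lia.
have down i j : (i + j.+1 < N)%N -> ~~ rainbow (c i.+1 j) (c i j.+1) (c i.+1 j.+1).
  move=> ij; apply/negP => rb; apply: none; exists i, j => a.
  case: (rainbow_all a rb) => <-; [exists i.+1, j|exists i, j.+1|exists i.+1, j.+1];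
    split=> //; lia.
pose B j m := \big[addb/false]_(i < m) door (c i j) (c i.+1 j).
(* A triangle that is not rainbow has an even number of doors. Summing over the strip between rows
   [j] and [j.+1], inner edges cancel and only the two rows and the two slanted end edges remain. *)
have strip j m : (m.+1 + j <= N)%N ->
    B j m.+1 = B j.+1 m (+) door (c 0 j) (c 0 j.+1) (+) door (c m.+1 j) (c m j.+1).
  elim: m => [|m ih] mj.
    rewrite /B big_ord1 big_ord0 addFb -(door_triangle (up 0%N j _)); last by lia.
    by rewrite -addbA addbb addbF.
  rewrite {1}/B big_ord_recr -/(B _ _) /= ih; last by lia.
  rewrite [B j.+1 m.+1]/B big_ord_recr -/(B _ _) /=.
  have mj' : (m + j.+1 < N)%N by rewrite addnS.
  have h1 := door_triangle (up m.+1 j mj).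
  have h2 := door_triangle (down m j mj').
  rewrite [door (c m.+2 j) (c m.+1 j.+1)](_ : _ = door (c m.+1 j) (c m.+2 j) (+) door (c m.+1 j) (c m.+1 j.+1)).
    rewrite -h2.
    by case: (B _ _); case: (door _ _); case: (door _ _); case: (door _ _); case: (door _ _).
  rewrite -h1.
  by rewrite addbA addbb.
have nol j : (j < N)%N -> door (c 0 j) (c 0 j.+1) = false.
  move=> jN; rewrite /door (negbTE (left_col jN)) andbF /=.
  by rewrite (negbTE (left_col (ltnW jN))).
have nor j : (j < N)%N -> door (c (N - j) j) (c (N - j).-1 j.+1) = false.
  move=> jN; have -> : (N - j).-1 = (N - j.+1)%N by lia.
  by rewrite /door (negbTE (right_col (ltnW jN))) (negbTE (right_col jN)) andbF.
have const j : (j <= N)%N -> B 0%N N = B j (N - j)%N.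
  elim: j => [|j ih] jN; first by rewrite subn0.
  rewrite ih ?(ltnW jN)//.
  have E : (N - j)%N = (N - j.+1).+1 by lia.
  rewrite {1}E strip; last by lia.
  by rewrite nol// -E (_ : (N - j.+1)%N = (N - j).-1) ?nor// ?addbF//; lia.
(* The top row is a single point and has no door, whereas the bottom row has exactly one, at its
   first edge. *)
have := const N (leqnn N); rewrite subnn {2}/B big_ord0.
rewrite /B; case: N N0 bottom => // M _ bot; rewrite big_ord_recl /= bottom0 bot//.
rewrite big1 ?addbF => [|i _]; first by rewrite /door !eqxx.
rewrite /= -[bump 0 i]/i.+1 (bot i.+1) ?(bot i.+2) ?ltnS ?(ltnW (ltn_ord i))//.
  by rewrite /door eqxx !ne.
by have := ltn_ord i.
Qed.
End Sperner.

Section Segments.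
Variables (R : realType) (n : nat).
Implicit Types (p q u : 'rV[rat]_n) (x y z : 'rV[R]_n).

Lemma pt_inj : injective (@pt R n).
Proof.
move=> p q e; apply/rowP => i; apply: (@fmorph_inj _ R ratr).
by have := congr1 (fun u : 'rV[R]_n => u 0 i) e; rewrite !mxE.
Qed.

Lemma pt_comb p q (k : rat) : pt R (p + k *: (q - p)) = pt R p + ratr k *: (pt R q - pt R p).
Proof. by apply/rowP => i; rewrite !mxE rmorphD rmorphM rmorphB. Qed.

Lemma chull2 p q x : chull R [fset p; q]%fset x <->
  exists2 t : R, 0 <= t <= 1 & x = pt R p + t *: (pt R q - pt R p).
Proof.
have [<-|pq] := eqVneq p q.
  rewrite fsetUid chull1; split=> [->|[t _ ->]]; last by rewrite subrr scaler0 addr0.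
  by exists 0; rewrite ?lexx ?ler01// scale0r addr0.
have U (V : nmodType) (F : 'rV[rat]_n -> V) : \sum_(v <- [fset p; q]%fset) F v = F p + F q.
  by rewrite big_fsetU1 ?big_seq_fset1// in_fset1.
split=> [[l [l0]]|[t /andP[t0 t1] ->]].
  rewrite !U => l1 ->; exists (l q).
    by rewrite l0 ?in_fset2 ?eqxx ?orbT// -l1 lerDr l0// in_fset2 eqxx.
  rewrite scalerBr addrCA addrC; congr (_ + _).
  by rewrite -{1}[pt R p]scale1r -scalerBl -l1 addrK.
exists (fun v => if v == p then 1 - t else t); split.
- by move=> v _; case: ifP; rewrite ?subr_ge0.
- by rewrite U eqxx eq_sym (negbTE pq) subrK.
- rewrite U eqxx eq_sym (negbTE pq) scalerBl scale1r scalerBr -addrA; congr (_ + _).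
  by rewrite addrC.
Qed.

Lemma segment_inj (a b : 'rV[R]_n) (s t : R) : a != b ->
  a + s *: (b - a) = a + t *: (b - a) -> s = t.
Proof.
move=> ab /addrI/eqP; rewrite -subr_eq0 -scalerBl scaler_eq0 !subr_eq0 [b == a]eq_sym (negbTE ab) orbF.
by move=> /eqP.
Qed.

Lemma near_grid (O : set 'rV[R]_n) z : open O -> O z ->
  exists2 e : R, 0 < e & forall y, (forall i, `|z 0 i - y 0 i| < e) -> O y.
Proof.
move=> oO Oz; have /nbhs_ballP[e /= e0 eO] : nbhs z O by exact: open_nbhs_nbhs.
by exists e => // y h; apply: eO; split=> // i j; rewrite ord1; exact: h.
Qed.

(** If the box of radius [e] at [z] lies in [O i], then boxes of radius below [e / 2] at points
    within [e / 2] of [z] do as well. The number has the form [1 / N] so that it can serve as the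
    mesh of a subdivision. *)
Lemma lebesgue_grid (l : nat) (O : 'I_l -> set 'rV[R]_n) (K : set 'rV[R]_n) :
  compact K -> (forall i, open (O i)) -> (forall z, K z -> exists i, O i z) ->
  exists2 N, (0 < N)%N & forall z, K z -> exists i, forall y,
    (forall c, `|z 0 c - y 0 c| <= N%:R^-1) -> O i y.
Proof.
move=> /compact_near_coveringP cK oO KO.
have := cK nat \oo (fun N z => (0 < N)%N -> exists i, forall y,
    (forall c, `|z 0 c - y 0 c| <= N%:R^-1) -> O i y).
move=> /(_ _)[z Kz|N _ h]; last first.
  by exists N.+1 => // z Kz; apply: (h N.+1) => //=.
have [i Oi] := KO z Kz; have [e e0 eO] := near_grid (oO i) Oi.
exists (ball z (e / 2), [set N | (Num.bound (e / 2)^-1 <= N)%N]) => /=.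
  by split; [apply: nbhsx_ballx; rewrite divr_gt0|exact: nbhs_infty_ge].
move=> -[x N] [/= [_ zx] eN] N0; exists i => y xy; apply: eO => c.
have Ne : N%:R^-1 < e / 2.
  rewrite invf_plt ?posrE ?ltr0n// ?divr_gt0//.
  apply: lt_le_trans (archi_boundP _) _; first by rewrite invr_ge0 ltW// divr_gt0.
  by rewrite ler_nat.
have : `|z 0 c - x 0 c| < e / 2 := zx 0 c.
have := xy c; rewrite -[z 0 c - y 0 c](subrKA (x 0 c)) => h1 h2.
by apply: le_lt_trans (ler_normD _ _) _; lra.
Qed.

Lemma cube_dist x y i : cube R n x -> cube R n y -> `|x 0 i - y 0 i| <= 1.
Proof.
move=> /(_ i)/andP[? ?] /(_ i)/andP[? ?].
by rewrite ler_norml; apply/andP; split; lra.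
Qed.

Lemma segment_dist (a b t : R) : 0 <= t -> t <= 1 ->
  `|a - (a + t * (b - a))| <= `|a - b| /\ `|b - (a + t * (b - a))| <= `|a - b|.
Proof.
move=> t0 t1; rewrite (_ : a - _ = t * (a - b)); last by ring.
rewrite (_ : b - _ = (1 - t) * (b - a)); last by ring.
rewrite !normrM (ger0_norm t0) (@ger0_norm _ (1 - t)) ?subr_ge0// (distrC b a).
by split; rewrite ler_piMl//; lra.
Qed.

End Segments.

Section Dimension.
Variables (R : realType) (n : nat) (P : nat -> set 'rV[R]_n).
Hypothesis P_poly : forall j, rational_polyhedron (P j).
Hypothesis P_cube : forall j, P j `<=` cube R n.
Hypothesis P_dec : forall i j, (i <= j)%N -> P j `<=` P i.
Variable hI : convex_lsubgroup (germ_ideal P).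
Let G : ulGroupType := lquot hI.
Let K : set 'rV[R]_n := \bigcap_j P j.
Local Open Scope quotient_scope.
Local Notation pi f := (\pi_(lquot hI) f).
Local Notation pid := (@point_ideal R n P hI).

Lemma maxspec_point (m : maxspec G) : exists2 z, K z & mxs m = pid z.
Proof. exact: maximal_point (mxsP m). Qed.

Lemma point_maxspec z : K z -> exists m : maxspec G, mxs m = pid z.
Proof. by move=> Kz; exists (MaxSpec (point_ideal_maximal P_cube P_dec hI Kz)). Qed.

(** The spectrum is compared with [K] through pairs of an [m] and a [z] such that [m] is the ideal
    of [z]. A basic open set is where some germ does not vanish, and its representative is
    continuous. *)
Lemma hk_open_trace (U : set (maxspec G)) : open U ->
  exists2 O : set 'rV[R]_n, open O &
    forall (m : maxspec G) z, K z -> mxs m = pid z -> (U m <-> O z).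
Proof.
move=> [A ->]; exists (\bigcup_(a in A) [set z | ext (repr a) z != 0]).
  apply: bigcup_open => a _; apply: (@open_comp _ _ (ext (repr a)) [set y | y != 0]).
    by move=> x _; exact: ext_continuous.
  exact: open_neq.
move=> m z Kz mz; rewrite /hk_hull /= mz; split.
  move=> /existsNP[a /not_implyP[Aa az]]; exists a => //=; apply/negP => /eqP; exact: az.
by move=> [a Aa /= /eqP az] h; apply: az; exact: h.
Qed.

(** A polyhedron is the zeroset of one function, so its complement is that of the hull of one germ.
    The covers built below are made of such sets. *)
Lemma polyhedron_hk_open (Q : set 'rV[R]_n) : rational_polyhedron Q ->
  exists2 U : set (maxspec G), open U &
    forall (m : maxspec G) z, K z -> mxs m = pid z -> (U m <-> ~ Q z).
Proof.
move=> /polyhedron_zeroset[f [f0 fP]].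
exists (~` @hk_hull G [set pi f]); first by exists [set pi f].
move=> m z Kz mz; have cz := bigcap_cube P_cube Kz.
rewrite -(fP z cz) -(point_idealP P_cube P_dec hI f Kz) -mz /hk_hull /=.
split=> h; apply: contra_not h; first by move=> ? _ ->.
by apply.
Qed.

(* The open stars of the vertices of a fine subdivision of the segments. *)
Lemma covering_dim_le1 (E : seq ('rV[rat]_n * 'rV[rat]_n)) :
  (forall x, K x <-> exists2 e, e \in E & chull R [fset e.1; e.2]%fset x) ->
  (forall e e' x, e \in E -> e' \in E -> e != e' ->
    chull R [fset e.1; e.2]%fset x -> chull R [fset e'.1; e'.2]%fset x ->
    x = pt R e.1 \/ x = pt R e.2) ->
  covering_dim_le (maxspec G) 1.
Proof.
move=> KE Ei k U oU cU.
have /choice[O /all_and2[oO OP]] : forall i, exists O : set 'rV[R]_n, open O /\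
    forall (m : maxspec G) z, K z -> mxs m = pid z -> (U i m <-> O z).
  by move=> i; have [O ? ?] := hk_open_trace (oU i); exists O.
have KO z : K z -> exists i, O i z.
  move=> Kz; have [m mz] := point_maxspec Kz.
  have : (\bigcup_i U i) m by rewrite cU.
  by move=> [i _ /(OP i m z Kz mz)]; exists i.
(* The segments lie in the unit cube, so cutting each into [N] equal pieces gives pieces of
   coordinate width at most [1 / N]. *)
have [N N0 NP] := lebesgue_grid (bigcap_compact P_poly P_cube) oO KO.
have N0' : N%:R != 0 :> R by rewrite pnatr_eq0 -lt0n.
have N0q : 0 < N%:R :> rat by rewrite ltr0n.
pose g (e : 'rV[rat]_n * 'rV[rat]_n) (j : nat) : 'rV[rat]_n := e.1 + (j%:R / N%:R) *: (e.2 - e.1).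
have gE e j : pt R (g e j) = pt R e.1 + (j%:R / N%:R) *: (pt R e.2 - pt R e.1).
  by rewrite pt_comb fmorph_div /= !ratr_nat.
pose piece e j := chull R [fset g e j; g e j.+1]%fset.
have pieceE e j x : piece e j x <-> exists2 t : R, 0 <= t <= 1 &
    x = pt R e.1 + ((j%:R + t) / N%:R) *: (pt R e.2 - pt R e.1).
  have step (t : R) : pt R (g e j) + t *: (pt R (g e j.+1) - pt R (g e j)) =
      pt R e.1 + ((j%:R + t) / N%:R) *: (pt R e.2 - pt R e.1).
    rewrite !gE opprD addrACA subrr add0r -scalerBl scalerA -addrA -scalerDl.
    by congr (_ + _ *: _); rewrite -natr1; field.
  by rewrite /piece chull2; split=> -[t t01 ->]; exists t; rewrite ?step.
have g0 e : g e 0%N = e.1 by rewrite /g mul0r scale0r addr0.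
have gN e : g e N = e.2 by rewrite /g divff ?scale1r ?gt_eqF// addrC subrK.
pose X := undup [seq g e j | e <- E, j <- iota 0 N.+1].
have gX e j : e \in E -> (j <= N)%N -> g e j \in X.
  by move=> eE jN; rewrite mem_undup allpairs_f// mem_iota.
have piece_seg e j x : (j < N)%N -> piece e j x -> chull R [fset e.1; e.2]%fset x.
  move=> jN /pieceE[t /andP[t0 t1] ->]; apply/chull2; eexists; last by [].
  rewrite divr_ge0 ?addr_ge0//= ler_pdivrMr ?ltr0n// mul1r.
  by apply: (@le_trans _ _ (j%:R + 1)); rewrite ?lerD2l// natr1 ler_nat.
have seg_piece e x : chull R [fset e.1; e.2]%fset x -> exists2 j, (j < N)%N & piece e j x.
  move=> /chull2[t /andP[t0 t1] ->].
  have [->|tn1] := eqVneq t 1.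
    exists N.-1; first by rewrite prednK.
    apply/pieceE; exists 1; rewrite ?ler01 ?lexx//.
    by rewrite natr1 prednK// divff.
  have tN0 : 0 <= t * N%:R by rewrite mulr_ge0.
  exists (Num.truncn (t * N%:R)).
    rewrite -(ltr_nat R); apply: le_lt_trans (_ : t * N%:R < _).
      by rewrite truncn_le.
    by rewrite gtr_pMl ?ltr0n// lt_neqAle tn1.
  apply/pieceE; exists (t * N%:R - (Num.truncn (t * N%:R))%:R).
    have /andP[h1 h2] := truncn_itv tN0.
    by rewrite subr_ge0 h1 /= lerBlDl natr1 ltW.
  by congr (_ + _ *: _); rewrite addrC subrK mulfK.
have Kpiece x : K x <-> exists e j, [/\ e \in E, (j < N)%N & piece e j x].
  rewrite KE; split=> [[e eE /seg_piece[j jN xj]]|[e [j [eE jN xj]]]]; first by exists e, j.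
  by exists e => //; exact: piece_seg xj.
pose Pc := [seq (e, j) | e <- E, j <- iota 0 N].
(* The union of the pieces of which [u] is not an end; its complement in [K] is the open star of
   [u]. *)
pose C u : set 'rV[R]_n := \bigcup_(S in [set` [seq [fset g c.1 c.2; g c.1 c.2.+1]%fset |
   c <- Pc & (u != g c.1 c.2) && (u != g c.1 c.2.+1)]]) chull R S.
have CP u x : C u x <-> exists e j, [/\ e \in E, (j < N)%N, piece e j x,
    u != g e j & u != g e j.+1].
  split=> [[S /= /mapP[[e j]]]|[e [j [eE jN xj uj uj']]]].
    rewrite mem_filter => /andP[/andP[uj uj'] /allpairsP[[e' j'] [/= eE]]].
    by rewrite mem_iota => /andP[_ jN] [? ?] -> xj; subst e' j'; exists e, j.
  exists [fset g e j; g e j.+1]%fset => //=.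
  apply/mapP; exists (e, j) => //; rewrite mem_filter uj uj' allpairs_f//.
  by rewrite mem_iota.
have Cpoly u : rational_polyhedron (C u) by eexists.
have /choice[V /all_and2[oV VP]] : forall u, exists V : set (maxspec G), open V /\
    forall (m : maxspec G) z, K z -> mxs m = pid z -> (V m <-> ~ C u z).
  by move=> u; have [V ? ?] := polyhedron_hk_open (Cpoly u); exists V.
(* A point lies in the stars of at most two subdivision points, which bounds the order of the
   cover. *)
have ends e j x u : K x -> e \in E -> (j < N)%N -> piece e j x -> ~ C u x ->
    u = g e j \/ u = g e j.+1.
  move=> Kx eE jN xj nC; have [->|uj] := eqVneq u (g e j); [by left|right].
  by apply/eqP; apply: contrapT => /negP uj'; apply: nC; apply/CP; exists e, j.
have cpt e : e \in E -> cube R n (pt R e.1) /\ cube R n (pt R e.2).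
  move=> eE; split; apply: (bigcap_cube P_cube); apply/KE; exists e => //;
    by apply: chull_vertex; rewrite in_fset2 eqxx ?orbT.
(* A subdivision point lies in its own star, because distinct segments meet only at ends; any other
   point is interior to a single piece, and the star of the first end of that piece contains it. *)
have coverX x : K x -> exists2 u, u \in X & ~ C u x.
  move=> Kx; have [[u uX xu]|nX] := pselect (exists2 u, u \in X & x = pt R u).
    exists u => //; move=> /CP[e [j [eE jN xj uj uj']]].
    have [i iN xi] : exists2 i, (i <= N)%N & x = pt R (g e i).
      move: uX; rewrite mem_undup => /allpairsP[[e' i] [e'E]].
      rewrite mem_iota add0n ltnS => /andP[_ iN] ue; rewrite /= in e'E iN ue; have [ee|ee] := eqVneq e e'.
        by exists i; rewrite ?xu ?ue ?ee.
      have xe' : chull R [fset e'.1; e'.2]%fset x.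
        rewrite xu ue gE; apply/chull2; exists (i%:R / N%:R) => //.
        by rewrite divr_ge0//= ler_pdivrMr ?ltr0n// mul1r ler_nat.
      have [->|->] := Ei e e' x eE e'E ee (piece_seg _ _ _ jN xj) xe'.
        by exists 0%N; rewrite ?g0.
      by exists N; rewrite ?gN.
    have uE : u = g e i by apply: (@pt_inj R n); rewrite -xu -xi.
    have [e12|e12] := eqVneq e.1 e.2.
      by case/eqP: uj; rewrite uE /g e12 subrr !scaler0.
    move/pieceE: xj => [t t01]; rewrite xi gE => /segment_inj -/(_ _).
    have -> : pt R e.1 != pt R e.2 by rewrite (inj_eq (@pt_inj R n)).
    move=> /(_ isT)/(mulIf _) -/(_ (invr_neq0 N0')) it.
    have ij : (j <= i)%N by rewrite -(ler_nat R) it lerDl; case/andP: t01.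
    have ij' : (i <= j.+1)%N by rewrite -(ler_nat R) it -natr1 lerD2l; case/andP: t01.
    have : (i == j) || (i == j.+1).
      by move: ij'; rewrite leq_eqVlt ltnS orbC (eqn_leq i j) ij andbT.
    by rewrite uE in uj uj' => /orP[/eqP e1|/eqP e1]; rewrite e1 eqxx in uj uj'.
  have [e [j [eE jN xj]]] := (Kpiece x).1 Kx.
  exists (g e j); first by rewrite gX// ltnW.
  move=> /CP[e' [j' [e'E j'N xj' uj uj']]].
  have ee : e = e'.
    apply/eqP; apply: contrapT => /negP ee; apply: nX.
    have [->|->] := Ei e e' x eE e'E ee (piece_seg _ _ _ jN xj) (piece_seg _ _ _ j'N xj').
      by exists (g e 0); [rewrite gX|rewrite g0].
    by exists (g e N); [rewrite gX|rewrite gN].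
  subst e'; have [e12|e12] := eqVneq e.1 e.2.
    by case/eqP: uj; rewrite /g e12 subrr !scaler0.
  move/pieceE: xj => [t /andP[t0 t1] xt]; move/pieceE: xj' => [t' /andP[t'0 t'1]].
  rewrite xt => /segment_inj -/(_ _); rewrite (inj_eq (@pt_inj R n)) => /(_ e12).
  move=> /(mulIf _) -/(_ (invr_neq0 N0')) tt.
  have tn0 : t != 0.
    apply/eqP => te; apply: nX; exists (g e j); first by rewrite gX// ltnW.
    by rewrite xt te addr0 gE.
  have tn1 : t != 1.
    apply/eqP => te; apply: nX; exists (g e j.+1); first by rewrite gX.
    by rewrite xt te natr1 gE.
  have tgt : 0 < t by rewrite lt_def tn0.
  have tlt : t < 1 by rewrite lt_neqAle tn1.
  have j1 : (j < j'.+1)%N by rewrite -(ltr_nat R) -natr1; lra.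
  have j2 : (j' < j.+1)%N by rewrite -(ltr_nat R) -natr1; lra.
  by case/eqP: uj; congr (g e _); apply/eqP;
    rewrite eqn_leq; apply/andP; split; rewrite -ltnS.
pose W (j : 'I_(size X)) := V (tnth (in_tuple X) j).
exists (size X), W; split.
- by move=> j; exact: oV.
- apply/seteqP; split=> // m _; have [z Kz mz] := maxspec_point m.
  have [u uX uz] := coverX z Kz.
  have [j uj] : exists j, u = tnth (in_tuple X) j by apply/tnthP.
  by exists j => //; apply/(VP _ _ z) => //; rewrite -uj.
- move=> j; pose u := tnth (in_tuple X) j.
  have : u \in X by exact: mem_tnth.
  rewrite mem_undup => /allpairsP[[e i] [eE]]; rewrite mem_iota add0n ltnS => /andP[_ iN] ue.
  rewrite /= in eE iN ue.
  have Ku : K (pt R u).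
    apply/KE; exists e => //; rewrite ue gE; apply/chull2; exists (i%:R / N%:R) => //.
    by rewrite divr_ge0//= ler_pdivrMr ?ltr0n// mul1r ler_nat.
  have [i0 Oi0] := NP _ Ku; exists i0 => m Wm; have [z Kz mz] := maxspec_point m.
  have nC : ~ C u z by apply/(VP u m z).
  apply/(OP i0 m z) => //; apply: Oi0 => c.
  have [e' [j' [e'E j'N zj']]] := (Kpiece z).1 Kz.
  have /chull2[t /andP[t0 t1] ->] := zj'.
  have [cp cq] := cpt _ e'E.
  have gd : `|pt R (g e' j') 0 c - pt R (g e' j'.+1) 0 c| <= N%:R^-1.
    have comb (a b : 'rV[R]_n) (r : R) : (a + r *: (b - a)) 0 c = a 0 c + r * (b 0 c - a 0 c).
      by rewrite !mxE.
    rewrite !gE !comb -natr1 (_ : _ - _ = N%:R^-1 * (pt R e'.1 0 c - pt R e'.2 0 c)).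
      by rewrite normrM ger0_norm ?invr_ge0// ler_piMr ?invr_ge0// cube_dist.
    by field.
  have comb (a b : 'rV[R]_n) : (a + t *: (b - a)) 0 c = a 0 c + t * (b 0 c - a 0 c).
    by rewrite !mxE.
  have [d1 d2] := segment_dist (pt R (g e' j') 0 c) (pt R (g e' j'.+1) 0 c) t0 t1.
  by rewrite comb; have [->|->] := ends _ _ _ _ Kz e'E j'N zj' nC; apply: le_trans gd.
move=> m; have [z Kz mz] := maxspec_point m.
have [e [j [eE jN zj]]] := (Kpiece z).1 Kz.
rewrite cardE -(size_map (fun j => tnth (in_tuple X) j)).
apply: (@uniq_leq_size _ _ [:: g e j; g e j.+1]).
  rewrite map_inj_uniq ?enum_uniq//; apply/tuple_uniqP; exact: undup_uniq.
move=> w /mapP[i]; rewrite mem_enum !inE => /asboolP/asboolP Wi ->.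
have nC : ~ C (tnth (in_tuple X) i) z by exact: (VP _ m z Kz mz).1 Wi.
by have [->|->] := ends _ _ _ _ Kz eE jN zj nC; rewrite eqxx ?orbT.
Qed.
End Dimension.

Section DimensionLower.
Variables (R : realType) (n : nat) (P : nat -> set 'rV[R]_n).
Hypothesis P_poly : forall j, rational_polyhedron (P j).
Hypothesis P_cube : forall j, P j `<=` cube R n.
Hypothesis P_dec : forall i j, (i <= j)%N -> P j `<=` P i.
Variable hI : convex_lsubgroup (germ_ideal P).
Let G : ulGroupType := lquot hI.
Let K : set 'rV[R]_n := \bigcap_j P j.
Local Notation pid := (@point_ideal R n P hI).

(** Testing the inequalities of the hull avoids assigning weights to vertices that may coincide. *)
Lemma chull3 (p0 p1 p2 : 'rV[rat]_n) (s t : R) : 0 <= s -> 0 <= t -> s + t <= 1 ->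
  chull R [fset p0; p1; p2]%fset
    (pt R p0 + s *: (pt R p1 - pt R p0) + t *: (pt R p2 - pt R p0)).
Proof.
move=> s0 t0 st; have [t' t'P] := chull_dual R [fset p0; p1; p2]%fset.
apply/t'P/dual_ev => a at'.
have h v : v \in [fset p0; p1; p2]%fset -> 0 <= ev a (pt R v).
  by move=> /(chull_vertex R)/t'P/dual_ev; apply.
have := h p0; have := h p1; have := h p2; rewrite !inE !eqxx ?orbT => /(_ isT) h2 /(_ isT) h1 /(_ isT) h0.
have -> : pt R p0 + s *: (pt R p1 - pt R p0) + t *: (pt R p2 - pt R p0) =
    \sum_(i < 3) [:: 1 - s - t; s; t]`_i *: [:: pt R p0; pt R p1; pt R p2]`_i.
  by rewrite !big_ord_recr big_ord0 /= add0r; apply/rowP => i; rewrite !mxE; ring.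
rewrite ev_sum; last by rewrite !big_ord_recr big_ord0 /=; ring.
by rewrite !big_ord_recr big_ord0 /= add0r !addr_ge0// mulr_ge0//; lra.
Qed.

(* The complements of the edges of the triangle cover K. Amalgamating a
   refinement of order 2 into W 0, W 1, W 2 and labelling grid points z with some
   a such that z is not in W a, Sperner's lemma contradicts the Lebesgue number
   of the cover W. *)
Lemma covering_dim_gt1 (p0 p1 p2 : 'rV[rat]_n) :
  (forall x, chull R [fset p0; p1; p2]%fset x -> K x) ->
  (forall x, chull R [fset p1; p2]%fset x -> chull R [fset p0; p2]%fset x ->
    chull R [fset p0; p1]%fset x -> False) ->
  ~ covering_dim_le (maxspec G) 1.
Proof.
move=> TK Tind dim1.
pose i0 : 'I_3 := inord 0; pose i1 : 'I_3 := inord 1; pose i2 : 'I_3 := inord 2.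
have ne01 : (i0 == i1) = false by apply/eqP => /(congr1 val); rewrite /= !inordK.
have ne02 : (i0 == i2) = false by apply/eqP => /(congr1 val); rewrite /= !inordK.
have ne12 : (i1 == i2) = false by apply/eqP => /(congr1 val); rewrite /= !inordK.
(* [Ed a] is the edge opposite to the vertex with index [a]. *)
pose Ed (a : 'I_3) := (if a == i0 then [fset p1; p2] else
  if a == i1 then [fset p0; p2] else [fset p0; p1])%fset.
have EP a : rational_polyhedron (chull R (Ed a)).
  exists [:: Ed a]; apply/seteqP; split=> [x xE|x [S /=]]; first by exists (Ed a) => //=; rewrite mem_head.
  by rewrite inE => /eqP ->.
have /choice[U /all_and2[oU UP]] : forall a, exists U : set (maxspec G), open U /\
    forall (m : maxspec G) z, K z -> mxs m = pid z -> (U m <-> ~ chull R (Ed a) z).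
  by move=> a; have [U ? ?] := polyhedron_hk_open P_cube P_dec hI (EP a); exists U.
have [|l [V [oV cV VU V2]]] := dim1 3 U oU.
  apply/seteqP; split=> // m _; have [z Kz mz] := maxspec_point P_poly P_cube P_dec m.
  apply: contrapT => nU.
  have Ez a : chull R (Ed a) z.
    by apply: contrapT => h; apply: nU; exists a => //; exact/(UP a m z).
  have := Ez i0; have := Ez i1; have := Ez i2.
  rewrite /Ed !eqxx (eq_sym i1) (eq_sym i2) (eq_sym i2) ne01 ne02 ne12 => h2 h1 h0.
  exact: Tind h0 h1 h2.
have /choice[c cP] := VU.
have /choice[O /all_and2[oO OP]] : forall j, exists O : set 'rV[R]_n, open O /\
    forall (m : maxspec G) z, K z -> mxs m = pid z -> (V j m <-> O z).
  by move=> j; have [O ? ?] := hk_open_trace (oV j); exists O.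
pose W (a : 'I_3) : set 'rV[R]_n := \bigcup_(j in [set j | c j = a]) O j.
have oW a : open (W a) by apply: bigcup_open => j _; exact: oO.
have WE a z : K z -> chull R (Ed a) z -> ~ W a z.
  move=> Kz Ez [j /= cj Oz]; subst a; have [m mz] := point_maxspec P_cube P_dec hI Kz.
  by apply: ((UP (c j) m z Kz mz).1 _) Ez; apply: cP; apply/(OP j m z).
have Wc z : K z -> exists a, W a z.
  move=> Kz; have [m mz] := point_maxspec P_cube P_dec hI Kz.
  have : (\bigcup_j V j) m by rewrite cV.
  by move=> [j _ /(OP j m z Kz mz) Oz]; exists (c j); exists j.
(* If [z] were in all three sets, members of [V] chosen from the three classes of [c] would be
   distinct and all contain [m], against the order of [V]. *)
have Wn z : K z -> exists a, ~ W a z.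
  move=> Kz; apply: contrapT => /forallNP h.
  have {}h a : W a z by apply: contrapT; exact: h.
  have [m mz] := point_maxspec P_cube P_dec hI Kz.
  have /choice[f fP] : forall a, exists j, c j = a /\ V j m.
    by move=> a; have [j /= cj Oj] := h a; exists j; split=> //; apply/(OP j m z).
  have finj : injective f by move=> a b /(congr1 c); have [-> _] := fP a; have [-> _] := fP b.
  have := V2 m; rewrite leqNgt => /negP; apply.
  apply: (@leq_trans #|codom f|); first by rewrite card_codom// card_ord.
  apply: subset_leq_card.
  apply/fintype.subsetP => _ /codomP[a ->]; have [_ Vf] := fP a.
  by rewrite unfold_in /=; apply/asboolP.
have /choice[col0 col0P] : forall z, exists a, K z -> ~ W a z.
  move=> z; have [Kz|nK] := pselect (K z); last by exists i0.
  by have [a ?] := Wn z Kz; exists a.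
have [N' N'0 N'P] := lebesgue_grid (bigcap_compact P_poly P_cube) oW Wc.
(* Within a small triangle both parameters change by at most [1 / N], hence each coordinate by at
   most [2 / N], which is [1 / N']. *)
pose N := (2 * N')%N; have N0 : (0 < N)%N by rewrite muln_gt0.
have N0' : N%:R != 0 :> R by rewrite pnatr_eq0 -lt0n.
pose q i j : 'rV[R]_n := pt R p0 + (i%:R / N%:R) *: (pt R p1 - pt R p0) +
  (j%:R / N%:R) *: (pt R p2 - pt R p0).
have qT i j : (i + j <= N)%N -> K (q i j).
  move=> ij; apply: TK; apply: chull3; rewrite ?divr_ge0//.
  by rewrite -mulrDl ler_pdivrMr ?ltr0n// mul1r -natrD ler_nat.
(* On the boundary the label is prescribed so as to meet the hypotheses of [sperner]. It is the
   index of an edge through the point, which is admissible as [W a] misses [Ed a]. *)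
pose col i j : 'I_3 := if j == 0%N then (if i == 0%N then i1 else i2) else
  if i == 0%N then (if j == N then i0 else i1) else
  if (i + j)%N == N then i0 else col0 (q i j).
have frac01 (i : nat) : (i <= N)%N -> 0 <= (i%:R / N%:R : R) <= 1.
  by move=> iN; rewrite divr_ge0//= ler_pdivrMr ?ltr0n// mul1r ler_nat.
have colP i j : (i + j <= N)%N -> ~ W (col i j) (q i j).
  move=> ij; have Kq := qT i j ij.
  have q0 : j = 0%N -> chull R (Ed i2) (q i j).
    move=> j0; rewrite /Ed (eq_sym i2) ne02 (eq_sym i2) ne12; apply/chull2.
    exists (i%:R / N%:R); first exact: frac01 (leq_trans (leq_addr j i) ij).
    by rewrite /q j0 mul0r scale0r addr0.
  have q1 : i = 0%N -> chull R (Ed i1) (q i j).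
    move=> j0; rewrite /Ed (eq_sym i1) ne01 eqxx; apply/chull2.
    exists (j%:R / N%:R); first exact: frac01 (leq_trans (leq_addl i j) ij).
    by rewrite /q j0 mul0r scale0r addr0.
  have q2 : (i + j)%N = N -> chull R (Ed i0) (q i j).
    move=> ijN; rewrite /Ed eqxx; apply/chull2.
    exists (j%:R / N%:R); first exact: frac01 (leq_trans (leq_addl i j) ij).
    rewrite /q; have -> : i%:R = N%:R - j%:R :> R by rewrite -ijN natrD addrK.
    by apply/rowP => k; rewrite !mxE; field.
  rewrite /col; case: eqP => [j0|jn].
    by case: eqP => [e0|en]; apply: WE => //; [exact: q1|exact: q0].
  case: eqP => [e0|en].
    by case: eqP => [jN|jN]; apply: WE => //; [apply: q2; rewrite e0 jN|exact: q1].
  by case: eqP => [ijN|ijN]; [apply: WE => //; exact: q2|exact: col0P].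
have [||||i [j ijP]] := @sperner N col N0.
- move=> j _; rewrite /col eqxx -/i0 -/i1 -/i2; case: ifP => _; first by rewrite ne12.
  by case: ifP => _; rewrite ?ne02 ?ne12.
- move=> j jN; rewrite /col -/i0 -/i1 -/i2; case: (eqVneq j 0%N) => [->|j0].
    by rewrite subn0 gtn_eqF// eq_sym ne12.
  case: (eqVneq (N - j)%N 0%N) => Nj; first by rewrite eqn_leq jN -subn_eq0 Nj ne01.
  by rewrite subnK// eqxx ne01.
- by rewrite /col !eqxx.
- by move=> i /andP[i0' _]; rewrite /col eqxx gtn_eqF.
have [a0' [b0' [_ _ ab0 _]]] := ijP i0.
have ij : (i + j <= N)%N.
  by have [a [b [/andP[h1 h2] /andP[h3 h4] h5 _]]] := ijP i0; apply: leq_trans h5; exact: leq_add.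
have [a Wa] := N'P _ (qT i j ij).
have [i' [j' [/andP[ii i'i] /andP[jj j'j] ij' ca]]] := ijP a.
apply: (colP i' j' ij'); rewrite ca; apply: Wa => k.
have cub v : v \in [fset p0; p1; p2]%fset -> cube R n (pt R v).
  by move=> vT; apply: (bigcap_cube P_cube); apply: TK; exact: chull_vertex.
have d v : v \in [fset p0; p1; p2]%fset -> `|pt R v 0 k - pt R p0 0 k| <= 1.
  by move=> vT; apply: cube_dist; apply: cub; rewrite // !inE eqxx.
have d1 := d p1; have d2 := d p2; rewrite !inE !eqxx ?orbT in d1 d2.
move: (d1 isT) (d2 isT) => {d1 d2}.
have qk (u w : nat) : q u w 0 k = pt R p0 0 k + (u%:R / N%:R) * (pt R p1 0 k - pt R p0 0 k) +
    (w%:R / N%:R) * (pt R p2 0 k - pt R p0 0 k) by rewrite !mxE.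
rewrite !qk; set a1 := pt R p1 0 k - _; set a2 := pt R p2 0 k - _ => h1 h2.
have -> : pt R p0 0 k + i%:R / N%:R * a1 + j%:R / N%:R * a2 -
   (pt R p0 0 k + i'%:R / N%:R * a1 + j'%:R / N%:R * a2) =
   - N%:R^-1 * ((i'%:R - i%:R) * a1 + (j'%:R - j%:R) * a2) by field.
have step (u u' : nat) (b : R) : (u <= u')%N -> (u' <= u.+1)%N -> `|b| <= 1 -> `|(u'%:R - u%:R) * b| <= 1.
  move=> uu u'u b1; rewrite -natrB// normrM normr_nat.
  have : (u' - u <= 1)%N by rewrite leq_subLR addn1.
  rewrite -(ler_nat R) => h; rewrite -[leRHS]mulr1; apply: ler_pM => //.
set X := _ + _.
have X2 : `|X| <= 2 by apply: le_trans (ler_normD _ _) _; apply: (lerD (y := 1)); apply: step.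
have N'i : 0 <= N'%:R^-1 :> R by rewrite invr_ge0.
have -> : `|- N%:R^-1 * X| = N'%:R^-1 * (2^-1 * `|X|).
  by rewrite normrM normrN [X in X * _]ger0_norm ?invr_ge0// /N natrM invfM -mulrA mulrCA.
by rewrite ler_piMr// ler_pdivrMl// mulr1.
Qed.

End DimensionLower.

(** * Stellar sequences in cone coordinates *)

Section ConeCoordinates.
Variables (R : realType) (V : choiceType).

Lemma cone_sub m (s s' : seq 'rV[int]_m) (y : 'rV[R]_m) :
  {subset s <= s'} -> cone s y -> cone s' y.
Proof.
move=> ss' sy; have [t tP] := weyl R s'; apply/tP/dualP => a at_.
rewrite dotC; apply: cone_dot sy _ => h hs; rewrite dotC.
by have /tP/dualP := cone_mem R (ss' h hs); apply.
Qed.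

Section Fixed.
Variables (n : nat) (W : wcomplex V) (iota : V -> 'rV[rat]_n).
Implicit Types (S T : {fset V}) (c : V -> R) (x : 'rV[R]_n).

Definition hz (v : V) : 'rV[R]_(n + 1) := intv R (homog (iota v)).
Definition supported S c : Prop := forall v, v \notin S -> c v = 0.
Definition tot c : 'rV[R]_(n + 1) := \sum_(v <- verts W) c v *: hz v.
(** Points of the cone over the abstract complex. They are functions on all of [V], so that
    coordinates before and after a step have the same type. *)
Definition ccone c : Prop :=
  (forall v, 0 <= c v) /\ exists2 S, simps W S & supported S c.

(* A complex realizing W by iota, seen through the cone over it: the first
   property says that cone coordinates are unique, which accounts for both the
   independence of the vertices of a simplex and the intersection condition;
   the second one that the lattice points of a cone have integer coordinates. *)
Definition good (D : set {fset 'rV[rat]_n}) : Prop :=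
  [/\ D = [set (iota @` S)%fset | S in simps W],
      forall c c', ccone c -> ccone c' -> tot c = tot c' -> c = c' &
      forall S c a, simps W S -> supported S c -> tot c = intv R a ->
        forall v, exists k : int, c v = k%:~R].

Lemma simps_sub S : simps W S -> (S `<=` verts W)%fset.
Proof. by move=> WS; apply/fsubsetP => v vS; apply/simps_verts; exists S. Qed.

Lemma simps1 v : v \in verts W -> simps W [fset v]%fset.
Proof.
by move=> /simps_verts[S WS vS]; apply: simps_down WS _; rewrite fsub1set.
Qed.

Lemma tot_sub S c : (S `<=` verts W)%fset -> supported S c ->
  tot c = \sum_(v <- S) c v *: hz v.
Proof.
move=> SW Sc; apply/esym/big_fset_incl => // v _ vS; by rewrite Sc// scale0r.
Qed.

Lemma chull_simp S x : (S `<=` verts W)%fset -> chull R (iota @` S)%fset x <->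
  exists c, [/\ forall v, 0 <= c v, supported S c & tot c = lift1 x].
Proof.
move=> SW; have E : chull R (iota @` S)%fset x <-> cone [seq homog (iota v) | v <- S] (lift1 x).
  rewrite chull_cone; split; apply: cone_sub => h /mapP[v].
    by move=> /imfsetP[w /= wS ->] ->; apply/mapP; exists w.
  by move=> vS ->; apply/mapP; exists (iota v); rewrite // in_imfset.
rewrite E (coneP (fun v => homog (iota v)) _ (fset_uniq S)).
split=> [[c [c0 cE]]|[c [c0 Sc cE]]]; last by exists c; split=> //; rewrite -cE (tot_sub SW Sc).
exists (fun v => if v \in S then c v else 0); split.
- by move=> v; case: ifP => // /c0.
- by move=> v /negbTE ->.
- rewrite cE (tot_sub SW); last by move=> v /negbTE ->.
  by rewrite [LHS]big_seq [RHS]big_seq; apply: eq_bigr => v ->.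
Qed.

Definition delta (v w : V) : R := (w == v)%:R.

Lemma sum_delta (U : lmodType R) (A : {fset V}) v (F : V -> U) : v \in A ->
  \sum_(w <- A) delta v w *: F w = F v.
Proof.
move=> vA; rewrite (bigD1_seq v) ?fset_uniq//= /delta eqxx scale1r big1 ?addr0//.
by move=> w /negbTE ->; rewrite scale0r.
Qed.

Lemma tot_delta v : v \in verts W -> tot (delta v) = hz v.
Proof. exact: sum_delta. Qed.

Lemma totZ (k : R) c : tot (fun v => k * c v) = k *: tot c.
Proof. by rewrite scaler_sumr; apply: eq_bigr => v _; rewrite scalerA. Qed.

Lemma totD c c' : tot (fun v => c v + c' v) = tot c + tot c'.
Proof. by rewrite -big_split; apply: eq_bigr => v _; rewrite scalerDl. Qed.

Lemma tot_last c : tot c 0 (rshift n 0) = \sum_(v <- verts W) c v * (den (iota v))%:R.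
Proof.
rewrite summxE; apply: eq_bigr => v _.
by rewrite mxE /hz mxE row_mxEr mxE.
Qed.

Lemma ccone_off c v : ccone c -> v \notin verts W -> c v = 0.
Proof.
by move=> [_ [S WS Sc]] vW; apply: Sc; apply: contra vW; exact/fsubsetP/simps_sub.
Qed.

Lemma ccone_delta v : v \in verts W -> ccone (delta v).
Proof.
move=> vW; split=> [w|]; first by rewrite ler0n.
exists [fset v]%fset; first exact: simps1.
by move=> w; rewrite in_fset1 /delta => /negbTE ->.
Qed.

Lemma cconeZ (k : R) c : 0 <= k -> ccone c -> ccone (fun v => k * c v).
Proof.
move=> k0 [c0 [S WS Sc]]; split=> [v|]; first by rewrite mulr_ge0.
by exists S => // v /Sc ->; rewrite mulr0.
Qed.

Lemma good_inj D : good D -> {in verts W &, injective iota}.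
Proof.
move=> [_ U _] v w vW wW e.
have /(congr1 (@^~ w)) : delta v = delta w.
  by apply: U; rewrite ?tot_delta ?/hz ?e//; exact: ccone_delta.
by rewrite /delta eqxx; case: (w =P v) => // _ /eqP; rewrite eq_sym oner_eq0.
Qed.

Lemma ccone_point c : ccone c -> (forall v, c v = 0) \/
  exists t x, [/\ 0 < t, tot c = t *: lift1 x & tot (fun v => t^-1 * c v) = lift1 x].
Proof.
move=> cc; have [c0 _] := cc; pose t := tot c 0 (rshift n 0).
have tE : t = \sum_(v <- verts W) c v * (den (iota v))%:R by exact: tot_last.
have [t0|t0] := eqVneq t 0; [left|right].
  move=> v; have [vW|/(ccone_off cc)//] := boolP (v \in verts W).
  move/eqP: t0; rewrite tE psumr_eq0 => [/allP/(_ v vW)|w _]; last by rewrite mulr_ge0.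
  by rewrite /= mulf_eq0 pnatr_eq0 gtn_eqF ?den_gt0// orbF => /eqP.
have tgt : 0 < t by rewrite lt_def t0 tE sumr_ge0// => v _; rewrite mulr_ge0.
pose x : 'rV[R]_n := \row_i (t^-1 * tot c 0 (lshift 1 i)).
have E : tot c = t *: lift1 x.
  apply/rowP => j; rewrite [RHS]mxE; case: (splitP j) => k jk.
    have -> : j = lshift 1 k by exact: val_inj.
    by rewrite row_mxEl mxE mulrA divff ?mul1r.
  have -> : j = rshift n 0 by apply: val_inj; rewrite /= jk ord1.
  by rewrite row_mxEr mxE mulr1.
by exists t, x; split=> //; rewrite totZ E scalerA mulVf ?scale1r.
Qed.

Lemma good_support D x : good D ->
  csupport R D x <-> exists2 c, ccone c & tot c = lift1 x.
Proof.
move=> [-> _ _]; split=> [[_ [S WS <-]]|[c [c0 [S WS Sc]] cx]].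
  by move=> /(chull_simp _ (simps_sub WS))[c [c0 Sc cx]]; exists c => //; split=> //; exists S.
exists (iota @` S)%fset; first by exists S.
by apply/(chull_simp _ (simps_sub WS)); exists c.
Qed.

Lemma good_chull D S c x : good D -> simps W S -> ccone c -> tot c = lift1 x ->
  chull R (iota @` S)%fset x <-> supported S c.
Proof.
move=> [_ U _] WS cc cx; rewrite (chull_simp _ (simps_sub WS)); split.
  move=> [c' [c'0 Sc' c'x]]; suff -> : c = c' by [].
  by apply: U => //; [split=> //; exists S|rewrite cx].
by move=> Sc; exists c; split=> //; case: cc.
Qed.

Lemma imfset_iota D S T : good D -> (S `<=` verts W)%fset -> (T `<=` verts W)%fset ->
  (iota @` S)%fset = (iota @` T)%fset -> S = T.
Proof.
move=> gD SW TW e.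
have sub A B : (A `<=` verts W)%fset -> (B `<=` verts W)%fset ->
    (iota @` A)%fset = (iota @` B)%fset -> (A `<=` B)%fset.
  move=> AW BW eAB; apply/fsubsetP => v vA.
  have : iota v \in (iota @` B)%fset by rewrite -eAB in_imfset.
  move=> /imfsetP[w /= wB vw]; suff -> : v = w by [].
  by apply: (good_inj gD) => //; [exact: (fsubsetP AW)|exact: (fsubsetP BW)].
by apply/eqP; rewrite eqEfsubset; apply/andP; split; apply: sub.
Qed.

Lemma simps_finite : finite_set (simps W).
Proof.
apply: (@sub_finite_set _ _ [set` fpowerset (verts W)]).
  by move=> S /simps_sub SW; rewrite /= fpowersetE.
exact: finite_fset.
Qed.

End Fixed.

End ConeCoordinates.

Section Steps.
Variables (R : realType) (V : choiceType) (n : nat).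
Implicit Types (S T : {fset V}) (c : V -> R) (W : wcomplex V).

(* The linear map of cones undoing a subdivision: h(a) = h(v) + h(w). *)
Definition rho (m : stellar_move V) c : V -> R :=
  if m is Subdivision v w a then
    fun x => if x == a then 0 else c x + (delta R v x + delta R w x) * c a
  else c.

(** Primitivity of [homog u]: the height [t] of an integral vector on its ray clears the
    denominators of [u], so [den u] divides it. *)
Lemma homog_pt_eq (u : 'rV[rat]_n) (y : 'rV[int]_(n + 1)) (t : nat) :
  t%:Z = y 0 (rshift n 0) -> (forall i, t%:R * u 0 i = (y 0 (lshift 1 i))%:~R) ->
  exists2 k, t = (k * den u)%N & y = k%:Z *: homog u.
Proof.
move=> ty ui; have /dvdnP[k kE] : (den u %| t)%N.
  by apply: den_dvd => i; exists (y 0 (lshift 1 i)).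
exists k => //; apply/rowP => j; case: (splitP j) => l jl.
  have -> : j = lshift 1 l by exact: val_inj.
  rewrite mxE row_mxEl mxE; apply: (@intr_inj rat).
  by rewrite rmorphM /= den_coord -ui kE natrM mulrA.
have -> : j = rshift n 0 by apply: val_inj; rewrite /= jl ord1.
by rewrite mxE row_mxEr mxE -ty kE.
Qed.

Section Subdivision.
Variables (W W' : wcomplex V) (iota : V -> 'rV[rat]_n) (D : set {fset 'rV[rat]_n}).
Variables (v w a : V).
Hypothesis gD : good R W iota D.
Hypothesis vw : v != w.
Hypothesis Wvw : simps W [fset v; w]%fset.
Hypothesis aW : a \notin verts W.
Hypothesis verts' : verts W' = (a |` verts W)%fset.
Hypothesis simps' : simps W' =
  [set T | simps W T /\ ~ ([fset v; w] `<=` T)%fset] `|`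
  [set T | exists S, [/\ simps W S, ([fset v; w] `<=` S)%fset &
     (T `<=` a |` (S `\ w))%fset \/ (T `<=` a |` (S `\ v))%fset]].

Let e := farey_mediant R (iota v) (iota w).
Let iota' := fun x => if x == a then e else iota x.

Let vW : v \in verts W.
Proof. by apply: (fsubsetP (simps_sub Wvw)); rewrite in_fset2 eqxx. Qed.
Let wW : w \in verts W.
Proof. by apply: (fsubsetP (simps_sub Wvw)); rewrite in_fset2 eqxx orbT. Qed.
Let va : v != a. Proof. by apply: contraNneq aW => <-. Qed.
Let wa : w != a. Proof. by apply: contraNneq aW => <-. Qed.

Let cvw (k : R) : V -> R := fun x => k * (delta R v x + delta R w x).
Let cvw_sup k : supported [fset v; w]%fset (cvw k).
Proof.
by move=> x; rewrite in_fset2 negb_or /cvw /delta => /andP[/negbTE -> /negbTE ->]; rewrite addr0 mulr0.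
Qed.
Let cvw_tot k : tot W iota (cvw k) = k *: (hz R iota v + hz R iota w).
Proof. by rewrite totZ totD !tot_delta. Qed.
Let cvw_cone k : 0 <= k -> ccone W (cvw k).
Proof.
move=> k0; split=> [x|]; first by rewrite mulr_ge0// addr_ge0// ler0n.
by exists [fset v; w]%fset.
Qed.

(** The sum of the two vectors is [k] times [homog u] for a rational point [u]. Then [homog u] has
    coordinates [1 / k] at [v] and [w], and integrality in [good] forces [k = 1]. *)
Lemma farey_homog : chull R [fset iota v; iota w]%fset (pt R e) /\
  homog e = homog (iota v) + homog (iota w).
Proof.
suff H : exists u, chull R [fset iota v; iota w]%fset (pt R u) /\
    homog u = homog (iota v) + homog (iota w).
  exact: (xgetPex (iota v) H).
pose y := homog (iota v) + homog (iota w); pose t := (den (iota v) + den (iota w))%N.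
have t0 : (0 < t)%N by rewrite addn_gt0 den_gt0.
have t0' : t%:R != 0 :> rat by rewrite pnatr_eq0 -lt0n.
pose u : 'rV[rat]_n := \row_i ((y 0 (lshift 1 i))%:~R / t%:R).
have [||k tk yk] := @homog_pt_eq u y t.
- by rewrite mxE !row_mxEr !mxE -PoszD.
- by move=> i; rewrite mxE mulrCA divff ?mulr1.
have k0 : (0 < k)%N by move: t0; rewrite tk muln_gt0 => /andP[].
have k0' : k%:R != 0 :> R by rewrite pnatr_eq0 -lt0n.
have yR : hz R iota v + hz R iota w = k%:R *: intv R (homog u).
  by rewrite /hz -intvD -/y yk intvZ.
have k1 : k = 1%N.
  have [_ _ /(_ _ (cvw k%:R^-1) (homog u) Wvw (cvw_sup _)) Sat] := gD.
  have [|l] := Sat _ v.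
    by rewrite cvw_tot yR scalerA mulVf// scale1r.
  rewrite /cvw /delta eqxx (negbTE vw) addr0 mulr1 => kl.
  have l0 : 0 < l by rewrite -(ltr0z R) -kl invr_gt0 ltr0n.
  have : 1 <= k%:R^-1 :> R by rewrite kl ler1z; lia.
  rewrite invf_ge1 ?ltr0n// -[1]/(1%:R) ler_nat => k1.
  by apply/eqP; rewrite eqn_leq k1 k0.
have du : (den u)%:R != 0 :> R by rewrite pnatr_eq0 -lt0n den_gt0.
exists u; split; last by rewrite -/y yk k1 scale1r.
have -> : [fset iota v; iota w]%fset = (iota @` [fset v; w])%fset.
  by rewrite imfset_fset2.
apply/(chull_simp iota _ (simps_sub Wvw)).
exists (cvw (den u)%:R^-1); split=> //.
- by have [] := @cvw_cone (den u)%:R^-1; rewrite ?invr_ge0.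
- by rewrite cvw_tot yR k1 scale1r intv_homog scalerA mulVf ?scale1r.
Qed.

Let hz_a : hz R iota' a = hz R iota v + hz R iota w.
Proof. by rewrite /hz /iota' eqxx farey_homog.2 intvD. Qed.
Let hz_old x : x \in verts W -> hz R iota' x = hz R iota x.
Proof. by move=> xW; rewrite /hz /iota' (negbTE (contraNneq _ aW))// => <-. Qed.

Let old_simplex T : simps W T -> a \notin T.
Proof. by move=> /simps_sub TW; apply: contra aW; exact: (fsubsetP TW). Qed.

Lemma rho_tot c : tot W' iota' c = tot W iota (rho (Subdivision v w a) c).
Proof.
rewrite /tot verts' big_fsetU1//= hz_a.
have -> : \sum_(x <- verts W) c x *: hz R iota' x = tot W iota c.
  by rewrite [LHS]big_seq [RHS]big_seq; apply: eq_bigr => x xW; rewrite hz_old.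
rewrite -cvw_tot addrC -totD; apply: eq_big_seq => x xW.
by rewrite (negbTE (contraNneq _ aW)) /cvw ?[c a * _]mulrC// => <-.
Qed.

(** No simplex of [W'] contains both [v] and [w]. The resulting vanishing of a coordinate is what
    lets [c] be recovered from its image under [rho]. *)
Lemma simps'_cases S' c : simps W' S' -> supported S' c ->
  (c v = 0 \/ c w = 0) /\ exists2 S, simps W S & supported S (rho (Subdivision v w a) c).
Proof.
rewrite simps' => -[[WS' nvw] Sc|[S [WS vwS SS'] Sc]].
  have ca : c a = 0 by apply: Sc; exact: old_simplex.
  split; last first.
    by exists S' => // x xS; rewrite /= ca mulr0 addr0 Sc//; case: ifP.
  apply: contrapT => /not_orP[cv cw]; apply: nvw; rewrite fsubUset !fsub1set.
  by apply/andP; split; apply: contrapT => /negP h; [apply: cv|apply: cw]; exact: Sc.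
have [vS wS] : v \in S /\ w \in S by move: vwS; rewrite fsubUset !fsub1set => /andP.
split.
  case: SS' => /fsubsetP SS'; [right|left]; apply: Sc; apply/negP => /SS';
    by rewrite !inE eqxx ?(negbTE va) ?(negbTE wa).
exists S => // x xS /=; case: eqP => // xa.
have xv : (x == v) = false by apply: contraNF xS => /eqP ->.
have xw : (x == w) = false by apply: contraNF xS => /eqP ->.
rewrite /delta xv xw addr0 mul0r addr0; apply: Sc; apply: contra xS => xS'.
by case: SS' => /fsubsetP/(_ x xS'); rewrite !inE (introF eqP xa) /= => /andP[].
Qed.

Lemma rho_cone c : ccone W' c -> ccone W (rho (Subdivision v w a) c).
Proof.
move=> [c0 [S' WS' Sc]]; split=> [x /=|]; last by have [] := simps'_cases WS' Sc.
by case: ifP => // _; rewrite addr_ge0// mulr_ge0// addr_ge0// ler0n.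
Qed.

Let rho_v c : rho (Subdivision v w a) c v = c v + c a.
Proof. by rewrite /= (negbTE va) /delta eqxx (negbTE vw) addr0 mul1r. Qed.
Let rho_w c : rho (Subdivision v w a) c w = c w + c a.
Proof. by rewrite /= (negbTE wa) /delta eqxx eq_sym (negbTE vw) add0r mul1r. Qed.
Let rho_x c x : x != v -> x != w -> x != a -> rho (Subdivision v w a) c x = c x.
Proof. by move=> xv xw xa; rewrite /= /delta (negbTE xv) (negbTE xw) (negbTE xa) addr0 mul0r addr0. Qed.

(** The preimage moves the smaller of [c v] and [c w] from both vertices to [a]. One of the two
    coordinates becomes 0, which puts the result into a simplex of the subdivision. *)
Lemma rho_surj c : ccone W c -> exists2 c', ccone W' c' & rho (Subdivision v w a) c' = c.
Proof.
move=> [c0 [S WS Sc]]; pose k := Num.min (c v) (c w).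
have k0 : 0 <= k by rewrite le_min !c0.
have ca : c a = 0 by apply: Sc; exact: old_simplex.
pose c' x := if x == a then k else c x - (delta R v x + delta R w x) * k.
have c'v : c' v = c v - k by rewrite /c' (negbTE va) /delta eqxx (negbTE vw) addr0 mul1r.
have c'w : c' w = c w - k by rewrite /c' (negbTE wa) /delta eqxx eq_sym (negbTE vw) add0r mul1r.
have c'x x : x != v -> x != w -> x != a -> c' x = c x.
  by move=> xv xw xa; rewrite /c' /delta (negbTE xv) (negbTE xw) (negbTE xa) addr0 mul0r subr0.
have c'a : c' a = k by rewrite /c' eqxx.
exists c'; last first.
  apply/funext => x; have [->|xa] := eqVneq x a; first by rewrite /= eqxx.
  have [->|xv] := eqVneq x v; first by rewrite rho_v c'v c'a subrK.
  have [->|xw] := eqVneq x w; first by rewrite rho_w c'w c'a subrK.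
  by rewrite rho_x// c'x.
split=> [x|].
  have [->|xa] := eqVneq x a; first by rewrite c'a.
  have [->|xv] := eqVneq x v; first by rewrite c'v subr_ge0 ge_min lexx.
  have [->|xw] := eqVneq x w; first by rewrite c'w subr_ge0 ge_min lexx orbT.
  by rewrite c'x.
have [vwS|nvwS] := boolP ([fset v; w] `<=` S)%fset; last first.
  exists S; first by rewrite simps'; left; split=> //; exact/negP.
  have kz : k = 0.
    move: nvwS; rewrite fsubUset !fsub1set negb_and => /orP[/Sc h|/Sc h].
      by rewrite /k h min_l.
    by rewrite /k h min_r.
  by move=> x xS; rewrite /c' kz mulr0 subr0 Sc//; case: ifP.
have aS x : x \notin S -> x != a -> c' x = 0.
  have [vS wS] : v \in S /\ w \in S by move: vwS; rewrite fsubUset !fsub1set => /andP.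
  by move=> xS xa; rewrite c'x ?Sc//; apply: contraNneq xS => ->.
have [le|le] := leP (c w) (c v).
  exists (a |` (S `\ w))%fset; first by rewrite simps'; right; exists S; split=> //; left.
  move=> x; rewrite !inE negb_or negb_and negbK => /andP[xa /orP[/eqP ->|/aS]]; last exact.
  by rewrite c'w /k min_r ?subrr.
exists (a |` (S `\ v))%fset; first by rewrite simps'; right; exists S; split=> //; right.
move=> x; rewrite !inE negb_or negb_and negbK => /andP[xa /orP[/eqP ->|/aS]]; last exact.
by rewrite c'v /k min_l ?subrr// ltW.
Qed.

Let e_simp S : simps W S ->
  chull R (iota @` S)%fset (pt R e) <-> ([fset v; w] `<=` S)%fset.
Proof.
move=> WS; have de : (den e)%:R != 0 :> R by rewrite pnatr_eq0 -lt0n den_gt0.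
have E : tot W iota (cvw (den e)%:R^-1) = lift1 (pt R e).
  rewrite cvw_tot -hz_a /hz /iota' eqxx intv_homog scalerA mulVf ?scale1r//.
rewrite (good_chull gD WS _ E); last by apply: cvw_cone; rewrite invr_ge0.
rewrite fsubUset !fsub1set; split=> [h|/andP[vS wS] x xS].
  apply/andP; split; apply: contrapT => /negP/h/eqP; rewrite /cvw mulf_eq0 invr_eq0 (negbTE de) /delta eqxx /=.
    by rewrite (negbTE vw) addr0 oner_eq0.
  by rewrite [w == v]eq_sym (negbTE vw) add0r oner_eq0.
rewrite /cvw /delta; have -> : (x == v) = false by apply: contraNF xS => /eqP ->.
have -> : (x == w) = false by apply: contraNF xS => /eqP ->.
by rewrite addr0 mulr0.
Qed.

Let im_old T : a \notin T -> (iota' @` T)%fset = (iota @` T)%fset.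
Proof.
move=> aT; apply/fsetP => y; apply/imfsetP/imfsetP => -[x /= xT ->]; exists x => //;
  by rewrite /iota' (negbTE (contraNneq _ aT))// => <-.
Qed.

Let im_new T : a \notin T -> (iota' @` (a |` T))%fset = (e |` iota @` T)%fset.
Proof. by move=> aT; rewrite imfsetU1 {1}/iota' eqxx im_old. Qed.

(** By [e_simp] a simplex contains the mediant exactly when it has both [v] and [w] as vertices,
    which turns the geometric conditions of [blowup] into the combinatorial ones. *)
Lemma blowup_good : blowup R D e = [set (iota' @` S)%fset | S in simps W'].
Proof.
have [DE _ _] := gD; rewrite simps' DE; apply/seteqP; split=> T.
  case=> [[[S WS <-] eS]|[F [neF [_ [[S WS <-] eS FS]]] <-]].
    exists S; last by rewrite im_old//; exact: old_simplex.
    by left; split=> // /(e_simp WS).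
  pose F0 := [fset x in S | iota x \in F]%fset.
  have F0S : (F0 `<=` S)%fset by apply/fsubsetP => x; rewrite !inE => /andP[].
  have FE : F = (iota @` F0)%fset.
    apply/fsetP => y; apply/idP/imfsetP => [yF|[x /= + ->]]; last by rewrite !inE => /andP[].
    have /imfsetP[x /= xS yx] := fsubsetP FS y yF.
    by exists x; rewrite // !inE /= xS -yx.
  have WF0 := simps_down WS F0S; have vwS := (e_simp WS).1 eS.
  have aF0 := old_simplex WF0.
  exists (a |` F0)%fset; last by rewrite im_new// -FE.
  right; exists S; split=> //.
  have : ~~ ([fset v; w] `<=` F0)%fset by apply/negP => /(e_simp WF0); rewrite -FE.
  rewrite fsubUset !fsub1set negb_and => /orP[vF|wF]; [right|left]; apply: fsetUS;
    by apply/fsubsetP => x xF; rewrite !inE (fsubsetP F0S)// andbT; apply: contraTneq xF => ->.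
have old S' : simps W S' -> ~~ ([fset v; w] `<=` S')%fset ->
    blowup R [set (iota @` S)%fset | S in simps W] e (iota' @` S')%fset.
  move=> WS' nvw; left; rewrite im_old ?old_simplex//; split; first by exists S'.
  by move=> /(e_simp WS'); exact/negP.
case=> S' [[WS' nvw]|[S [WS vwS SS']]] <-; first by apply: old => //; exact/negP.
pose F0 := (S' `\ a)%fset.
have F0S : (F0 `<=` S)%fset.
  apply/fsubsetP => x; rewrite !inE => /andP[xa xS'].
  by case: SS' => /fsubsetP/(_ x xS'); rewrite !inE (negbTE xa) /= => /andP[].
have nF0 : ~~ ([fset v; w] `<=` F0)%fset.
  rewrite fsubUset !fsub1set negb_and; apply/orP; case: SS' => /fsubsetP SS'; [right|left];
    by apply/negP; rewrite !inE => /andP[xa /SS']; rewrite !inE eqxx (negbTE xa).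
have WF0 := simps_down WS F0S.
have [aS'|aS'] := boolP (a \in S'); last first.
  have -> : S' = F0 by apply/fsetP => x; rewrite !inE; case: eqP => // ->; rewrite (negbTE aS').
  exact: old.
right; exists (iota @` F0)%fset.
  split; first by move=> /(e_simp WF0); exact/negP.
  exists (iota @` S)%fset; split; [by exists S|exact/(e_simp WS)|].
  by apply/fsubsetP => y /imfsetP[x /= xF ->]; rewrite in_imfset// (fsubsetP F0S).
rewrite -im_new; last exact: old_simplex.
by rewrite /F0 fsetD1K.
Qed.

(** As [c] vanishes at [v] or [w], the value [c a] is one of the coordinates of [rho] at [v] and
    [w], the smaller one if [c] is nonnegative. Hence [rho] is injective on the cone, and [c] is
    integral when its image is. *)
Lemma good_subdivision : good R W' iota' (blowup R D e).
Proof.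
have [DE U Sat] := gD; split; first exact: blowup_good.
  move=> c c' cc cc'; rewrite !rho_tot => /(U _ _ (rho_cone cc) (rho_cone cc')) rr.
  have [c0 [S WS Sc]] := cc; have [c'0 [S' WS' Sc']] := cc'.
  have [nb _] := simps'_cases WS Sc; have [nb' _] := simps'_cases WS' Sc'.
  have ev := congr1 (@^~ v) rr; have ew := congr1 (@^~ w) rr.
  rewrite /= -/(rho (Subdivision v w a) c v) -/(rho (Subdivision v w a) c' v) !rho_v in ev.
  rewrite /= -/(rho (Subdivision v w a) c w) -/(rho (Subdivision v w a) c' w) !rho_w in ew.
  have := c0 v; have := c0 w; have := c0 a; have := c'0 v; have := c'0 w; have := c'0 a.
  move=> h1 h2 h3 h4 h5 h6.
  have [ea ev' ew'] : [/\ c a = c' a, c v = c' v & c w = c' w].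
    by case: nb => nb; case: nb' => nb'; split; lra.
  apply/funext => x; have [->//|xa] := eqVneq x a.
  have [->//|xv] := eqVneq x v; have [->//|xw] := eqVneq x w.
  by rewrite -(rho_x c xv xw xa) rr rho_x.
move=> S c y WS Sc; rewrite rho_tot => cy x.
have [nb [S0 WS0 Sc0]] := simps'_cases WS Sc.
have ints := Sat _ _ _ WS0 Sc0 cy.
have [kv kvE] := ints v; have [kw kwE] := ints w; rewrite rho_v in kvE; rewrite rho_w in kwE.
have [ka kaE] : exists k : int, c a = k%:~R.
  by case: nb => e0; [exists kv|exists kw]; rewrite -?kvE -?kwE e0 add0r.
have [->|xa] := eqVneq x a; first by exists ka.
have [->|xv] := eqVneq x v; first by exists (kv - ka); rewrite rmorphB /= -kvE -kaE addrK.
have [->|xw] := eqVneq x w; first by exists (kw - ka); rewrite rmorphB /= -kwE -kaE addrK.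
by have [k] := ints x; rewrite rho_x// => ?; exists k.
Qed.

Lemma subdivision_support : csupport R (blowup R D e) = csupport R D.
Proof.
apply/seteqP; split; first exact: support_blowup.
move=> x /(good_support _ gD)[c cc cx]; apply/(good_support _ good_subdivision).
have [c' cc' cE] := rho_surj cc.
by exists c' => //; rewrite rho_tot cE.
Qed.

End Subdivision.

Lemma tot_eq W W' (iota : V -> 'rV[rat]_n) S c : (S `<=` verts W)%fset ->
  (S `<=` verts W')%fset -> supported S c -> tot W iota c = tot W' iota c.
Proof. by move=> SW SW' Sc; rewrite (tot_sub _ SW Sc) (tot_sub _ SW' Sc). Qed.

Lemma good_shrink W W' (iota : V -> 'rV[rat]_n) (D D' : set {fset 'rV[rat]_n}) :
  good R W iota D -> simps W' `<=` simps W ->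
  D' = [set (iota @` S)%fset | S in simps W'] -> good R W' iota D'.
Proof.
move=> [_ U Sat] W'W ->.
have T S c : simps W' S -> supported S c -> tot W' iota c = tot W iota c.
  by move=> W'S; apply: tot_eq; [exact: simps_sub|exact/simps_sub/W'W].
split=> // [c c' [c0 [S WS Sc]] [c'0 [S' WS' Sc']]|S c a WS Sc].
  rewrite (T _ _ WS Sc) (T _ _ WS' Sc'); apply: U; split=> //.
    by exists S => //; exact: W'W.
  by exists S' => //; exact: W'W.
by rewrite (T _ _ WS Sc); apply: Sat Sc; exact: W'W.
Qed.

Section Move.
Variables (W W' : wcomplex V) (m : stellar_move V).
Variables (iota : V -> 'rV[rat]_n) (D : set {fset 'rV[rat]_n}).
Hypothesis gD : good R W iota D.
Hypothesis step : stellar_step m W W'.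
Let p := realize_move R m (D, iota).

Lemma good_move : good R W' p.2 p.1.
Proof.
rewrite /p; case: m step => [|M|v w a] /=.
- move=> [_ sW _]; apply: (good_shrink gD); first by rewrite sW.
  by have [-> _ _] := gD; rewrite sW.
- move=> [WM Mmax vW' sW' _]; apply: (good_shrink gD); first by rewrite sW' => S [].
  have [DE _ _] := gD; rewrite sW' DE; apply/seteqP; split=> T.
    move=> [[S WS <-] nSM]; exists S => //; split=> // SM; apply: nSM.
    by rewrite /= SM.
  move=> [S [WS nSM] <-]; split; first by exists S.
  by move=> /(imfset_iota gD (simps_sub WS) (simps_sub WM)).
- move=> [[vw Wvw aW] [vW' sW' _ _]].
  exact: good_subdivision gD vw Wvw aW vW' sW'.
Qed.

Lemma rho_move (c : V -> R) : ccone W' c ->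
  ccone W (rho m c) /\ tot W' p.2 c = tot W iota (rho m c).
Proof.
rewrite /p; case: m step => [|M|v w a] /=.
- move=> [vW sW _] [c0 [S WS Sc]]; split; last by rewrite /tot vW.
  by split=> //; exists S; rewrite -?sW.
- move=> [WM Mmax vW' sW' _] [c0 [S WS Sc]]; have [WS' _] : (simps W `\ M) S by rewrite -sW'.
  split; first by split=> //; exists S.
  by apply: tot_eq Sc; exact: simps_sub.
- move=> [[vw Wvw aW] [vW' sW' _ _]] cc; split.
    exact: (rho_cone Wvw aW sW' cc).
  exact: (rho_tot gD vw Wvw aW vW').
Qed.

Lemma move_support : ~ is_deletion m -> csupport R p.1 = csupport R D.
Proof.
rewrite /p; case: m step => [|M|v w a] //=; first by move=> _ []; exists M.
by move=> [[vw Wvw aW] [vW' sW' _ _]] _; exact: (subdivision_support gD vw Wvw aW vW' sW').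
Qed.

(** The lost point has cone coordinates that are equal on [M] and 0 elsewhere. By uniqueness every
    simplex containing it contains [M], which is maximal; [M] is nonempty because the complex has a
    vertex. *)
Lemma deletion_support M : m = Deletion M ->
  csupport R p.1 <> csupport R D.
Proof.
move=> mM; have gp := good_move; move: step gp; rewrite /p mM /= => -[WM Mmax vW' sW' _] gp e.
have M0 : exists v0, v0 \in M.
  apply/fset0Pn/eqP => M0; have [v0 v0W] := fset0Pn _ (verts_neq0 W).
  have /fsetP/(_ v0) : [fset v0]%fset = M by apply: Mmax; rewrite ?M0 ?fsub0set//; exact: simps1.
  by rewrite M0 !inE eqxx.
have [v0 v0M] := M0; pose c x : R := (x \in M)%:R.
have cc : ccone W c.
  by split=> [x|]; [rewrite ler0n|exists M => // x; rewrite /c => /negbTE ->].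
have [c0|[t [x [t0 _ cx]]]] := ccone_point iota cc.
  by have := c0 v0; rewrite /c v0M => /eqP; rewrite oner_eq0.
have : csupport R (D `\ (iota @` M)%fset) x.
  rewrite e; apply/(good_support _ gD); exists (fun x => t^-1 * c x) => //.
  by apply: cconeZ; rewrite ?invr_ge0 ?ltW.
move=> /(good_support _ gp)[c' [c'0 [S WS Sc']] c'x].
have [WS' SM] : (simps W `\ M) S by rewrite -sW'.
have c'E : c' = fun x => t^-1 * c x.
  have [_ U _] := gD; apply: U; first by split=> //; exists S.
    by apply: cconeZ; rewrite ?invr_ge0 ?ltW.
  by rewrite cx -c'x; apply: tot_eq Sc'; exact: simps_sub.
apply: SM; apply: Mmax => //; apply/fsubsetP => y yM; apply: contrapT => /negP/Sc'/eqP.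
by rewrite c'E /c yM mulr1 invr_eq0 gt_eqF.
Qed.

End Move.

Section Sequence.
Variables (W : nat -> wcomplex V) (s : nat -> stellar_move V) (hW : stellar W s).

(** The composite from the cone over [W j] to the cone over [W 0]. It is defined by the moves alone,
    without a realization, which makes [decided_coords] intrinsic. *)
Fixpoint rhos j (c : V -> R) : V -> R :=
  if j is i.+1 then rhos i (rho (s i) c) else c.

Section Realization.
Variables (iota : V -> 'rV[rat]_n) (D : set {fset 'rV[rat]_n}).
Hypothesis gD : good R (W 0%N) iota D.
Let p := realize R s D iota.

Lemma good_realize j : good R (W j) (p j).2 (p j).1.
Proof.
elim: j => [//|j ih]; rewrite /p /= -/(p j).
case E : (p j) ih => [Dj ij] /= ih; exact: good_move ih (hW j).
Qed.

Lemma realize_support j : ~ is_deletion (s j) ->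
  csupport R (p j.+1).1 = csupport R (p j).1.
Proof.
have := good_realize j; rewrite /p /= -/(p j); case E : (p j) => [Dj ij] /= gj.
exact: move_support gj (hW j).
Qed.

Lemma realize_deletion j : is_deletion (s j) ->
  csupport R (p j.+1).1 <> csupport R (p j).1.
Proof.
have := good_realize j; rewrite /p /= -/(p j); case E : (p j) => [Dj ij] /= gj [M].
exact: deletion_support gj (hW j) _.
Qed.

Lemma rhos_tot j c : ccone (W j) c ->
  ccone (W 0%N) (rhos j c) /\ tot (W j) (p j).2 c = tot (W 0%N) iota (rhos j c).
Proof.
elim: j c => [//|j ih] c cc; have gj := good_realize j.
have := rho_move gj (hW j) cc; rewrite /p /= -/(p j).
by case E : (p j) ih gj => [Dj ij] /= ih gj [cc' ->]; exact: ih.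
Qed.

Lemma realize_supportP j x : csupport R (p j).1 x <->
  exists2 c, ccone (W j) c & tot (W 0%N) iota (rhos j c) = lift1 x.
Proof.
rewrite (good_support _ (good_realize j)); split=> -[c cc cx]; exists c => //.
  by rewrite -(rhos_tot cc).2.
by rewrite (rhos_tot cc).2.
Qed.

End Realization.
End Sequence.
End Steps.

(** * The canonical realization, and regular realizations in general *)

Section Canonical.
Variables (R : realType) (V : choiceType) (W : wcomplex V).
Variables (n : nat) (v : n.-tuple V).
Hypothesis v_uniq : uniq v.
Hypothesis v_verts : verts W =i v.
Let iota := canonical_iota W v.
Let D := canonical_complex W v.

Let tnth_verts i : tnth v i \in verts W. Proof. by rewrite v_verts mem_tnth. Qed.
Let tnth_eq i j : (tnth v i == tnth v j) = (i == j).
Proof. by rewrite (inj_eq (tuple_uniqP v v_uniq)). Qed.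
Let w_gt0 i : (0 < weight W (tnth v i))%N. Proof. exact: weight_gt0. Qed.

Lemma canonical_den i : den (iota (tnth v i)) = weight W (tnth v i).
Proof.
have w0 : (weight W (tnth v i))%:R != 0 :> rat by rewrite pnatr_eq0 -lt0n.
apply/eqP; rewrite eqn_dvd; apply/andP; split.
  apply: den_dvd => j; exists (tnth v i == tnth v j)%:R.
  by rewrite mxE mulrCA divff// mulr1; case: (_ == _).
have := den_coord (iota (tnth v i)) i; rewrite [in RHS]mxE eqxx mul1r.
set d := den _; set k := numq _ => kd.
have e : (d%:Z = k * (weight W (tnth v i))%:Z)%R.
  by apply: (@intr_inj rat); rewrite rmorphM /= kd divfK.
have : ((weight W (tnth v i))%:Z %| d%:Z)%Z by rewrite e dvdz_mull.
by [].
Qed.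

Lemma canonical_homog i j : homog (iota (tnth v i)) 0 (lshift 1 j) = (i == j)%:R.
Proof.
apply: (@intr_inj rat).
rewrite row_mxEl mxE den_coord canonical_den mxE tnth_eq.
rewrite mulrCA divff ?mulr1 ?pnatr_eq0 -?lt0n//; by case: eqP.
Qed.

Lemma canonical_homog_last i :
  homog (iota (tnth v i)) 0 (rshift n 0) = (weight W (tnth v i))%:Z.
Proof. by rewrite row_mxEr mxE canonical_den. Qed.

Lemma sum_verts (U : nmodType) (F : V -> U) :
  \sum_(x <- verts W) F x = \sum_(i < n) F (tnth v i).
Proof.
rewrite -(big_tuple _ _ _ xpredT F); apply: perm_big.
by apply: uniq_perm; rewrite ?fset_uniq.
Qed.

Lemma hzE u j : hz R iota u 0 j = (homog (iota u) 0 j)%:~R.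
Proof. exact: mxE. Qed.

(** [homog] of the i-th vertex is e_i followed by its weight, so the first n entries of a vector are
    its cone coordinates; uniqueness and integrality in [canonical_good] are read off from this. *)
Lemma canonical_tot (c : V -> R) i : tot W iota c 0 (lshift 1 i) = c (tnth v i).
Proof.
rewrite summxE sum_verts (bigD1 i)//= big1 ?addr0 => [|j ji].
  by rewrite mxE hzE canonical_homog eqxx mulr1.
by rewrite mxE hzE canonical_homog (negbTE ji) mulr0.
Qed.

Lemma canonical_good : good R W iota D.
Proof.
have off (c : V -> R) S x : simps W S -> supported S c -> x \notin v -> c x = 0.
  by move=> WS Sc; rewrite -v_verts => xW; apply: Sc; apply: contra xW; exact/fsubsetP/simps_sub.
split=> // [c c' [c0 [S WS Sc]] [c'0 [S' WS' Sc']] e|S c a WS Sc e x].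
  apply/funext => x; have [/tnthP[i ->]|xv] := boolP (x \in v).
    by rewrite -!canonical_tot e.
  by rewrite (off c S)// (off c' S').
have [/tnthP[i ->]|xv] := boolP (x \in v).
  by exists (a 0 (lshift 1 i)); rewrite -canonical_tot e mxE.
by exists 0; rewrite (off c S).
Qed.

Lemma chull_cube (S : {fset 'rV[rat]_n}) : (forall u, u \in S -> cube R n (pt R u)) ->
  chull R S `<=` cube R n.
Proof.
move=> Sc x xS; apply/dual_cube/dual_ev => a ac; apply: chull_ev_ge0 xS _ => u /Sc uc.
by have /dual_cube/dual_ev := uc; apply.
Qed.

Lemma canonical_cube : csupport R D `<=` cube R n.
Proof.
move=> x [_ [S WS <-]]; apply: chull_cube => _ /imfsetP[u /= uS ->] j.
have /tnthP[i ->] : u \in v by rewrite -v_verts (fsubsetP (simps_sub WS)).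
have w0 : (0 : R) < (weight W (tnth v i))%:R by rewrite ltr0n.
rewrite !mxE tnth_eq fmorph_div /= !ratr_nat; apply/andP; split; first by rewrite divr_ge0.
by rewrite ler_pdivrMr// mul1r ler_nat; case: (_ == _).
Qed.

(** The rows formed by e_i and the weight are completed by the last unit vector to a unitriangular
    matrix. *)
Lemma canonical_regular S : simps W S -> regular_simplex (iota @` S)%fset.
Proof.
move=> WS; pose B : 'M[int]_(n + 1) :=
  block_mx 1%:M (\col_i (weight W (tnth v i))%:Z) 0 1%:M.
exists B; first by rewrite unitmxE det_ublock !det1 mulr1 unitr1.
move=> _ /imfsetP[u /= uS ->].
have /tnthP[i ->] : u \in v by rewrite -v_verts (fsubsetP (simps_sub WS)).
exists (lshift 1 i); apply/rowP => j; rewrite mxE; case: (splitP j) => k jk.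
  have -> : j = lshift 1 k by exact: val_inj.
  by rewrite block_mxEul mxE canonical_homog; case: (_ == _).
have -> : j = rshift n 0 by apply: val_inj; rewrite /= jk ord1.
by rewrite block_mxEur mxE canonical_homog_last.
Qed.

End Canonical.

Section Realizations.
Variables (R : realType) (V : choiceType) (W : wcomplex V) (n : nat).
Implicit Types (iota : V -> 'rV[rat]_n) (D : set {fset 'rV[rat]_n}).

Lemma realization_good D iota : realization R D W iota -> good R W iota D.
Proof.
move=> [[Dfin Ddown Dcap Dreg] [iota_im iota_inj iota_surj] _ DW].
have iinj y z : y \in verts W -> z \in verts W -> iota y = iota z -> y = z.
  by move=> yW zW; apply: iota_inj; exact: mem_set.
have DE : D = [set (iota @` S)%fset | S in simps W].
  apply/seteqP; split=> [T DT|T [S WS <-]]; last by apply/DW => //; exact: simps_sub.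
  pose S := [fset x in verts W | iota x \in T]%fset.
  have SW : (S `<=` verts W)%fset by apply/fsubsetP => x; rewrite !inE => /andP[].
  have TS : T = (iota @` S)%fset.
    apply/fsetP => y; apply/idP/imfsetP => [yT|[x /= + ->]]; last by rewrite !inE => /andP[].
    have [x /= xW xy] := iota_surj y (ex_intro2 _ _ T DT yT).
    by exists x; rewrite // !inE xW /= xy.
  by exists S => //; apply/DW; rewrite -?TS.
(* Multiplication by [invmx B] sends the vertices of the simplex to distinct unit vectors, so each
   coefficient is an entry of an integral vector. *)
have SatS S c a : simps W S -> supported S c -> tot W iota c = intv R a ->
    forall x, exists k : int, c x = k%:~R.
  move=> WS Sc ca x; have [xS|/Sc ->] := boolP (x \in S); last by exists 0.
  have /Dreg[B uB rowB] : D (iota @` S)%fset by rewrite DE; exists S.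
  have [i iE] := rowB (iota x) (in_imfset _ iota xS).
  exists ((a *m invmx B) 0 i).
  have rE y : y \in S -> exists l, row l B = homog (iota y).
    by move=> yS; apply: rowB; exact: in_imfset.
  have inj y z : y \in S -> z \in S -> homog (iota y) = homog (iota z) -> y = z.
    move=> yS zS e; apply: iinj; [exact: (fsubsetP (simps_sub WS))|exact: (fsubsetP (simps_sub WS))|].
    have dd : den (iota y) = den (iota z).
      by have /(congr1 (fun u : 'rV[int]_(n + 1) => u 0 (rshift n 0))) := e; rewrite !row_mxEr !mxE => -[].
    apply/rowP => k; have /(congr1 (fun u : 'rV[int]_(n + 1) => ((u 0 (lshift 1 k))%:~R : rat))) := e.
    rewrite !row_mxEl !mxE !den_coord dd => /mulfI; apply.
    by rewrite pnatr_eq0 -lt0n den_gt0.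
  have bi y : y \in S -> (homog (iota y) *m invmx B) 0 i = (y == x)%:R.
    move=> yS; have [->|yx] := eqVneq y x; first by rewrite -iE -row_mul mulmxV// !mxE eqxx.
    have [l lE] := rE y yS; rewrite -lE -row_mul mulmxV// !mxE.
    have [li|//] := eqVneq l i; case/eqP: yx; apply: inj => //.
    by rewrite -lE li.
  have E : map_mx intr (a *m invmx B) = \sum_(y <- S) c y *: map_mx intr (homog (iota y) *m invmx B) :> 'rV[R]_(n + 1).
    rewrite map_mxM -[map_mx intr a]/(intv R a) -ca (tot_sub _ (simps_sub WS) Sc) mulmx_suml.
    by apply: eq_bigr => y _; rewrite -scalemxAl map_mxM.
  have -> : ((a *m invmx B) 0 i)%:~R = (map_mx intr (a *m invmx B) : 'rV[R]_(n + 1)) 0 i by rewrite [RHS]mxE.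
  rewrite E summxE (bigD1_seq x) ?fset_uniq//= big_seq_cond big1 ?addr0 => [|y /andP[yS yx]].
    by rewrite mxE [map_mx _ _ _ _]mxE bi// eqxx mulr1.
  by rewrite mxE [map_mx _ _ _ _]mxE bi// (negbTE yx) mulr0.
(* All real multiples of c - c' have integer coordinates. *)
have indep S (c c' : V -> R) : simps W S -> supported S c -> supported S c' ->
    tot W iota c = tot W iota c' -> c = c'.
  move=> WS Sc Sc' e; apply/funext => x; apply/eqP; rewrite -subr_eq0; apply/eqP.
  apply: contrapT => /eqP dx; pose k := (2 * (c x - c' x))^-1.
  have [||l] := SatS S (fun y => k * (c y + (- 1) * c' y)) 0 WS _ _ x.
  - by move=> y yS; rewrite Sc// Sc'// mulr0 addr0 mulr0.
  - by rewrite totZ totD totZ e scaleN1r subrr scaler0 /intv map_mx0.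
  rewrite mulN1r /k invfM -mulrA mulVf// mulr1 => l2.
  have l0 : 0 < l by rewrite -(ltr0z R) -l2 invr_gt0.
  have : (1 : R) <= 2^-1 by rewrite l2 ler1z.
  by lra.
split=> // c c' cc cc' e.
have [c0 [S WS Sc]] := cc; have [c'0 [S' WS' Sc']] := cc'.
have nz (b : V -> R) t x : tot W iota b = t *: lift1 x -> 0 < t -> (forall y, b y = 0) -> False.
  move=> bt t0 b0; have /(congr1 (fun u : 'rV[R]_(n + 1) => u 0 (rshift n 0))) := bt.
  rewrite [RHS]mxE row_mxEr mxE mulr1 /tot big1 ?mxE => [t00|y _]; last by rewrite b0 scale0r.
  by rewrite -t00 ltxx in t0.
have [cz|[t [x [t0 ct cx]]]] := ccone_point iota cc.
  have [c'z|[t' [x' [t'0 ct' _]]]] := ccone_point iota cc'.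
    by apply/funext => y; rewrite cz c'z.
  by case: (nz c t' x' _ t'0 cz); rewrite e.
have c'x : tot W iota (fun y => t^-1 * c' y) = lift1 x by rewrite totZ -e -totZ.
have ti : 0 <= t^-1 by rewrite invr_ge0 ltW.
have SD : D (iota @` S)%fset by rewrite DE; exists S.
have SD' : D (iota @` S')%fset by rewrite DE; exists S'.
(* The common point lies in a common face [F]. Independence in [S'] shows that the vertices where
   [c'] is nonzero belong to [F], hence to [S], and independence in [S] then compares [c] with
   [c']. *)
have [F [FS FS' FE]] := Dcap _ _ SD SD'.
have xF : chull R F x.
  rewrite -FE; split.
    apply/(chull_simp iota _ (simps_sub WS)).
    exists (fun y => t^-1 * c y); split=> // y; first by rewrite mulr_ge0.
    by move=> /Sc ->; rewrite mulr0.
  apply/(chull_simp iota _ (simps_sub WS')).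
  exists (fun y => t^-1 * c' y); split=> // y; first by rewrite mulr_ge0.
  by move=> /Sc' ->; rewrite mulr0.
have pull T : simps W T -> (F `<=` iota @` T)%fset -> exists2 T0, (T0 `<=` T)%fset & F = (iota @` T0)%fset.
  move=> WT FT; exists [fset y in T | iota y \in F]%fset.
    by apply/fsubsetP => y; rewrite !inE => /andP[].
  apply/fsetP => y; apply/idP/imfsetP => [yF|[z /= + ->]]; last by rewrite !inE => /andP[].
  have /imfsetP[z /= zT yz] := fsubsetP FT y yF.
  by exists z; rewrite // !inE /= zT -yz.
have coef T (b : V -> R) : simps W T -> (F `<=` iota @` T)%fset -> supported T b ->
    tot W iota b = lift1 x -> forall y, b y != 0 -> iota y \in F.
  move=> WT FT Tb bx y; have [T0 T0T FE'] := pull T WT FT.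
  have T0W := fsubset_trans T0T (simps_sub WT).
  move: xF; rewrite FE' => /(chull_simp iota _ T0W)[b' [b'0 T0b' b'x]] by0.
  have bE : b = b'.
    apply: (indep T) => //; last by rewrite bx.
    by move=> z zT; apply: T0b'; apply: contra zT; exact: fsubsetP.
  apply: in_imfset => /=; apply: contraNT by0 => /T0b'; rewrite bE => ->.
  by rewrite eqxx.
have scz T (b : V -> R) : supported T b -> supported T (fun y : V => t^-1 * b y).
  by move=> Tb y /Tb ->; rewrite mulr0.
have inS y : (fun y => t^-1 * c' y) y != 0 -> y \in S.
  move=> c'y; have yF := coef S' _ WS' FS' (scz _ _ Sc') c'x y c'y.
  have /imfsetP[z /= zS yz] := fsubsetP FS _ yF.
  have yS' : y \in S' by apply: contraNT c'y => /Sc' ->; rewrite mulr0.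
  suff -> : y = z by [].
  apply: iinj yz; first exact: (fsubsetP (simps_sub WS')).
  exact: (fsubsetP (simps_sub WS)).
have e' : (fun y => t^-1 * c y) = (fun y => t^-1 * c' y).
  apply: (indep S) => //; [exact: scz| |by rewrite cx].
  by move=> y; apply: contraNeq => /inS.
apply/funext => y; have := congr1 (@^~ y) e'; apply: mulfI.
by rewrite invr_eq0 gt_eqF.
Qed.
End Realizations.

Section GoodRealization.
Variables (R : realType) (V : choiceType) (W : wcomplex V) (n : nat).
Variables (iota : V -> 'rV[rat]_n) (D : set {fset 'rV[rat]_n}).
Hypothesis gD : good R W iota D.

(** A point of two simplexes has unique coordinates, supported in both vertex sets, so the two hulls
    meet in the hull of the common vertices. It is applied to the canonical realization. *)
Lemma good_realization : (forall S, simps W S -> regular_simplex (iota @` S)%fset) ->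
  (forall x, x \in verts W -> den (iota x) = weight W x) -> realization R D W iota.
Proof.
move=> reg denE; have [DE U _] := gD; split=> //.
- split; first by rewrite DE; exact/finite_image/simps_finite.
  + move=> T F; rewrite DE => -[S WS <-] FS.
    pose F0 := [fset x in S | iota x \in F]%fset.
    exists F0; first by apply: simps_down WS _; apply/fsubsetP => x; rewrite !inE => /andP[].
    apply/fsetP => y; apply/imfsetP/idP => [[x /= + ->]|yF]; first by rewrite !inE => /andP[].
    have /imfsetP[x /= xS yx] := fsubsetP FS y yF.
    by exists x; rewrite // !inE /= xS -yx.
  + move=> S' T'; rewrite DE => -[S WS <-] [T WT <-].
    exists (iota @` (S `&` T))%fset; split.
    * exact/subset_imfset/fsubsetP/fsubsetIl.
    * exact/subset_imfset/fsubsetP/fsubsetIr.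
    have WST : simps W (S `&` T)%fset by apply: simps_down WS _; exact: fsubsetIl.
    apply/seteqP; split=> x.
      move=> [/(chull_simp iota _ (simps_sub WS))[c [c0 Sc cx]]].
      move=> /(chull_simp iota _ (simps_sub WT))[c' [c'0 Tc' c'x]].
      have cc' : c = c' by apply: U; [split=> //; exists S|split=> //; exists T|rewrite cx].
      apply/(chull_simp iota _ (simps_sub WST)); exists c; split=> // y.
      by rewrite in_fsetI negb_and => /orP[/Sc//|]; rewrite cc' => /Tc'.
    move=> xST; split; apply: chull_sub xST => u /imfsetP[y /= + ->];
      by rewrite in_fsetI => /andP[yS yT]; apply: chull_vertex; exact: in_imfset.
  + by move=> T; rewrite DE => -[S WS <-]; exact: reg.
- split=> [x /= xW|x y /set_mem xW /set_mem yW|u [T DT uT]].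
  + exists (iota @` [fset x])%fset; last by apply: in_imfset; rewrite /= in_fset1.
    by rewrite DE; exists [fset x]%fset => //; exact: simps1.
  + exact: (good_inj gD).
  + move: DT; rewrite DE => -[S WS e]; rewrite -e in uT; have /imfsetP[x /= xS ->] := uT.
    by exists x => //; exact: (fsubsetP (simps_sub WS)).
- move=> S SW; rewrite DE; split=> [WS|[T WT e]]; first by exists S.
  by rewrite -(imfset_iota gD (simps_sub WT) SW e).
Qed.
End GoodRealization.

(** * Total orders *)

Section Deciding.
Variables (R : realType) (n : nat).
Implicit Types (P : nat -> set 'rV[R]_n) (a b : 'rV[int]_(n + 1)).

Definition decided_forms P : Prop := forall a, exists j,
  (forall x, P j x -> 0 <= ev a x) \/ (forall x, P j x -> ev a x <= 0).

Lemma exists_min_form (X : set 'rV[R]_n) (l : seq 'rV[int]_(n + 1)) : l != [::] ->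
  (forall a b, a \in l -> b \in l -> (forall x, X x -> ev a x <= ev b x) \/
    (forall x, X x -> ev b x <= ev a x)) ->
  exists2 a, a \in l & forall b, b \in l -> forall x, X x -> ev a x <= ev b x.
Proof.
elim: l => // a [|b l] ih _ tot.
  by exists a; rewrite ?mem_head// => b; rewrite inE => /eqP ->.
have [//|c d cl dl|m ml mP] := ih.
  by apply: tot; rewrite in_cons ?cl ?dl orbT.
have [le|le] := tot a m (mem_head _ _) (mem_behead (s := a :: _) ml); last first.
  exists m; first by rewrite in_cons ml orbT.
  by move=> c; rewrite in_cons => /predU1P[->//|]; exact: mP.
exists a; first by rewrite mem_head.
move=> c; rewrite in_cons => /predU1P[->//|/mP h] x Xx.
by apply: le_trans (le x Xx) (h x Xx).
Qed.

(* If the smallest of the forms that are nonnegative but not eventually zero is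
   positive at some point, then all of them are: this point plays the role of
   a generic point of P j. *)
Lemma decided_cover P (L : seq (seq 'rV[int]_(n + 1))) :
  (forall j, P j !=set0) -> (forall i j, (i <= j)%N -> P j `<=` P i) ->
  decided_forms P -> (forall x, P 0%N x -> exists2 t, t \in L & dual t (lift1 x)) ->
  exists j, exists2 t, t \in L & forall x, P j x -> dual t (lift1 x).
Proof.
move=> Pne Pdec dec cover.
pose F := flatten L ++ [seq - a | a <- flatten L].
have [|a aF|j0 j0P] := @ex_bound_seq _ (F ++ [seq b - a | a <- F, b <- F])
    (fun a j => (forall x, P j x -> 0 <= ev a x) \/ (forall x, P j x -> ev a x <= 0)).
- by move=> a j j' jj' [h|h]; [left|right] => x /(Pdec _ _ jj')/h.
- exact: dec.
have [|a aF|j1 j1P] := @ex_bound_seq _ F (fun a j =>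
    (exists i, forall x, P i x -> ev a x = 0) -> forall x, P j x -> ev a x = 0).
- by move=> a j j' jj' h /h{}h x /(Pdec _ _ jj')/h.
- have [[i iP]|ni] := pselect (exists i, forall x, P i x -> ev a x = 0).
    by exists i => _.
  by exists 0%N.
pose J := maxn j0 j1.
have PJ0 x : P J x -> P j0 x by apply: Pdec; exact: leq_maxl.
have PJ1 x : P J x -> P j1 x by apply: Pdec; exact: leq_maxr.
pose pos := [seq a <- F | `[< (forall x, P J x -> 0 <= ev a x) /\
   ~ exists i, forall x, P i x -> ev a x = 0 >]].
have posP a : a \in pos -> [/\ a \in F, forall x, P J x -> 0 <= ev a x &
    ~ exists i, forall x, P i x -> ev a x = 0].
  by rewrite mem_filter => /andP[/asboolP[? ?] ?].
have [x0 x0J x0P] : exists2 x0, P J x0 & forall a, a \in pos -> 0 < ev a x0.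
  have [p0|pn] := eqVneq pos [::].
    by have [x0 ?] := Pne J; exists x0 => // a; rewrite p0.
  have [a b /posP[aF _ _] /posP[bF _ _]|m mpos mP] := @exists_min_form (P J) pos pn.
    have [|h|h] := j0P (b - a).
      by rewrite mem_cat; apply/orP; right; apply/allpairsP; exists (a, b).
      by left => x /PJ0/h; rewrite evB subr_ge0.
    by right => x /PJ0/h; rewrite evB subr_le0.
  have [mF m0 mn] := posP m mpos.
  have [x0 x0J mx0] : exists2 x0, P J x0 & ev m x0 != 0.
    apply: contrapT => h; apply: mn; exists J => x Px; apply/eqP; apply: contrapT => /negP nz.
    by apply: h; exists x.
  exists x0 => // a /mP/(_ x0 x0J); apply: lt_le_trans.
  by rewrite lt_def mx0 m0.
(* Every form of the cell containing [x0] is nonnegative on [P J]: a nonpositive one that is not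
   eventually zero would have its opposite in [pos], and would be negative at [x0]. *)
have [t tL tx0] := cover x0 (Pdec _ _ (leq0n J) _ x0J).
exists J, t => // x Px; apply/dual_ev => a at_.
have aL : a \in flatten L by apply/flattenP; exists t.
have aF : a \in F by rewrite mem_cat aL.
have [|h|h] := j0P a; first by rewrite mem_cat aF.
  by apply: h; exact: PJ0.
have [ez|nz] := pselect (exists i, forall x, P i x -> ev a x = 0).
  by rewrite (j1P a aF ez)//; exact: PJ1.
suff /x0P : - a \in pos.
  by rewrite evN oppr_gt0 ltNge; move/dual_ev: tx0 => /(_ a at_) ->.
rewrite mem_filter; apply/andP; split; last first.
  by rewrite mem_cat; apply/orP; right; apply/mapP; exists a.
apply/asboolP; split=> [y /PJ0/h|[i iP]]; first by rewrite evN oppr_ge0.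
by apply: nz; exists i => y /iP/eqP; rewrite evN oppr_eq0 => /eqP.
Qed.

Lemma decided_decides P (A B : set 'rV[R]_n) :
  (forall j, P j !=set0) -> (forall i j, (i <= j)%N -> P j `<=` P i) ->
  decided_forms P -> rational_polyhedron A -> rational_polyhedron B ->
  P 0%N `<=` A `|` B -> exists j, P j `<=` A \/ P j `<=` B.
Proof.
move=> Pne Pdec dec [sA ->] [sB ->] cover.
have /choice[t tP] := @chull_dual R n.
have [x Px|j [t0 + tj]] := @decided_cover P [seq t T | T <- sA ++ sB] Pne Pdec dec.
  have [S SAB xS] : exists2 S, S \in sA ++ sB & chull R S x.
    by case: (cover x Px) => -[S /= SA xS]; exists S; rewrite // mem_cat SA ?orbT.
  by exists (t S); [exact: map_f|exact/tP].
move=> /mapP[S]; rewrite mem_cat => SAB t0E; exists j.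
have PS : P j `<=` chull R S by move=> x /tj; rewrite t0E => /tP.
by case/orP: SAB => SAB; [left|right] => x /PS xS; exists S.
Qed.
End Deciding.

Section TotalOrder.
Variables (R : realType) (V : choiceType).
Variables (W : nat -> wcomplex V) (s : nat -> stellar_move V) (hW : stellar W s).

(** The analogue of [decided_forms] on the cone over [W 0], a form being given by its integer values
    [q] at the vertices. A realization yields, through [coord_form], in general only some of these
    [q]. *)
Definition decided_coords : Prop := forall q : V -> int, exists j,
  (forall c, ccone (W j) c -> 0 <= \sum_(v <- verts (W 0%N)) rhos s j c v * (q v)%:~R :> R) \/
  (forall c, ccone (W j) c -> \sum_(v <- verts (W 0%N)) rhos s j c v * (q v)%:~R <= 0 :> R).

Section Realization.
Variables (n : nat) (iota : V -> 'rV[rat]_n) (D : set {fset 'rV[rat]_n}).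
Hypothesis gD : good R (W 0%N) iota D.
Let P j : set 'rV[R]_n := csupport R (realized_complex R s D iota j).

Lemma orbit_ne j : P j !=set0.
Proof.
have [v vW] := fset0Pn _ (verts_neq0 (W j)).
have gj := good_realize hW gD j.
exists (pt R ((realize R s D iota j).2 v)).
exists ((realize R s D iota j).2 @` [fset v])%fset.
  by have [DE _ _] := gj; rewrite /mkset /realized_complex DE; exists [fset v]%fset => //; exact: simps1.
by apply: chull_vertex; apply: in_imfset; rewrite /= in_fset1.
Qed.

Lemma orbit_dec i j : (i <= j)%N -> P j `<=` P i.
Proof. exact: support_realize_le. Qed.

Lemma orbit_polyhedron j : rational_polyhedron (P j).
Proof.
have [DE _ _] := good_realize hW gD j.
have /finite_seqP[l lE] : finite_set (realized_complex R s D iota j).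
  by rewrite /realized_complex DE; exact/finite_image/simps_finite.
by exists l; rewrite /P /csupport lE.
Qed.

Definition coord_form (a : 'rV[int]_(n + 1)) (v : V) : int := \sum_i a 0 i * homog (iota v) 0 i.

Lemma dot_tot a (c : V -> R) :
  dot (intv R a) (tot (W 0%N) iota c) =
  \sum_(v <- verts (W 0%N)) c v * (coord_form a v)%:~R.
Proof. by rewrite dot_sumr; apply: eq_bigr => v _; rewrite dotZr dot_intv. Qed.

Lemma decided_coords_forms : decided_coords -> decided_forms P.
Proof.
move=> dec a; have [j jP] := dec (coord_form a); exists j.
have E x : P j x -> exists2 c, ccone (W j) c &
    ev a x = \sum_(v <- verts (W 0%N)) rhos s j c v * (coord_form a v)%:~R.
  by move=> /(realize_supportP hW gD)[c cc cx]; exists c => //; rewrite /ev -cx dot_tot.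
by case: jP => h; [left|right] => x /E[c cc ->]; exact: h.
Qed.

(** The form has to induce [q] only at the vertices that carry the points of some [P i], since all
    later supports lie in [P i]. *)
Lemma decided_coords_of_form (q : V -> int) a i :
  decided_forms P ->
  (forall c, ccone (W 0%N) c -> (exists x, P i x /\ tot (W 0%N) iota c = lift1 x) ->
    forall v, v \in verts (W 0%N) -> c v != 0 -> coord_form a v = q v) ->
  exists j,
  (forall c, ccone (W j) c -> 0 <= \sum_(v <- verts (W 0%N)) rhos s j c v * (q v)%:~R :> R) \/
  (forall c, ccone (W j) c -> \sum_(v <- verts (W 0%N)) rhos s j c v * (q v)%:~R <= 0 :> R).
Proof.
move=> dec aq; have [j jP] := dec a; pose J := maxn i j.
have E c : ccone (W J) c -> exists t x, [/\ 0 <= t, P j x &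
    \sum_(v <- verts (W 0%N)) rhos s J c v * (q v)%:~R = t * ev a x :> R].
  move=> cc; have [rc rE] := rhos_tot hW gD cc.
  have [z|[t [x [t0 tx t1x]]]] := ccone_point iota rc.
    have [x Px] := orbit_ne j; exists 0, x; split=> //.
    by rewrite mul0r big1// => v _; rewrite z mul0r.
  have PJ : P J x.
    apply/(realize_supportP hW gD); exists (fun v => t^-1 * c v).
      by apply: cconeZ => //; rewrite invr_ge0 ltW.
    have cc' : ccone (W J) (fun v => t^-1 * c v) by apply: cconeZ; rewrite ?invr_ge0 ?ltW.
    by have [_ <-] := rhos_tot hW gD cc'; rewrite totZ rE -totZ.
  exists t, x; split; [exact: ltW|by apply: orbit_dec PJ; exact: leq_maxr|].
  rewrite /ev -dotZr -tx dot_tot; apply: eq_big_seq => v vW.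
  have [->|cv] := eqVneq (rhos s J c v) 0; first by rewrite !mul0r.
  rewrite (aq (fun v => t^-1 * rhos s J c v))//.
  - by apply: cconeZ; rewrite ?invr_ge0 ?ltW.
  - by exists x; split=> //; apply: orbit_dec PJ; exact: leq_maxl.
  - by rewrite mulf_neq0// invr_eq0 gt_eqF.
by exists J; case: jP => h; [left|right] => c /E[t [x [t0 /h hx ->]]];
  [rewrite mulr_ge0|rewrite mulr_ge0_le0].
Qed.

Lemma decides_decided : (P 0%N `<=` cube R n) ->
  orbit_decides_covers R s D iota -> decided_forms P.
Proof.
move=> P0 dec a.
have aux b : rational_polyhedron [set x : 'rV[R]_n | cube R n x /\ ext (aff R b) x <= 0].
  exact: le0_polyhedron.
have [|j [h|h]] := dec _ _ (aux a) (aux (- a)).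
- apply/seteqP; split=> x; first by case=> [[]|[]].
  move=> cx; have [le|/ltW le] := leP (ext (aff R a) x) 0; [by left|right; split=> //].
  by move: le; rewrite !ext_aff// evN oppr_le0.
- by exists j; right => x /h[cx]; rewrite ext_aff.
- by exists j; left => x /h[cx]; rewrite ext_aff// evN oppr_le0.
Qed.

Lemma decided_orbit : (P 0%N `<=` cube R n) -> decided_forms P ->
  orbit_decides_covers R s D iota.
Proof.
move=> P0 dec A B pA pB AB.
apply: (decided_decides orbit_ne orbit_dec dec pA pB).
by rewrite AB.
Qed.

End Realization.

(** The simplexes of the initial complex cover [P 0], so [decided_cover] confines some [P i] to one
    of them. Its regularity provides an integer form with the values [q] at its vertices. *)
Lemma realization_decided n (iota : V -> 'rV[rat]_n) D :
  realization R D (W 0%N) iota ->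
  decided_forms (fun j => csupport R (realized_complex R s D iota j)) -> decided_coords.
Proof.
move=> rD dec q; have gD := realization_good rD.
have [[Dfin _ _ Dreg] _ _ _] := rD; have [DE U _] := gD.
have /finite_seqP[l lE] := Dfin.
have /choice[t tP] := @chull_dual R n.
have [x [S DS xS]|i [t0 + ti]] :=
    decided_cover (L := [seq t T | T <- l]) (orbit_ne gD) (orbit_dec (D := D)) dec.
  exists (t S); last exact/tP.
  by apply: map_f; have : D S by []; rewrite lE.
move=> /mapP[T Tl t0E]; have DT : D T by rewrite lE.
have [B uB rowB] := Dreg T DT.
move: DT; rewrite DE => -[S WS ST].
have rE v : v \in S -> exists k, row k B = homog (iota v).
  by move=> vS; apply: rowB; rewrite -ST in_imfset.
have hinj v w : v \in S -> w \in S -> homog (iota v) = homog (iota w) -> v = w.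
  move=> vS wS e; have [vW wW] : v \in verts (W 0%N) /\ w \in verts (W 0%N).
    by split; exact: (fsubsetP (simps_sub WS)).
  have /(congr1 (@^~ w)) : delta R v = delta R w.
    by apply: U; rewrite ?tot_delta ?/hz ?e//; exact: ccone_delta.
  by rewrite /delta eqxx; case: (w =P v) => // _ /eqP; rewrite eq_sym oner_eq0.
have /choice[z zP] : forall k : 'I_(n + 1), exists z : int,
    forall v, v \in S -> row k B = homog (iota v) -> z = q v.
  move=> k; have [[v vS vk]|nv] := pselect (exists2 v, v \in S & row k B = homog (iota v)).
    by exists (q v) => w wS wk; rewrite (hinj v w)// -vk -wk.
  by exists 0 => w wS wk; case: nv; exists w.
(* The integer form with values [z] on the rows of the basis [B]; these values extend [q] from the
   vertices of the simplex. *)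
pose a := ((invmx B) *m (\col_k z k))^T.
have aq v : v \in S -> coord_form iota a v = q v.
  move=> vS; have [k kE] := rE v vS; rewrite -(zP k v vS kE).
  have /matrixP/(_ k 0) : B *m (invmx B *m \col_k z k) = \col_k z k by rewrite mulKVmx.
  rewrite [RHS]mxE => <-; rewrite mxE; apply: eq_bigr => l' _.
  by rewrite [a 0 l']mxE mulrC; congr (_ * _); rewrite -kE mxE.
apply: (decided_coords_of_form gD dec (a := a) (i := i)) => c cc [x [Px cx]] v vW cv.
apply: aq; apply: contraNT cv => vS; apply/eqP.
have : chull R (iota @` S)%fset x by rewrite ST; apply/tP; rewrite -t0E; exact: ti.
by move=> /(good_chull gD WS cc cx); apply.
Qed.

End TotalOrder.

(** * The unital l-group of a stellar sequence *)

Section StellarGroup.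
Variables (R : realType) (V : choiceType).
Variables (W : nat -> wcomplex V) (s : nat -> stellar_move V) (hW : stellar W s).
Variables (n : nat) (iota : V -> 'rV[rat]_n) (D : set {fset 'rV[rat]_n}).
Hypothesis gD : good R (W 0%N) iota D.
Let P j : set 'rV[R]_n := csupport R (realized_complex R s D iota j).
Hypothesis P0_cube : P 0%N `<=` cube R n.
Let p := realize R s D iota.
Let hI : convex_lsubgroup (germ_ideal P) := stellar_ideal_convex R s D iota.
Let G : ulGroupType := lquot hI.
Let K : set 'rV[R]_n := \bigcap_j P j.
Let gj j : good R (W j) (p j).2 (p j).1 := good_realize hW gD j.
Let P_poly := orbit_polyhedron hW gD.
Let P_ne := orbit_ne hW gD.
Let P_dec : forall i j, (i <= j)%N -> P j `<=` P i := @orbit_dec _ _ s _ iota D.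

Lemma orbit_cube j : P j `<=` cube R n.
Proof. by apply: subset_trans P0_cube; exact: P_dec. Qed.
Let P_cube := orbit_cube.

Lemma orbitE j x : P j x <-> exists2 S, simps (W j) S & chull R ((p j).2 @` S)%fset x.
Proof.
have [DE _ _] := gj j; rewrite /P /csupport /realized_complex -/p DE.
split=> [[_ [S WS <-] xS]|[S WS xS]]; first by exists S.
by exists ((p j).2 @` S)%fset => //; exists S.
Qed.

Lemma orbit_const i : (forall j, (i <= j)%N -> ~ is_deletion (s j)) ->
  forall j, (i <= j)%N -> P j = P i.
Proof.
move=> nd; elim=> [|j ih]; first by rewrite leqn0 => /eqP ->.
rewrite leq_eqVlt => /predU1P[->//|]; rewrite ltnS => ij; rewrite -ih//.
by rewrite /P /realized_complex (realize_support hW gD)//; exact: nd.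
Qed.

Lemma finite_deletions_bound : finite_set [set j | is_deletion (s j)] <->
  exists N, forall j, (N <= j)%N -> ~ is_deletion (s j).
Proof.
split=> [/finite_seqP[l lE]|[N NP]].
  exists (\max_(i <- l) i).+1 => j; rewrite ltnNge => /negP jl dj; apply: jl.
  have jl : j \in l by have : [set j | is_deletion (s j)] j by []; rewrite lE.
  exact: leq_bigmax_seq.
apply: (@sub_finite_set _ _ `I_N); last exact: finite_II.
by move=> j /= dj; rewrite ltnNge; apply/negP => /NP.
Qed.

Lemma fin_gen_deletions : fin_gen_lideal (germ_ideal P) <->
  finite_set [set j | is_deletion (s j)].
Proof.
rewrite (fin_gen_iff P_poly P_cube P_dec hI) finite_deletions_bound.
split=> -[N NP]; exists N; last exact: orbit_const.
move=> j Nj /(realize_deletion hW gD); apply.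
exact: (etrans (NP j.+1 (leqW Nj)) (esym (NP j Nj))).
Qed.

Lemma coordinates j S x : simps (W j) S -> chull R ((p j).2 @` S)%fset x ->
  exists2 c : V -> R, ccone (W j) c /\ tot (W j) (p j).2 c = lift1 x & supported S c.
Proof.
move=> WS /(chull_simp _ _ (simps_sub WS))[c [c0 Sc cx]].
by exists c => //; split=> //; split=> //; exists S.
Qed.

Lemma unique_coordinates j x (c c' : V -> R) :
  ccone (W j) c -> ccone (W j) c' -> tot (W j) (p j).2 c = lift1 x ->
  tot (W j) (p j).2 c' = lift1 x -> c = c'.
Proof.
by move=> cc cc' cx c'x; have [_ U _] := gj j; apply: U cc cc' _; rewrite c'x.
Qed.

Lemma coordinates_neq0 j x (c : V -> R) : tot (W j) (p j).2 c = lift1 x ->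
  exists v, c v != 0.
Proof.
move=> cx; apply: contrapT => /forallNP h.
have /(congr1 (fun u : 'rV[R]_(n + 1) => u 0 (rshift n 0))) := cx.
rewrite row_mxEr [RHS]mxE /tot big1 ?mxE => [/eqP|v _]; first by rewrite eq_sym oner_eq0.
by have /negP := h v; rewrite negbK => /eqP ->; rewrite scale0r.
Qed.

Lemma vertex_coordinate j x (c : V -> R) v : v \in verts (W j) ->
  tot (W j) (p j).2 c = lift1 x -> (forall w, w != v -> c w = 0) -> x = pt R ((p j).2 v).
Proof.
move=> vW cx cv.
have E : c = fun w => c v * delta R v w.
  apply/funext => w; rewrite /delta; case: eqP => [->|/eqP/cv ->]; by rewrite ?mulr1 ?mulr0.
move: cx; rewrite E totZ tot_delta// /hz intv_homog scalerA => e.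
have /(congr1 (fun u : 'rV[R]_(n + 1) => u 0 (rshift n 0))) := e.
rewrite [LHS]mxE !row_mxEr !mxE mulr1 => e1.
by apply: lift_inj; rewrite -e e1 scale1r.
Qed.

(** After the last deletion [P i] equals [K], so three vertices of a simplex span a triangle in [K].
    By uniqueness of coordinates its three edges have no common point. *)
Lemma dim_le1_simps : fin_gen_lideal (germ_ideal P) -> covering_dim_le (maxspec G) 1 ->
  exists N, forall i, (N <= i)%N -> forall S, simps (W i) S -> (#|` S| <= 2)%N.
Proof.
move=> /fin_gen_deletions/finite_deletions_bound[N nd] dim1; exists N => i Ni S WS.
rewrite leqNgt; apply/negP => S3.
have Pi j : P i `<=` P j.
  have [ji|ij] := leqP j i; first exact: P_dec.
  have nd' l : (i <= l)%N -> ~ is_deletion (s l) by move=> il; apply: nd; exact: leq_trans il.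
  by rewrite (orbit_const nd' (ltnW ij)).
have [v0 [v1 [v2 [v0S v1S v2S [d01 d02 d12]]]]] : exists v0 v1 v2,
    [/\ v0 \in S, v1 \in S, v2 \in S & [/\ v0 != v1, v0 != v2 & v1 != v2]].
  have := fset_uniq S; have memS x : (x \in S) = (x \in (S : seq V)) by [].
  case E : (S : seq V) S3 => [|v0 [|v1 [|v2 l]]] //= _.
  rewrite !inE !negb_or => /and4P[/and3P[d01 d02 _] /andP[d12 _] _ _].
  by exists v0, v1, v2; rewrite !memS E !inE !eqxx !orbT.
have iS A : (A `<=` S)%fset -> simps (W i) A by exact: simps_down.
have sub2 x y : x \in S -> y \in S -> simps (W i) [fset x; y]%fset.
  by move=> xS yS; apply: iS; rewrite fsubUset !fsub1set xS.
apply: (covering_dim_gt1 P_poly P_cube P_dec (p0 := (p i).2 v0) (p1 := (p i).2 v1)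
    (p2 := (p i).2 v2) _ _ dim1).
  move=> x xT j _; apply: Pi; apply/orbitE; exists S => //; apply: chull_sub xT => u.
  by rewrite !inE => /orP[/orP[]|] /eqP ->; apply: chull_vertex; exact: in_imfset.
move=> x; rewrite -!imfset_fset2.
move=> /(coordinates (sub2 _ _ v1S v2S))[c0 [cc0 c0x] S0].
move=> /(coordinates (sub2 _ _ v0S v2S))[c1 [cc1 c1x] S1].
move=> /(coordinates (sub2 _ _ v0S v1S))[c2 [cc2 c2x] S2].
have e1 : c1 = c0 by exact: unique_coordinates cc1 cc0 c1x c0x.
have e2 : c2 = c0 by exact: unique_coordinates cc2 cc0 c2x c0x.
have [u cu] := coordinates_neq0 c0x.
have u0 : u \in [fset v1; v2]%fset by apply: contraNT cu => /S0 ->.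
have u1 : u \in [fset v0; v2]%fset by apply: contraNT cu => /S1; rewrite e1 => ->.
have u2 : u \in [fset v0; v1]%fset by apply: contraNT cu => /S2; rewrite e2 => ->.
move: u0 u1 u2; rewrite !inE => /orP[]/eqP ->.
  by rewrite eq_sym (negbTE d01) (negbTE d12).
by rewrite (eq_sym v2) (negbTE d02) eq_sym (negbTE d12).
Qed.

Lemma simps_dim_le1 : finite_set [set j | is_deletion (s j)] ->
  (exists N, forall i, (N <= i)%N -> forall S, simps (W i) S -> (#|` S| <= 2)%N) ->
  covering_dim_le (maxspec G) 1.
Proof.
move=> /finite_deletions_bound[N1 nd] [N2 S2]; pose i := maxn N1 N2.
have nd' l : (i <= l)%N -> ~ is_deletion (s l) by move=> il; apply: nd; apply: leq_trans il; exact: leq_maxl.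
have S2' := S2 i (leq_maxr _ _).
have KE x : K x <-> P i x.
  split=> [|Px j _]; first exact.
  by have [ji|ij] := leqP j i; [exact: P_dec Px|rewrite (orbit_const nd' (ltnW ij))].
have [v0 v0W] := fset0Pn _ (verts_neq0 (W i)).
have /finite_seqP[l lE] := simps_finite (W i).
have lP S : S \in l <-> simps (W i) S by rewrite lE.
(* A singleton yields a degenerate segment, so that isolated vertices are covered as well. *)
pose e (S : {fset V}) := ((p i).2 (head v0 S), (p i).2 (last v0 S)).
have eS S : simps (W i) S -> S != fset0 -> S = [fset head v0 S; last v0 S]%fset.
  move=> WS S0; have := S2' S WS; have memS x : (x \in S) = (x \in (S : seq V)) by [].
  move=> Sle; apply/fsetP => x; rewrite memS !inE.
  case E : (S : seq V) Sle => [|a [|b [|d l']]] //=.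
  - by case/eqP: S0; apply/fsetP => y; rewrite memS E.
  - by rewrite inE orbb.
  - by rewrite !inE.
have chE S : simps (W i) S -> S != fset0 ->
    [fset (e S).1; (e S).2]%fset = ((p i).2 @` S)%fset.
  by move=> WS S0; rewrite [in RHS](eS S WS S0) imfset_fset2.
apply: (covering_dim_le1 P_poly P_cube P_dec (E := [seq e T | T <- l & T != fset0])).
  move=> x; rewrite -/K KE orbitE; split=> [[S WS xS]|[e0 /mapP[S]]].
    have S0 : S != fset0.
      by apply: contraPneq xS => ->; rewrite imfset0 => -[c [_ /eqP]]; rewrite big_nil eq_sym oner_eq0.
    exists (e S); last by rewrite chE.
    by apply/mapP; exists S => //; rewrite mem_filter S0; exact/lP.
  by rewrite mem_filter => /andP[S0 /lP WS] ->; rewrite chE// => xS; exists S.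
move=> e1 e2 x /mapP[S + ->] /mapP[T + ->]; rewrite !mem_filter => /andP[S0 /lP WS] /andP[T0 /lP WT].
move=> eST; have ST : S <> T by move=> ST; case/eqP: eST; rewrite ST.
rewrite !chE// => /(coordinates WS)[c [cc cx] Sc] /(coordinates WT)[c' [cc' c'x] Tc'].
have cc'E : c = c' by exact: unique_coordinates cc cc' cx c'x.
(* If [S] is not inside [T], the coordinate of [x] at a vertex outside [T] is 0 and [x] is the other
   end of the segment. If it is, [S] is a singleton, as [T] has at most two elements. *)
have ninT : exists2 y, y \in S & c y = 0 \/ S = [fset y]%fset.
  have [ST'|nST] := boolP (S `<=` T)%fset; last first.
    have /fsubsetPn[y yS yT] := nST.
    by exists y => //; left; rewrite cc'E Tc'.
  have SpT : (S `<` T)%fset by rewrite fproperEneq ST' andbT; apply/eqP.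
  have S1 : (#|` S| <= 1)%N.
    by rewrite -ltnS; apply: leq_trans (fproper_ltn_card SpT) (S2' T WT).
  have [y yS] := fset0Pn _ S0; exists y => //; right; apply/eqP.
  by rewrite eq_sym eqEfcard fsub1set yS cardfs1.
have eSE := eS S WS S0.
have [hS lS] : head v0 S \in verts (W i) /\ last v0 S \in verts (W i).
  by split; apply: (fsubsetP (simps_sub WS)); rewrite [X in _ \in X]eSE !inE eqxx ?orbT.
have off w : w != head v0 S -> w != last v0 S -> c w = 0.
  by move=> wh wl; apply: Sc; rewrite eSE !inE negb_or wh.
have [y + [cy|Sy]] := ninT; rewrite {1}eSE !inE => /orP[/eqP yE|/eqP yE].
- right; apply: vertex_coordinate cx _ => // w wl.
  by have [->|wh] := eqVneq w (head v0 S); [rewrite -yE|exact: off].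
- left; apply: vertex_coordinate cx _ => // w wl.
  by have [->|wh] := eqVneq w (last v0 S); [rewrite -yE|exact: off].
- left; apply: vertex_coordinate cx _ => // w wl; apply: Sc.
  by rewrite Sy inE yE.
- right; apply: vertex_coordinate cx _ => // w wl; apply: Sc.
  by rewrite Sy inE yE.
Qed.

Lemma simplicial_singletons : simplicial_ulg G ->
  exists N, forall i, (N <= i)%N ->
    forall S, simps (W i) S -> S <> fset0 -> exists x, S = [fset x]%fset.
Proof.
move=> /(simplicial_grid P_poly P_cube P_dec)[N N0 [j jN]]; exists j => i ji S WS /eqP S0.
have [x xS] := fset0Pn _ S0; exists x; apply/eqP; rewrite eq_sym eqEfsubset fsub1set xS /=.
apply/fsubsetP => y yS; rewrite inE; apply: contrapT => /negP yx.
have vW z : z \in S -> z \in verts (W i) by exact: (fsubsetP (simps_sub WS)).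
have [l lxy] : exists l, pt R ((p i).2 x) 0 l != pt R ((p i).2 y) 0 l.
  apply: contrapT => /forallNP h; case/eqP: yx; apply/esym/(good_inj (gj i)); rewrite ?vW//.
  by apply: (@pt_inj R n); apply/rowP => l; have /negP := h l; rewrite negbK => /eqP.
set u := pt R ((p i).2 x) in lxy *; set w := pt R ((p i).2 y) in lxy *.
have grid (t : R) : 0 <= t <= 1 -> on_grid N (u + t *: (w - u)).
  move=> t01; apply: jN; apply: (P_dec ji); apply/orbitE; exists [fset x; y]%fset.
    by apply: simps_down WS _; rewrite fsubUset !fsub1set xS.
  by rewrite imfset_fset2; apply/chull2; exists t.
have z01 : 0 <= (0 : R) <= 1 by rewrite lexx ler01.
have [k0 k0E] := grid 0 z01 l.
pose d := w 0 l - u 0 l; have d0 : d != 0 by rewrite subr_eq0 eq_sym.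
(* Along this step [N] times the coordinate changes by [d / (|d| + 1)], nonzero and below 1 in
   absolute value, although both ends lie on the grid. *)
pose t := (N%:R * (`|d| + 1))^-1.
have N0' : (0 : R) < N%:R by rewrite ltr0n.
have d1 : 0 < `|d| + 1 by rewrite ltr_wpDl.
have t0 : 0 < t by rewrite invr_gt0 mulr_gt0.
have t1 : t <= 1.
  by rewrite invf_le1 ?mulr_gt0// mulr_ege1 ?ler1n// lerDr.
have t01 : 0 <= t <= 1 by rewrite ltW.
have [k1 k1E] := grid t t01 l.
have E : (k1 - k0)%:~R = d / (`|d| + 1) :> R.
  have comb r : (u + r *: (w - u)) 0 l = u 0 l + r * d by rewrite /d !mxE.
  rewrite rmorphB /= -k1E -k0E !comb /t; field.
  by rewrite !gt_eqF.
have : `|(k1 - k0)%:~R : R| < 1.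
  by rewrite E normrM normfV (ger0_norm (ltW d1)) ltr_pdivrMr// mul1r ltrDl.
rewrite -intr_norm ltrz1 => k1k0.
have kk : k1 - k0 = 0.
  by apply/eqP; rewrite -normr_eq0 eq_le normr_ge0 andbT -ltzD1 add0r.
move: E; rewrite kk => /esym/eqP; rewrite mulf_eq0 (negbTE d0) invr_eq0 gt_eqF//.
Qed.

(** No edge is left to subdivide, so the number of vertices never grows and each deletion lowers it.
    From a step where it is least there are no deletions, and the support stays a fixed finite
    set. *)
Lemma singletons_simplicial : (exists N, forall i, (N <= i)%N ->
    forall S, simps (W i) S -> S <> fset0 -> exists x, S = [fset x]%fset) ->
  simplicial_ulg G.
Proof.
move=> [N0 S1].
have [N NN0 nd] : exists2 N, (N0 <= N)%N & forall i, (N <= i)%N -> ~ is_deletion (s i).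
  have step i : (N0 <= i)%N -> (#|` verts (W i.+1)| <= #|` verts (W i)|)%N /\
      (is_deletion (s i) -> (#|` verts (W i.+1)| < #|` verts (W i)|)%N).
    move=> Ni; have := hW i; case: (s i) => [|M|v w a] /=.
    - by move=> [-> _ _]; split=> // -[].
    - move=> [WM Mmax -> _ _].
      have [v vW] := fset0Pn _ (verts_neq0 (W i)).
      have M0 : M <> fset0.
        move=> M0; have /fsetP/(_ v) : [fset v]%fset = M by apply: Mmax; rewrite ?M0 ?fsub0set//; exact: simps1.
        by rewrite M0 !inE eqxx.
      have [x ME] := S1 i Ni M WM M0.
      have xW : x \in verts (W i) by apply: (fsubsetP (simps_sub WM)); rewrite ME inE.
      have lt : (#|` (verts (W i) `\` [fset x])%fset| < #|` verts (W i)|)%N by rewrite [in X in (_ < X)%N](cardfsD1 x) xW.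
      by rewrite ME cardfs1 eqxx; split=> //; exact: ltnW.
    - move=> [[vw Wvw _] _]; have [|x xE] := S1 i Ni _ Wvw.
        by move=> /fsetP/(_ v); rewrite !inE eqxx.
      have /fsetP/(_ v) := xE; have /fsetP/(_ w) := xE; rewrite !inE !eqxx orbT.
      by move=> /esym/eqP wx /esym/eqP vx; rewrite wx vx eqxx in vw.
  have mono i j : (N0 <= i)%N -> (i <= j)%N -> (#|` verts (W j)| <= #|` verts (W i)|)%N.
    move=> Ni; elim: j => [|j ih]; first by rewrite leqn0 => /eqP ->.
    rewrite leq_eqVlt => /predU1P[->//|ij]; apply: leq_trans (ih ij).
    by have [] := step j (leq_trans Ni ij).
  have ex : exists m, `[< exists2 i, (N0 <= i)%N & #|` verts (W i)| = m >].
    by exists #|` verts (W N0)|; apply/asboolP; exists N0.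
  case: (ex_minnP ex) => m /asboolP[N NN0 Nm] mmin.
  exists N => // i Ni /(step i (leq_trans NN0 Ni)).2; rewrite ltnNge => /negP; apply.
  apply: leq_trans (mono N i NN0 Ni) _; rewrite Nm; apply: mmin; apply/asboolP.
  by exists i.+1; rewrite // leqW// (leq_trans NN0).
have S1' := S1 N NN0.
apply: (simplicial_finite P_cube P_dec hI (N := N) (s := [seq (p N).2 x | x <- verts (W N)])).
  exact: orbit_const.
move=> x; rewrite orbitE; split=> [[S WS xS]|[u /mapP[y yW ->] ->]]; last first.
  by exists [fset y]%fset; [exact: simps1|rewrite imfset_fset1; exact/chull1].
have S0 : S <> fset0.
  by move=> S0; move: xS; rewrite S0 imfset0 => -[c [_ /eqP]]; rewrite big_nil eq_sym oner_eq0.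
have [y Sy] := S1' S WS S0; exists ((p N).2 y).
  by apply: map_f; apply: (fsubsetP (simps_sub WS)); rewrite Sy inE.
by move: xS; rewrite Sy imfset_fset1 => /chull1.
Qed.

Lemma orbit_bigcap : \bigcap_(Q in stellar_orbit R s D iota) Q = K.
Proof.
apply/seteqP; split=> x h; first by move=> j _; apply: h; exists j.
by move=> _ [j _ <-]; exact: h.
Qed.

Lemma orbit_exists (Q : set 'rV[R]_n) :
  (exists2 A, stellar_orbit R s D iota A & A `<=` Q) <-> exists j, P j `<=` Q.
Proof.
by split=> [[_ [j _ <-] AQ]|[j jQ]]; [exists j|exists (P j) => //; exists j].
Qed.

Lemma stellar_archimedean : archimedean_ulg G <->
  forall Q : set 'rV[R]_n, rational_polyhedron Q ->
    \bigcap_(A in stellar_orbit R s D iota) A `<=` Q ->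
    exists2 A, stellar_orbit R s D iota A & A `<=` Q.
Proof.
rewrite orbit_bigcap (archimedean_iff P_poly P_cube P_dec hI).
by split=> h Q rQ KQ; apply/orbit_exists; exact: h.
Qed.

Lemma stellar_local : local_ulg G <->
  exists z, \bigcap_(A in stellar_orbit R s D iota) A = [set z].
Proof. by rewrite orbit_bigcap; exact: local_iff. Qed.

Lemma stellar_subreal : ulisomorphic_to_ulsubgroup G R <->
  exists z, \bigcap_(A in stellar_orbit R s D iota) A = [set z] /\
    forall Q : set 'rV[R]_n, rational_polyhedron Q -> Q z ->
      exists2 A, stellar_orbit R s D iota A & A `<=` Q.
Proof.
rewrite orbit_bigcap (subreal_iff P_poly P_cube P_ne P_dec hI).
split=> -[z [Kz h]]; exists z; split=> // Q rQ Qz; apply/orbit_exists; exact: h.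
Qed.

Lemma stellar_total : totally_ordered_ulg G <-> decided_forms P.
Proof. exact: total_iff. Qed.

End StellarGroup.

Theorem theorem7p1 (R : realType) (V : choiceType)
    (W : nat -> wcomplex V) (s : nat -> stellar_move V) (hW : stellar W s)
    (n : nat) (v : n.-tuple V) (v_uniq : uniq v)
    (v_verts : verts (W 0%N) =i v) :
  let D0 := canonical_complex (W 0%N) v in
  let iota0 := canonical_iota (W 0%N) v in
  let O : set (set 'rV[R]_n) := stellar_orbit R s D0 iota0 in
  let I : set (mcn R n) := stellar_ideal R s D0 iota0 in
  let G : ulGroupType := stellar_group R s D0 iota0 in
  let finitely_many_deletions := finite_set [set j | is_deletion (s j)] in
           
  (fin_gen_lideal I <-> finitely_many_deletions) /\
           
  (fin_gen_lideal I /\ covering_dim_le (maxspec G) 1 <->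
    finitely_many_deletions /\
    exists N, forall i, (N <= i)%N ->
      forall S, simps (W i) S -> (#|` S| <= 2)%N) /\
           
  (simplicial_ulg G <->
    exists N, forall i, (N <= i)%N ->
      forall S, simps (W i) S -> S <> fset0 -> exists x, S = [fset x]%fset) /\
           
  (archimedean_ulg G <->
    forall P : set 'rV[R]_n, rational_polyhedron P ->
      \bigcap_(Q in O) Q `<=` P -> exists2 Q, O Q & Q `<=` P) /\
           
  (local_ulg G <-> exists z, \bigcap_(Q in O) Q = [set z]) /\
           
  (ulisomorphic_to_ulsubgroup G R <->
    exists z, \bigcap_(Q in O) Q = [set z] /\
      forall P : set 'rV[R]_n, rational_polyhedron P -> P z ->
        exists2 Q, O Q & Q `<=` P) /\
           
  ((totally_ordered_ulg G <->
      exists (m : nat) (nabla : set {fset 'rV[rat]_m}) (iota : V -> 'rV[rat]_m),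
        [/\ realization R nabla (W 0%N) iota, csupport R nabla `<=` cube R m &
            orbit_decides_covers R s nabla iota]) /\
   (totally_ordered_ulg G <->
      forall (m : nat) (nabla : set {fset 'rV[rat]_m}) (iota : V -> 'rV[rat]_m),
        realization R nabla (W 0%N) iota -> csupport R nabla `<=` cube R m ->
        orbit_decides_covers R s nabla iota)).
Proof.
move=> D0 iota0 O I G finitely_many_deletions.
have gD : good R (W 0%N) iota0 D0 := canonical_good R v_uniq v_verts.
have cub : csupport R (realized_complex R s D0 iota0 0) `<=` cube R n.
  exact: canonical_cube v_uniq v_verts.
have fin_gen := fin_gen_deletions hW gD cub.
split; first exact: fin_gen.
split.
  split=> [[fg dim1]|[fd simps2]].
    by split; [exact/fin_gen|exact: (dim_le1_simps hW gD cub fg dim1)].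
  by split; [exact/fin_gen|exact: (simps_dim_le1 hW gD cub fd simps2)].
split.
  split; first exact: (simplicial_singletons hW gD cub).
  exact: (singletons_simplicial hW gD cub).
split; first exact: (stellar_archimedean hW gD cub).
split; first exact: (stellar_local hW gD cub).
split; first exact: (stellar_subreal hW gD cub).
have total : totally_ordered_ulg G <-> _ := stellar_total cub.
(* The canonical realization serves as witness for the existential form and as instance of the
   universal one. *)
have canon : realization R D0 (W 0%N) iota0.
  apply: (good_realization gD) => [S|x].
    exact: canonical_regular v_uniq v_verts _.
  by rewrite v_verts => /tnthP[i ->]; exact: canonical_den.
have of_nabla m (nabla : set {fset 'rV[rat]_m}) (iota : V -> 'rV[rat]_m) :
    realization R nabla (W 0%N) iota -> csupport R nabla `<=` cube R m ->
    orbit_decides_covers R s nabla iota <-> decided_coords R W s.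
  move=> real cube_nabla; have gN := realization_good real; split.
    by move=> /(decides_decided cube_nabla)/(realization_decided hW real).
  by move=> /(decided_coords_forms hW gN)/(decided_orbit hW gN cube_nabla).
have total_coords : totally_ordered_ulg G <-> decided_coords R W s.
  split; first by move=> /total/(realization_decided hW canon).
  by move=> /(decided_coords_forms hW gD)/total.
split; rewrite total_coords; split.
- by move=> dc; exists n, D0, iota0; split=> //; exact/(of_nabla _ _ _ canon cub).
- by move=> [m [nabla [iota [real cube_nabla dec]]]]; exact/(of_nabla _ _ _ real cube_nabla).
- by move=> dc m nabla iota real cube_nabla; exact/(of_nabla _ _ _ real cube_nabla).
- by move=> dec; apply/(of_nabla _ _ _ canon cub); exact: dec.
Qed.
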